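(* There is a polynomial-time many-one reduction from the problem of query containment of Boolean conjunctive queries (respectively, Boolean positive queries) under access limitations, starting from a given configuration, to the problem of determining whether an access is \emph{not} long-term relevant to a Boolean conjunctive query (respectively, Boolean positive query) in another configuration. In the case of positive queries, the configuration can be chosen to be the same.
   Context: Model. A schema is a finite set of relations, each with a set of attributes; each attribute $a$ has an abstract domain $\mathrm{Dom}(a)$ taken from a countable set of abstract domains (attributes may share a domain; different domains may overlap). An instance $I$ gives a set $I(S)$ of tuples for each relation $S$. A configuration $\mathrm{Conf}$ is a subset of some instance (relation by relation); it is consistent with $I$ if $\mathrm{Conf}\subseteq I$. An access method consists of a relation $R$ and a set of input attributes among the attributes of $R$ (the others are output attributes); each method is either dependent or independent. A relation may have zero, one or several access methods; with none, its content stays that of the initial configuration. An access is an access method together with a binding $\mathrm{Bind}$ of values to its input attributes. The active domain of $\mathrm{Conf}$ is the set of pairs (constant, abstract domain) such that the constant occurs in $\mathrm{Conf}$ at an attribute with that domain. An access is well-formed at $\mathrm{Conf}$ if its method is independent, or its method is dependent and each bound value, paired with the domain of its input attribute, is in the active domain of $\mathrm{Conf}$. A well-formed access to $R$ with binding $\mathrm{Bind}$ at $\mathrm{Conf}$ on an instance $I\supseteq\mathrm{Conf}$ leads, non-deterministically, to any configuration $\mathrm{Conf}\cup\mathrm{Resp}$ where the response $\mathrm{Resp}$ is any set of tuples of $I(R)$ agreeing with $\mathrm{Bind}$ on the input attributes (accesses are sound but not necessarily exact). A configuration is reachable from $\mathrm{Conf}$ if some sequence of well-formed accesses (on some instance consistent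 with $\mathrm{Conf}$) can lead from $\mathrm{Conf}$ to it. Queries. Conjunctive queries (CQs) are existentially quantified conjunctions of atoms; positive queries (PQs) are first-order formulas without universal quantifiers or negation. A variable occurring in several attributes requires these to have the same abstract domain, and all constants of a query are assumed to be present in the configuration. A Boolean query is certain at $\mathrm{Conf}$ if it is true in every instance consistent with $\mathrm{Conf}$. Containment. $Q_1$ is contained in $Q_2$ under a set $\mathrm{ACS}$ of access methods starting from $\mathrm{Conf}$, written $Q_1\sqsubseteq_{\mathrm{ACS},\mathrm{Conf}}Q_2$, if $Q_1(\mathrm{Conf}')\subseteq Q_2(\mathrm{Conf}')$ for every configuration $\mathrm{Conf}'$ reachable from $\mathrm{Conf}$. The containment problem takes as input the schema, $\mathrm{ACS}$, $\mathrm{Conf}$, $Q_1$ and $Q_2$. Long-term relevance. A path from an access $\alpha_1$ starting from $\mathrm{Conf}$ on $I$ is a sequence $\mathrm{Conf}_1,\alpha_1,\mathrm{Conf}_2,\alpha_2,\dots,\alpha_{n-1},\mathrm{Conf}_n$ with $\mathrm{Conf}_1=\mathrm{Conf}$ and each $\mathrm{Conf}_{i+1}=\mathrm{Conf}_i\cup\mathrm{Resp}_i$ a successor configuration of the well-formed access $\alpha_i$ at $\mathrm{Conf}_i$ on $I$. Its truncated path drops $\alpha_1$ and performs $\alpha_2,\dots,\alpha_i$ with the same responses, $\mathrm{Conf}'_1=\mathrm{Conf}_1$, $\mathrm{Conf}'_j=\mathrm{Conf}'_{j-1}\cup\mathrm{Resp}_j$, where $i$ is maximal such that every $\alpha_j$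 ($2\le j\le i$) is well-formed at $\mathrm{Conf}'_{j-1}$. The access $\alpha_1$ is long-term relevant for a Boolean query $Q$ at $\mathrm{Conf}$ if for some instance $I$ consistent with $\mathrm{Conf}$ and some path $p$ beginning with $\alpha_1$, $Q$ is certain at the final configuration of $p$ but not at the final configuration of its truncated path. The long-term relevance problem takes as input the schema, the access methods, the configuration, the (well-formed) access and the query. *)

(* Defs.v *)
From mathcomp Require Import all_boot.
From mathcomp Require Import classical_sets.

Set Implicit Arguments.
Unset Strict Implicit.
Unset Printing Implicit Defensive.

Local Open Scope classical_set_scope.

(** * Polynomial time

   The machine model is the WHILE language over binary trees (N. D. Jones,
   "Computability and Complexity from a Programming Perspective").  Evaluating
   an expression is charged the sum of the sizes of the values of all its
   subexpressions, rather than one unit per operation: with unit costs,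
   iterating [x := Cons x x] would build a tree of exponential size in linear
   time.  With this charge a Turing machine simulates a run of cost t in time
   polynomial in t and the size of the input, and a Turing machine step is
   simulated at a cost linear in the size of the tape contents (two lists), so
   the functions computable in polynomial time are the usual ones. *)

Inductive tree := Leaf | Node of tree & tree.

Fixpoint tsize (t : tree) : nat :=
  if t is Node l r then (tsize l + tsize r).+1 else 1.

Definition store := nat -> tree.

Inductive expr :=
  | Get of nat
  | Nil
  | Cons of expr & expr
  | Head of expr
  | Tail of expr.

Fixpoint eval (s : store) (e : expr) : tree :=
  match e with
  | Get x => s x
  | Nil => Leaf
  | Cons e1 e2 => Node (eval s e1) (eval s e2)
  | Head e1 => if eval s e1 is Node l _ then l else Leaf
  | Tail e1 => if eval s e1 is Node _ r then r else Leaf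
  end.

Fixpoint ecost (s : store) (e : expr) : nat :=
  tsize (eval s e) +
  match e with
  | Get _ | Nil => 0
  | Cons e1 e2 => ecost s e1 + ecost s e2
  | Head e1 | Tail e1 => ecost s e1
  end.

Inductive cmd :=
  | Assign of nat & expr
  | Seq of cmd & cmd
  | If of expr & cmd & cmd
  | While of expr & cmd.

Definition upd (s : store) (x : nat) (t : tree) : store :=
  fun y => if y == x then t else s y.

(* [exec c s n s']: run from [s], [c] halts in [s'] at cost [n]. [Leaf] is the
   truth value false, every other tree is true. *)
Inductive exec : cmd -> store -> nat -> store -> Prop :=
  | ExecAssign x e s :
      exec (Assign x e) s (ecost s e) (upd s x (eval s e))
  | ExecSeq c1 c2 s s1 s2 n1 n2 :
      exec c1 s n1 s1 -> exec c2 s1 n2 s2 ->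
      exec (Seq c1 c2) s (n1 + n2) s2
  | ExecIfTrue e c1 c2 s s1 n :
      eval s e <> Leaf -> exec c1 s n s1 ->
      exec (If e c1 c2) s (ecost s e + n) s1
  | ExecIfFalse e c1 c2 s s1 n :
      eval s e = Leaf -> exec c2 s n s1 ->
      exec (If e c1 c2) s (ecost s e + n) s1
  | ExecWhileTrue e c s s1 s2 n1 n2 :
      eval s e <> Leaf -> exec c s n1 s1 -> exec (While e c) s1 n2 s2 ->
      exec (While e c) s (ecost s e + n1 + n2) s2
  | ExecWhileFalse e c s :
      eval s e = Leaf -> exec (While e c) s (ecost s e) s.

Definition input_store (t : tree) : store := fun x => if x == 0 then t else Leaf.

Record problem := Problem {
  input : Type;
  code : input -> tree;
  valid : input -> Prop;
  yes : input -> Prop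
}.

(* Input and output are in variable 0.  Any polynomial bound is of the form
   [k * n ^ k + k] up to increasing it. *)
Definition polytime (P P' : problem) (f : input P -> input P') : Prop :=
  exists (c : cmd) (k : nat), forall x : input P, valid x ->
    exists n s, [/\ exec c (input_store (code x)) n s,
                    s 0 = code (f x)
                  & n <= k * tsize (code x) ^ k + k].

Definition many_one_reduction (P P' : problem) (f : input P -> input P') : Prop :=
  forall x : input P, valid x -> valid (f x) /\ (yes x <-> yes (f x)).

Definition polytime_reduction (P P' : problem) (f : input P -> input P') : Prop :=
  polytime f /\ many_one_reduction f.

(** * Schemas, configurations, access methods *)

(* Names of relations, abstract domains, constants and variables are all bit
   strings; abstract domains are only names, and any constant may occur at an
   attribute of any abstract domain. *)
Definition name := seq bool.

(* Attributes are positional: a relation comes with the list of the abstract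
   domains of its attributes. *)
Definition schema := seq (name * seq name).

Definition wf_schema (S : schema) : bool := uniq (unzip1 S).

Definition fact : Type := (name * seq name)%type.

Definition is_instance (S : schema) (I : set fact) : Prop :=
  forall R t, I (R, t) -> exists2 ds, (R, ds) \in S & size t = size ds.

Definition active_domain (S : schema) (K : set fact) : set (name * name) :=
  [set p | exists R t ds, [/\ K (R, t), (R, ds) \in S & p \in zip t ds]].

(* ((relation, input mask), dependent?): the i-th attribute is an input
   attribute iff the i-th bit of the mask is set. *)
Definition access_method : Type := (name * seq bool * bool)%type.
Definition am_rel (m : access_method) : name := m.1.1.
Definition am_inputs (m : access_method) : seq bool := m.1.2.
Definition am_dependent (m : access_method) : bool := m.2.

Definition wf_method (S : schema) (m : access_method) : Prop :=
  exists2 ds, (am_rel m, ds) \in S & size (am_inputs m) = size ds.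

(* The binding lists the values of the input attributes in increasing order. *)
Definition access : Type := (access_method * seq name)%type.

Definition is_access (ACS : seq access_method) (a : access) : Prop :=
  a.1 \in ACS /\ size a.2 = count id (am_inputs a.1).

Definition well_formed (S : schema) (K : set fact) (a : access) : Prop :=
  am_dependent a.1 ->
  forall ds, (am_rel a.1, ds) \in S ->
  forall p, p \in zip a.2 (mask (am_inputs a.1) ds) -> active_domain S K p.

Definition is_response (I : set fact) (a : access) (Resp : set fact) : Prop :=
  forall R t, Resp (R, t) ->
    [/\ I (R, t), R = am_rel a.1 & mask (am_inputs a.1) t = a.2].

(* A sequence of accesses with their responses; the configurations visited are
   determined by the first one. *)
Definition trace := seq (access * set fact).

Fixpoint well_formed_trace (S : schema) (K : set fact) (p : trace) : Prop :=
  if p is (a, Resp) :: p' then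
    well_formed S K a /\ well_formed_trace S (K `|` Resp) p'
  else True.

Definition is_path (S : schema) (ACS : seq access_method) (I K : set fact)
    (p : trace) : Prop :=
  well_formed_trace S K p /\
  forall i, i < size p -> forall a Resp, onth p i = Some (a, Resp) ->
    is_access ACS a /\ is_response I a Resp.

Fixpoint final (K : set fact) (p : trace) : set fact :=
  if p is (_, Resp) :: p' then final (K `|` Resp) p' else K.

Definition reachable (S : schema) (ACS : seq access_method)
    (K K' : set fact) : Prop :=
  exists I p, [/\ is_instance S I, K `<=` I, is_path S ACS I K p
                & K' = final K p].

(** * Queries *)

Inductive term := Var of name | Cst of name.

Inductive query :=
  | Atom of name & seq term
  | And of query & query
  | Or of query & query
  | Ex of name & query.

Definition tval (v : name -> name) (u : term) : name :=
  match u with Var x => v x | Cst c => c end.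

Fixpoint sat (K : set fact) (v : name -> name) (q : query) : Prop :=
  match q with
  | Atom R us => K (R, map (tval v) us)
  | And q1 q2 => sat K v q1 /\ sat K v q2
  | Or q1 q2 => sat K v q1 \/ sat K v q2
  | Ex x q1 => exists c, sat K (fun y => if y == x then c else v y) q1
  end.

(* For Boolean queries, which have no free variable, the initial valuation is
   irrelevant. *)
Definition holds (K : set fact) (q : query) : Prop := sat K (fun=> [::]) q.

(* [G] gives the abstract domains of the free variables. *)
Fixpoint typed (S : schema) (G : name -> option name) (q : query) : Prop :=
  match q with
  | Atom R us => exists2 ds, (R, ds) \in S &
      all2 (fun u d => if u is Var x then G x == Some d else true) us ds
  | And q1 q2 | Or q1 q2 => typed S G q1 /\ typed S G q2
  | Ex x q1 => exists d, typed S (fun y => if y == x then Some d else G y) q1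
  end.

Fixpoint constants (q : query) : seq name :=
  match q with
  | Atom _ us => pmap (fun u => if u is Cst c then Some c else None) us
  | And q1 q2 | Or q1 q2 => constants q1 ++ constants q2
  | Ex _ q1 => constants q1
  end.

Fixpoint is_conjunction (q : query) : bool :=
  match q with
  | Atom _ _ => true
  | And q1 q2 => is_conjunction q1 && is_conjunction q2
  | _ => false
  end.

Fixpoint is_cq (q : query) : bool :=
  if q is Ex _ q1 then is_cq q1 else is_conjunction q.

(* The type [query] has neither negation nor universal quantification. *)
Definition is_pq (q : query) : bool := true.

Definition wf_boolean_query (S : schema) (Conf : seq fact) (q : query) : Prop :=
  typed S (fun=> None) q /\ {subset constants q <= flatten (unzip2 Conf)}.

Definition certain (S : schema) (K : set fact) (q : query) : Prop :=
  forall I, is_instance S I -> K `<=` I -> holds I q.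

(** * Containment and long-term relevance *)

Definition contained (S : schema) (ACS : seq access_method) (K : set fact)
    (q1 q2 : query) : Prop :=
  forall K', reachable S ACS K K' -> holds K' q1 -> holds K' q2.

(* [p'] is the truncated path of the path that continues its first access,
   made at [K], with the accesses of [p]. *)
Definition truncation (S : schema) (K : set fact) (p p' : trace) : Prop :=
  exists i, [/\ i <= size p, p' = take i p, well_formed_trace S K p'
    & forall j, j <= size p -> well_formed_trace S K (take j p) -> j <= i].

Definition long_term_relevant (S : schema) (ACS : seq access_method)
    (K : set fact) (a : access) (q : query) : Prop :=
  exists I Resp p p',
    [/\ is_instance S I /\ K `<=` I,
        is_path S ACS I K ((a, Resp) :: p),
        truncation S K p p',
        certain S (final K ((a, Resp) :: p)) q
      & ~ certain S (final K p') q].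

(** * The two decision problems *)

Section Codes.
Variables (A B : Type) (cA : A -> tree) (cB : B -> tree).

Definition code_pair (x : A * B) : tree := Node (cA x.1) (cB x.2).

Fixpoint code_seq (s : seq A) : tree :=
  if s is x :: s' then Node (cA x) (code_seq s') else Leaf.

End Codes.

Definition code_bool (b : bool) : tree := if b then Node Leaf Leaf else Leaf.

Definition code_name : name -> tree := code_seq code_bool.

Definition code_fact : fact -> tree := code_pair code_name (code_seq code_name).

Definition code_schema : schema -> tree :=
  code_seq (code_pair code_name (code_seq code_name)).

Definition code_method : access_method -> tree :=
  code_pair (code_pair code_name (code_seq code_bool)) code_bool.

Definition code_access : access -> tree :=
  code_pair code_method (code_seq code_name).

Definition code_term (u : term) : tree :=
  match u with
  | Var x => Node (code_bool false) (code_name x)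
  | Cst c => Node (code_bool true) (code_name c)
  end.

Fixpoint code_query (q : query) : tree :=
  match q with
  | Atom R us => Node (code_seq code_bool [:: false; false])
                      (Node (code_name R) (code_seq code_term us))
  | And q1 q2 => Node (code_seq code_bool [:: false; true])
                      (Node (code_query q1) (code_query q2))
  | Or q1 q2 => Node (code_seq code_bool [:: true; false])
                     (Node (code_query q1) (code_query q2))
  | Ex x q1 => Node (code_seq code_bool [:: true; true])
                    (Node (code_name x) (code_query q1))
  end.

Definition wf_setting (S : schema) (ACS : seq access_method) (Conf : seq fact)
    : Prop :=
  [/\ wf_schema S, forall m, m \in ACS -> wf_method S m
    & is_instance S [set` Conf]].

Record containment_input := ContainmentInput {
  cont_schema : schema;
  cont_methods : seq access_method;
  cont_conf : seq fact;
  cont_query1 : query;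
  cont_query2 : query
}.

Definition code_containment (x : containment_input) : tree :=
  Node (code_schema (cont_schema x))
 (Node (code_seq code_method (cont_methods x))
 (Node (code_seq code_fact (cont_conf x))
 (Node (code_query (cont_query1 x)) (code_query (cont_query2 x))))).

(* [L] selects the query language. *)
Definition containment (L : query -> bool) : problem := {|
  input := containment_input;
  code := code_containment;
  valid := fun x =>
    [/\ wf_setting (cont_schema x) (cont_methods x) (cont_conf x),
        L (cont_query1 x) /\ L (cont_query2 x),
        wf_boolean_query (cont_schema x) (cont_conf x) (cont_query1 x)
      & wf_boolean_query (cont_schema x) (cont_conf x) (cont_query2 x)];
  yes := fun x =>
    contained (cont_schema x) (cont_methods x) [set` cont_conf x]
              (cont_query1 x) (cont_query2 x)
|}.

Record relevance_input := RelevanceInput {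
  rel_schema : schema;
  rel_methods : seq access_method;
  rel_conf : seq fact;
  rel_access : access;
  rel_query : query
}.

Definition code_relevance (x : relevance_input) : tree :=
  Node (code_schema (rel_schema x))
 (Node (code_seq code_method (rel_methods x))
 (Node (code_seq code_fact (rel_conf x))
 (Node (code_access (rel_access x)) (code_query (rel_query x))))).

Definition non_relevance (L : query -> bool) : problem := {|
  input := relevance_input;
  code := code_relevance;
  valid := fun x =>
    [/\ wf_setting (rel_schema x) (rel_methods x) (rel_conf x),
        is_access (rel_methods x) (rel_access x),
        well_formed (rel_schema x) [set` rel_conf x] (rel_access x),
        L (rel_query x)
      & wf_boolean_query (rel_schema x) (rel_conf x) (rel_query x)];
  yes := fun x =>
    ~ long_term_relevant (rel_schema x) (rel_methods x) [set` rel_conf x]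
                         (rel_access x) (rel_query x)
|}.

(* Main.v *)
(* Positive queries.  Let A be a fresh relation without attributes, accessed by
   the first access.  It makes no value accessible, so that the truncated path
   is the whole path without its first access; hence that access is relevant to
   Q2 \/ (Q1 /\ A) iff some reachable configuration satisfies Q1 but not Q2.

   Conjunctive queries.  The query Q1 /\ (A \/ Q2) is coded without disjunction
   by adding to each relation a tag attribute, 1 for the real facts: Q2 is
   evaluated at an existentially quantified tag, and dummy facts of tag 0 filled
   with a new value bot make it true at tag 0.  A table of the configuration
   expresses that one of several tags, or that of A, is 1.  Three obstacles have
   to be overcome.
   - Dummy facts, and other facts of tag 0 obtained through accesses, provide
     values that ought not to be accessible.  For any two attributes of the same
     domain, the query that some value occurs in a fact of tag 0 at the former
     and in a fact of tag 1 at the latter is thus added to the disjunction.  If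
     none of them holds, then the facts of tag 1 have been obtained from facts of
     tag 1 only.
   - An access must not choose other tags than 0 and 1.  So the tag is an input
     attribute of all methods, which all become dependent, the independent ones
     losing their other input attributes.
   - A constant c of Q2 cannot occur in dummy facts, as this would make it
     accessible.  It is replaced by a variable z with an atom M(z, c), where M is
     a new relation that depends on the attribute and contains the dummy facts
     M(bot, c); a tuple can be added to M only if its values are accessible
     already.  The facts M(c, c) are required along with Q1 for each c that
     occurs at the same domain in Q1 or in the configuration.  Any other constant
     of Q2 may be renamed at its domain in a counterexample to containment, since
     neither Q1 nor the configuration has it there. *)

Require Import Defs.
From HB Require Import structures.
From mathcomp Require Import all_boot.
From mathcomp Require Import boolp classical_sets zify.
(* [tsize] is also a notation of the library for the size of tuples. *)
Import Defs.

Set Implicit Arguments.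
Unset Strict Implicit.
Unset Printing Implicit Defensive.

(** * Polynomial-time functions on trees *)

(** The base [n.+1] is at least 2 for positive [n], so that the exponent alone absorbs constants and
    sums. *)
Definition ispoly (p : nat -> nat) : Prop :=
  exists k, forall n, 0 < n -> p n <= n.+1 ^ k.


Lemma leq_powl k m n : m <= n -> m ^ k <= n ^ k.
Proof. by case: k => [|k] mn; rewrite ?expn0 ?leq_exp2r. Qed.

Lemma ispoly_const c : ispoly (fun=> c).
Proof.
exists c => n n_gt0; apply: leq_trans (ltnW (ltn_expl c (ltnSn 1))) _.
exact: leq_powl.
Qed.

Lemma ispoly_id : ispoly id.
Proof. by exists 1 => n _; rewrite expn1. Qed.

Lemma ispolyD p q : ispoly p -> ispoly q -> ispoly (fun n => p n + q n).
Proof.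
move=> [j pj] [k qk]; exists (maxn j k).+1 => n n_gt0.
rewrite expnS; apply: (@leq_trans (2 * n.+1 ^ maxn j k)); last exact: leq_mul.
rewrite mul2n -addnn; apply: leq_add.
  by apply: leq_trans (pj _ n_gt0) _; rewrite leq_pexp2l ?leq_maxl.
by apply: leq_trans (qk _ n_gt0) _; rewrite leq_pexp2l ?leq_maxr.
Qed.

Lemma ispolyM p q : ispoly p -> ispoly q -> ispoly (fun n => p n * q n).
Proof.
move=> [j pj] [k qk]; exists (j + k) => n n_gt0.
by rewrite expnD leq_mul ?pj ?qk.
Qed.

Lemma ispolyS p : ispoly p -> ispoly (fun n => (p n).+1).
Proof.
move=> pp; have [k kP] := ispolyD pp (ispoly_const 1).
by exists k => n /kP; rewrite addn1.
Qed.

Lemma ispolyX p k : ispoly p -> ispoly (fun n => p n ^ k).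
Proof.
move=> pp; elim: k => [|k IHk]; first exact: ispoly_const 1.
by have [j jP] := ispolyM pp IHk; exists j => n /jP; rewrite expnS.
Qed.

Ltac poly := repeat first [exact: ispoly_id | exact: ispoly_const
  | apply: ispolyS | apply: ispolyX | apply: ispolyD | apply: ispolyM].

Lemma tsize_gt0 t : 0 < tsize t.
Proof. by case: t. Qed.

(* The program may be placed at any register [r], from which it reads its
   argument and to which it writes its result, using the registers above [r] as
   scratch space whatever they contain. *)
Definition ptime (f : tree -> tree) : Prop :=
  exists (c : nat -> cmd) (p : nat -> nat), ispoly p /\ forall r s,
    exists n s', [/\ exec (c r) s n s', s' r = f (s r),
      forall i, i < r -> s' i = s i,
      n <= p (tsize (s r)) & tsize (f (s r)) <= p (tsize (s r))].

Lemma ptimeP f : ptime f ->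
  exists (c : nat -> cmd) k, forall r s,
    exists n s', [/\ exec (c r) s n s', s' r = f (s r),
      forall i, i < r -> s' i = s i,
      n <= (tsize (s r)).+1 ^ k & tsize (f (s r)) <= (tsize (s r)).+1 ^ k].
Proof.
move=> [c [p [[k kP] cP]]]; exists c, k => r s.
have [n [s' [? ? ? ? ?]]] := cP r s; exists n, s'; split=> //.
  exact: leq_trans (kP _ (tsize_gt0 _)).
exact: leq_trans (kP _ (tsize_gt0 _)).
Qed.

Lemma ptime_ext f g : f =1 g -> ptime f -> ptime g.
Proof.
move=> fg [c [p [pp cP]]]; exists c, p; split=> // r s.
by have [n [s' [? ? ? ? ?]]] := cP r s; exists n, s'; rewrite -fg.
Qed.

Lemma ptime_size f : ptime f ->
  exists k, forall t, tsize (f t) <= (tsize t).+1 ^ k.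
Proof.
move=> /ptimeP [c [k cP]]; exists k => t.
by have [n [s' []]] := cP 0 (fun=> t).
Qed.

Lemma ptime_id : ptime id.
Proof.
exists (fun r => Assign r (Get r)), id; split=> [|r s]; first by poly.
exists (tsize (s r)), (upd s r (s r)); split=> //.
- by rewrite -[X in exec _ _ X _]addn0; exact: (ExecAssign r (Get r) s).
- by rewrite /upd eqxx.
- by move=> i ir; rewrite /upd ltn_eqF.
Qed.

Lemma ptime_comp f g : ptime f -> ptime g -> ptime (fun t => f (g t)).
Proof.
move=> /ptimeP [c [j cP]] /ptimeP [d [k dP]].
exists (fun r => Seq (d r) (c r)), (fun n => n.+1 ^ k + (n.+1 ^ k).+1 ^ j).
split=> [|r s]; first by poly.
have [m [s1 [ex1 s1r fr1 m_le g_le]]] := dP r s.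
have [n [s2 [ex2 s2r fr2 n_le f_le]]] := cP r s1.
exists (m + n), s2; rewrite -s1r; split=> //.
- exact: ExecSeq ex1 ex2.
- by move=> i ir; rewrite fr2 ?fr1.
- by apply: leq_add => //; apply: leq_trans n_le _; rewrite s1r leq_powl.
- apply: leq_trans f_le _; apply: leq_trans (leq_addl _ _).
  by rewrite s1r leq_powl.
Qed.

Lemma ptime_expr (e : nat -> expr) f p : ispoly p ->
    (forall r s, [/\ eval s (e r) = f (s r) & ecost s (e r) <= p (tsize (s r))]) ->
  ptime f.
Proof.
move=> pp eP; exists (fun r => Assign r (e r)), p; split=> // r s.
have [ev cost] := eP r s.
exists (ecost s (e r)), (upd s r (f (s r))); split=> //.
- by rewrite -ev; constructor.
- by rewrite /upd eqxx.
- by move=> i ir; rewrite /upd ltn_eqF.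
(* The cost of an expression includes the size of its value. *)
- by apply: leq_trans cost; rewrite -ev; case: (e r) => *; exact: leq_addr.
Qed.

Definition thd (t : tree) : tree := if t is Node l _ then l else Leaf.
Definition ttl (t : tree) : tree := if t is Node _ r then r else Leaf.

Lemma tsize_thd t : tsize (thd t) <= tsize t.
Proof. by case: t => //= t u; rewrite leqW ?leq_addr. Qed.

Lemma tsize_ttl t : tsize (ttl t) <= tsize t.
Proof. by case: t => //= t u; rewrite leqW ?leq_addl. Qed.

Lemma ptime_thd f : ptime f -> ptime (fun t => thd (f t)).
Proof.
apply: ptime_comp; apply: (@ptime_expr (fun r => Head (Get r)) _ (fun n => n + n)).
  by poly.
move=> r s; split=> //=; rewrite addn0 leq_add2r.
exact: tsize_thd.
Qed.

Lemma ptime_ttl f : ptime f -> ptime (fun t => ttl (f t)).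
Proof.
apply: ptime_comp; apply: (@ptime_expr (fun r => Tail (Get r)) _ (fun n => n + n)).
  by poly.
move=> r s; split=> //=; rewrite addn0 leq_add2r.
exact: tsize_ttl.
Qed.

Fixpoint quote (t : tree) : expr :=
  if t is Node l r then Cons (quote l) (quote r) else Nil.

Lemma eval_quote s t : eval s (quote t) = t.
Proof. by elim: t => //= l -> r ->. Qed.

Lemma ptime_const u : ptime (fun=> u).
Proof.
apply: (@ptime_expr (fun=> quote u) _ (fun=> ecost (fun=> Leaf) (quote u))).
  by poly.
move=> r s; rewrite eval_quote; split=> //.
by elim: u => //= l IHl r' IHr; rewrite !eval_quote leq_add // leq_add.
Qed.

(** The argument stays in register [r] while [f] runs at [r.+1] and [g] at [r.+2], each on a copy of
    it; this works because programs preserve the lower registers. *)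
Lemma ptime_node f g : ptime f -> ptime g -> ptime (fun t => Node (f t) (g t)).
Proof.
move=> /ptimeP [c [j cP]] /ptimeP [d [k dP]].
exists (fun r => Seq (Assign r.+1 (Get r)) (Seq (c r.+1)
  (Seq (Assign r.+2 (Get r)) (Seq (d r.+2)
    (Assign r (Cons (Get r.+1) (Get r.+2))))))).
exists (fun n => n + (n.+1 ^ j + (n + (n.+1 ^ k +
  ((n.+1 ^ j + n.+1 ^ k).+1 + (n.+1 ^ j + n.+1 ^ k)))))).
split=> [|r s]; first by poly.
pose s0 := upd s r.+1 (s r).
have s0r : s0 r.+1 = s r by rewrite /s0 /upd eqxx.
have [m [s1 [ex1 s1r fr1 m_le]]] := cP r.+1 s0; rewrite s0r in s1r m_le * => fle.
have s1r0 : s1 r = s r by rewrite fr1 // /s0 /upd ltn_eqF.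
pose s2 := upd s1 r.+2 (s r).
have s2r : s2 r.+2 = s r by rewrite /s2 /upd eqxx.
have [n [s3 [ex3 s3r fr3 n_le]]] := dP r.+2 s2; rewrite s2r in s3r n_le * => gle.
have s3r1 : s3 r.+1 = f (s r) by rewrite fr3 // /s2 /upd ltn_eqF.
have ex0 := ExecAssign r.+1 (Get r) s.
have ex2 := ExecAssign r.+2 (Get r) s1.
have ex4 := ExecAssign r (Cons (Get r.+1) (Get r.+2)) s3.
rewrite /= s1r0 addn0 in ex2; rewrite /= addn0 in ex0.
rewrite /= s3r1 s3r !addn0 in ex4.
exists (tsize (s r) + (m + (tsize (s r) + (n + ((tsize (f (s r)) + tsize (g (s r))).+1 +
  (tsize (f (s r)) + tsize (g (s r)))))))), (upd s3 r (Node (f (s r)) (g (s r)))).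
split.
- exact: (ExecSeq ex0 (ExecSeq ex1 (ExecSeq ex2 (ExecSeq ex3 ex4)))).
- by rewrite /upd eqxx.
- move=> i ir; rewrite /upd (ltn_eqF ir) fr3 ?(ltn_trans ir) //.
  rewrite /s2 /upd (ltn_eqF (ltn_trans ir _)) // fr1 ?(ltn_trans ir) //.
  by rewrite /s0 /upd (ltn_eqF (ltn_trans ir _)).
- by rewrite !leq_add // ltnS leq_add.
- do 4![apply: leq_trans (leq_addl _ _)]; apply: leq_trans (leq_addr _ _).
  by rewrite /= ltnS leq_add.
Qed.

Definition tif (c a b : tree) : tree := if c is Node _ _ then a else b.

(** The condition is first paired with the argument, so that one register carries both to the test;
    either branch begins by dropping the condition. *)
Lemma ptime_if h f g : ptime h -> ptime f -> ptime g ->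
  ptime (fun t => tif (h t) (f t) (g t)).
Proof.
move=> ph /ptimeP [c [j cP]] /ptimeP [d [k dP]].
pose F t := tif (thd t) (f (ttl t)) (g (ttl t)).
suff pF : ptime F.
  apply: (@ptime_ext (fun t => F (Node (h t) t))) => //.
  by apply: (@ptime_comp F) => //; apply: ptime_node ptime_id.
exists (fun r => If (Head (Get r)) (Seq (Assign r (Tail (Get r))) (c r))
                                   (Seq (Assign r (Tail (Get r))) (d r))).
exists (fun n => (n + n) + ((n + n) + (n.+1 ^ j + n.+1 ^ k))).
split=> [|r s]; first by poly.
have exh := ExecAssign r (Tail (Get r)) s.
set s1 := upd _ _ _ in exh.
have s1r : s1 r = ttl (s r) by rewrite /s1 /upd eqxx.
have fr i : i < r -> s1 i = s i by move=> ir; rewrite /s1 /upd ltn_eqF.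
have costh : ecost s (Head (Get r)) <= tsize (s r) + tsize (s r).
  by rewrite /= addn0 leq_add2r tsize_thd.
have costt : ecost s (Tail (Get r)) <= tsize (s r) + tsize (s r).
  by rewrite /= addn0 leq_add2r tsize_ttl.
have [m [s2 [ex2 s2r fr2 m_le f_le]]] := cP r s1.
have [n [s3 [ex3 s3r fr3 n_le g_le]]] := dP r s1.
rewrite s1r in s2r s3r m_le f_le n_le g_le.
have pw i : (tsize (ttl (s r))).+1 ^ i <= (tsize (s r)).+1 ^ i.
  by rewrite leq_powl // ltnS tsize_ttl.
case E: (thd (s r)) => [|a b].
  exists (ecost s (Head (Get r)) + (ecost s (Tail (Get r)) + n)), s3; split.
  - by apply: ExecIfFalse (ExecSeq exh ex3); exact: E.
  - by rewrite /F E.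
  - by move=> i ir; rewrite fr3 ?fr.
  - apply: leq_add costh (leq_add costt _); apply: leq_trans (leq_addl _ _).
    exact: leq_trans n_le (pw _).
  - rewrite /F E /=; do 3![apply: leq_trans (leq_addl _ _)].
    exact: leq_trans g_le (pw _).
exists (ecost s (Head (Get r)) + (ecost s (Tail (Get r)) + m)), s2; split.
- apply: ExecIfTrue; last exact: ExecSeq exh ex2.
  by rewrite /= -/(thd (s r)) E.
- by rewrite /F E.
- by move=> i ir; rewrite fr2 ?fr.
- apply: leq_add costh (leq_add costt _); apply: leq_trans (leq_addr _ _).
  exact: leq_trans m_le (pw _).
- rewrite /F E /=; do 2![apply: leq_trans (leq_addl _ _)].
  by apply: leq_trans (leq_addr _ _); exact: leq_trans f_le (pw _).
Qed.

(** All intermediate states must be bounded, not only the last one, since each run of the body is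
    charged in the size of the state it starts from. *)
Lemma ptime_loop f h g p : ptime f -> ptime h -> ispoly p ->
    (forall t, exists n,
      [/\ n <= p (tsize t), g t = iter n f (h t), thd (g t) = Leaf
      & forall i, i <= n -> (i < n -> thd (iter i f (h t)) <> Leaf)
                            /\ tsize (iter i f (h t)) <= p (tsize t)]) ->
  ptime g.
Proof.
move=> /ptimeP [c [k cP]] /ptimeP [d [l dP]] pp gP.
exists (fun r => Seq (d r) (While (Head (Get r)) (c r))).
exists (fun n => n.+1 ^ l + (p n).+1 * (p n + p n + (p n).+1 ^ k) + p n).
split=> [|r s]; first by poly.
have [n [n_le gE gl itP]] := gP (s r).
have [a [s1 [exd s1r frd a_le _]]] := dP r s.
set P := p _ in n_le itP *.
(* Here [j] is the number of iterations still to be made. *)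
suff loop j s0 : j <= n -> s0 r = iter (n - j) f (h (s r)) ->
    exists m s', [/\ exec (While (Head (Get r)) (c r)) s0 m s', s' r = g (s r),
      forall i, i < r -> s' i = s0 i & m <= j.+1 * (P + P + P.+1 ^ k)].
  have [|m [s' [ex s'r fr m_le]]] := loop n s1 (leqnn _); first by rewrite subnn.
  exists (a + m), s'; split=> //.
  - exact: ExecSeq exd ex.
  - by move=> i ir; rewrite fr ?frd.
  - apply: leq_trans (leq_addr _ _); apply: leq_add => //.
    by apply: leq_trans m_le _; rewrite leq_mul.
  - apply: leq_trans (leq_addl _ _); rewrite gE.
    by have [] := itP n (leqnn n).
elim: j s0 => [|j IHj] s0 jn s0r.
  rewrite subn0 -gE in s0r.
  exists (ecost s0 (Head (Get r))), s0; split=> //.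
    by apply: ExecWhileFalse; rewrite /= -/(thd _) s0r.
  have [_] := itP n (leqnn n); rewrite -gE => g_le.
  rewrite mul1n /= addn0 -/(thd _) s0r; apply: leq_trans (leq_addr _ _).
  by rewrite leq_add // (leq_trans (tsize_thd _)).
have nj : n - j.+1 < n by rewrite ltn_subrL (leq_ltn_trans _ jn).
have [/(_ nj) nl it_le] := itP _ (ltnW nj).
have [m [s2 [ex1 s2r fr1 m_le it1_le]]] := cP r s0.
have s2E : s2 r = iter (n - j) f (h (s r)).
  by rewrite s2r s0r -iterS -subSn // subSS.
have [m' [s3 [ex2 s3r fr2 m'_le]]] := IHj s2 (ltnW jn) s2E.
exists (ecost s0 (Head (Get r)) + m + m'), s3; split=> //.
- by apply: ExecWhileTrue ex1 ex2; rewrite /= -/(thd _) s0r.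
- by move=> i ir; rewrite fr2 ?fr1.
rewrite mulSn leq_add // leq_add //=.
  by rewrite addn0 -/(thd _) s0r leq_add // (leq_trans (tsize_thd _)).
by apply: leq_trans m_le _; rewrite s0r leq_powl.
Qed.

Lemma polytime_of_ptime (P P' : problem) (f : input P -> input P') (F : tree -> tree) :
  ptime F -> (forall x, valid x -> code (f x) = F (code x)) -> polytime f.
Proof.
(* The same number has to serve as coefficient and as exponent; [2 ^ k] comes from bounding
   [m.+1 ^ k] by [(2 * m) ^ k]. *)
move=> /ptimeP [c [k cP]] fF; exists (c 0), (2 ^ k + k) => x vx.
have [n [s [ex s0 _ n_le _]]] := cP 0 (input_store (code x)).
exists n, s; split=> //; first by rewrite s0 fF.
apply: leq_trans n_le _; rewrite /input_store /=.
apply: leq_trans (leq_addr _ _).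
have := tsize_gt0 (code x); move: (tsize _) => m m_gt0.
apply: (@leq_trans ((2 * m) ^ k)).
  by rewrite leq_powl // mul2n -addnn -addn1 leq_add2l.
rewrite expnMn leq_mul ?leq_addr // leq_pexp2l ?leq_addl //.
Qed.

(** * Folds, maps and equality tests on trees that code lists *)

Fixpoint tfold (F : tree -> tree -> tree) (st xs : tree) : tree :=
  if xs is Node _ xs' then tfold F (F xs st) xs' else st.

(** The loop state consists of the remaining list, the environment and the accumulator, in this
    order. *)
Definition tfold_step F (t : tree) : tree :=
  Node (ttl (thd t)) (Node (thd (ttl t)) (F (thd (ttl t)) (thd t) (ttl (ttl t)))).

(** A step may enlarge the accumulator by an amount that depends on the environment and the list
    only; growth by a factor would be compounded to an exponential size. *)
Lemma tfold_iter F k : (forall e xs st,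
    tsize (F e xs st) <= tsize st + (tsize e + tsize xs).+1 ^ k) ->
  forall e xs st, exists n, [/\ n < tsize xs,
    iter n (tfold_step F) (Node xs (Node e st)) =
      Node Leaf (Node e (tfold (F e) st xs))
    & forall i, i <= n ->
      (i < n -> thd (iter i (tfold_step F) (Node xs (Node e st))) <> Leaf) /\
      tsize (iter i (tfold_step F) (Node xs (Node e st))) <=
        tsize xs + tsize e + tsize st + 2 +
        tsize xs * (tsize e + tsize xs).+1 ^ k].
Proof.
move=> Fk e; elim=> [|x _ xs IHxs] st.
  exists 0; split=> // i; rewrite leqn0 => /eqP -> /=; split=> //.
  by rewrite mul1n; apply: leq_trans (leq_addr _ _); rewrite !addnS !addn0 !addSn.
have [n [n_lt itn itP]] := IHxs (F e (Node x xs) st).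
exists n.+1; split; first by rewrite /= ltnS ltn_addl.
  by rewrite iterSr.
case=> [|i] i_le.
  split=> //=; apply: leq_trans (leq_addr _ _).
  by rewrite !addnS !addn0 !addSn addnA.
rewrite iterSr; have [lf sz] := itP i i_le; split=> //.
apply: leq_trans sz _.
have := Fk e (Node x xs) st; set M := (_ + tsize (Node x xs)).+1 ^ k => le.
have leM : (tsize e + tsize xs).+1 ^ k <= M.
  by rewrite leq_powl // ltnS leq_add2l /= leqW // leq_addl.
apply: (@leq_trans (tsize xs + tsize e + (tsize st + M) + 2 + tsize xs * M)).
  by rewrite leq_add ?leq_mul // leq_add2r leq_add2l.
rewrite [tsize (Node x xs)]/= mulSn mulnDl.
by lia.
Qed.

(** The argument [t] travels in the loop state as the environment of the step, and two projections
    remove it at the end. *)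
Lemma ptime_fold F h l k :
    ptime (fun z => F (thd z) (thd (ttl z)) (ttl (ttl z))) ->
    (forall e xs st,
      tsize (F e xs st) <= tsize st + (tsize e + tsize xs).+1 ^ k) ->
    ptime h -> ptime l ->
  ptime (fun t => tfold (F t) (h t) (l t)).
Proof.
move=> pF Fk ph pl.
have [j jP] := ptime_size ph; have [m mP] := ptime_size pl.
apply: (@ptime_ext (fun t => ttl (ttl
  (Node Leaf (Node t (tfold (F t) (h t) (l t))))))) => //.
do 2!apply: ptime_ttl.
pose M n := n.+1 ^ m + n + n.+1 ^ j + 2 + n.+1 ^ m * (n + n.+1 ^ m).+1 ^ k.
apply: (@ptime_loop (tfold_step F) (fun t => Node (l t) (Node t (h t))) _ M).
- apply: ptime_node; first exact/ptime_ttl/ptime_thd/ptime_id.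
  apply: ptime_node; first exact/ptime_thd/ptime_ttl/ptime_id.
  apply: (ptime_comp (f := fun z => F (thd z) (thd (ttl z)) (ttl (ttl z)))
    (g := fun t => Node (thd (ttl t)) (Node (thd t) (ttl (ttl t))))) => //.
  apply: ptime_node; first exact/ptime_thd/ptime_ttl/ptime_id.
  apply: ptime_node; first exact/ptime_thd/ptime_id.
  exact/ptime_ttl/ptime_ttl/ptime_id.
- by do 2?apply: ptime_node => //; exact: ptime_id.
- by poly.
move=> t; have [n [n_lt itn itP]] := tfold_iter Fk t (l t) (h t).
exists n; split=> // [|i /itP [lf sz]].
  by apply: leq_trans (ltnW n_lt) (leq_trans (mP t) _); rewrite /M; lia.
split=> //; apply: leq_trans sz _; rewrite /M.
apply: leq_add; first by have := mP t; have := jP t; lia.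
by rewrite leq_mul // leq_powl // ltnS leq_add2l.
Qed.

(* [B x r] sees an entry [x] of the list together with the entries [r] that
   follow it, whose number serves as the index of [x]. *)
Fixpoint tmap (B : tree -> tree -> tree) (xs : tree) : tree :=
  if xs is Node x r then Node (B x r) (tmap B r) else Leaf.

Fixpoint tfoldr (G : tree -> tree -> tree) (st xs : tree) : tree :=
  if xs is Node x r then G x (tfoldr G st r) else st.

Definition tcat (xs ys : tree) : tree := tfoldr Node ys xs.

Definition tflatten : tree -> tree := tfoldr tcat Leaf.

Definition tcatrev (st xs : tree) : tree := tfold (fun xs => Node (thd xs)) st xs.

(** Loops consume a list from the left, so a right fold is run as a left fold over the reversed
    list. *)
Lemma tfold_catrev G out st xs :
  tfold (fun ys => G (thd ys)) out (tcatrev st xs) =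
  tfold (fun ys => G (thd ys)) (tfoldr G out xs) st.
Proof. by elim: xs st => //= x _ r IHr st; rewrite IHr. Qed.

Lemma ptime_catrev h l : ptime h -> ptime l -> ptime (fun t => tcatrev (h t) (l t)).
Proof.
apply: (@ptime_fold (fun _ xs st => Node (thd xs) st) _ _ 1).
  apply: ptime_node; first exact/ptime_thd/ptime_thd/ptime_ttl/ptime_id.
  exact/ptime_ttl/ptime_ttl/ptime_id.
by move=> e xs st /=; have := tsize_thd xs; rewrite expn1; lia.
Qed.

Lemma ptime_cat l m : ptime l -> ptime m -> ptime (fun t => tcat (l t) (m t)).
Proof.
move=> pl pm; apply: (@ptime_ext (fun t => tcatrev (m t) (tcatrev Leaf (l t)))).
  by move=> t; rewrite [LHS]tfold_catrev.
by do 2?apply: ptime_catrev => //; exact: ptime_const.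
Qed.

(** A first loop accumulates the images in reverse order and a second one reverses them. *)
Lemma ptime_map B l :
    ptime (fun z => B (thd z) (thd (ttl z)) (ttl (ttl z))) -> ptime l ->
  ptime (fun t => tmap (B t) (l t)).
Proof.
move=> pB pl.
pose F e xs st := Node (B e (thd xs) (ttl xs)) st.
apply: (@ptime_ext (fun t => tcatrev Leaf (tfold (F t) Leaf (l t)))) => [t|].
  have -> st xs : tfold (F t) st xs = tcatrev st (tmap (B t) xs).
    by elim: xs st => //= x _ r IHr st; rewrite IHr.
  by rewrite [LHS]tfold_catrev /=; elim: (l t) => //= x _ r ->.
apply: ptime_catrev; first exact: ptime_const.
have [k kP] := ptime_size pB.
have pC : ptime (fun z => B (thd z) (thd (thd (ttl z))) (ttl (thd (ttl z)))).
  apply: (ptime_comp (f := fun z => B (thd z) (thd (ttl z)) (ttl (ttl z)))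
    (g := fun z => Node (thd z) (thd (ttl z)))).
    exact: pB.
  by apply: ptime_node; [exact/ptime_thd/ptime_id|exact/ptime_thd/ptime_ttl/ptime_id].
apply: (@ptime_fold F _ _ (k * 2).+1) => //.
- apply: ptime_node => //.
  exact/ptime_ttl/ptime_ttl/ptime_id.
- move=> e xs st; rewrite /F [tsize (Node _ _)]/= -addSn addnC leq_add2l.
  have /= := kP (Node e (Node (thd xs) (ttl xs))); set b := tsize (B _ _ _) => le.
  set n := tsize e + tsize xs; have n_gt0 : 0 < n by rewrite addn_gt0 tsize_gt0.
  (* [Node (thd xs) (ttl xs)] is larger than [xs] when [xs] is [Leaf]; the square covers this case
     and the added constants. *)
  have : (tsize e + (tsize (thd xs) + tsize (ttl xs)).+1).+2 <= n.+1 ^ 2.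
    rewrite /n -mulnn; have := tsize_gt0 e; case: (xs) => [|? ?] /=; nia.
  move=> /(leq_powl k) le2; have {le2}le : b <= n.+1 ^ (k * 2).
    by rewrite mulnC expnM (leq_trans le).
  have : 0 < n.+1 ^ (k * 2) by rewrite expn_gt0.
  by rewrite expnS; nia.
- exact: ptime_const.
Qed.

Lemma tsize_cat xs ys : tsize (tcat xs ys) <= tsize xs + tsize ys.
Proof. by rewrite /tcat; elim: xs => //= x _ r; lia. Qed.

Lemma ptime_flatten l : ptime l -> ptime (fun t => tflatten (l t)).
Proof.
move=> pl; pose F (e xs st : tree) := tcat (thd xs) st.
apply: (@ptime_ext (fun t => tfold (F t) Leaf (tcatrev Leaf (l t)))) => [t|].
  by rewrite (tfold_catrev tcat).
apply: (@ptime_fold F _ _ 1).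
- apply: ptime_cat; first exact/ptime_thd/ptime_thd/ptime_ttl/ptime_id.
  exact/ptime_ttl/ptime_ttl/ptime_id.
- move=> e xs st; rewrite expn1; have := tsize_cat (thd xs) st.
  by have := tsize_thd xs; rewrite -/(F e xs st); lia.
- exact: ptime_const.
- exact: ptime_catrev (ptime_const _) _.
Qed.

Definition ttrue : tree := Node Leaf Leaf.

(** Compares lists of bits. The state pairs the verdict so far with the unread part of the second
    list; exhausting that list makes the verdict false, and [teq] rejects if some of it is left at
    the end. *)
Definition teq_step (xs st : tree) : tree :=
  Node (tif (ttl st)
         (tif (tif (thd xs) (thd (ttl st)) (tif (thd (ttl st)) Leaf ttrue))
              (thd st) Leaf)
         Leaf)
       (ttl (ttl st)).

Definition teq (a b : tree) : tree :=
  (fun st => tif (ttl st) Leaf (thd st)) (tfold teq_step (Node ttrue b) a).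

Ltac ptime_auto := cbv beta; repeat (cbv beta; first [assumption | lazymatch goal with
  | |- ptime (fun t => t) => apply ptime_id
  | |- ptime (fun _ => ?u) => apply (@ptime_const u)
  | |- ptime (fun t => thd (@?a t)) => apply (@ptime_thd a)
  | |- ptime (fun t => ttl (@?a t)) => apply (@ptime_ttl a)
  | |- ptime (fun t => Node (@?a t) (@?b t)) => apply (@ptime_node a b)
  | |- ptime (fun t => tif (@?a t) (@?b t) (@?c t)) => apply (@ptime_if a b c)
  | |- ptime (fun t => tcat (@?a t) (@?b t)) => apply (@ptime_cat a b)
  | |- ptime (fun t => tflatten (@?a t)) => apply (@ptime_flatten a)
  | |- ptime (fun t => tmap (@?B t) (@?l t)) => apply (@ptime_map B l)
  end]).

Lemma ptime_eq a b : ptime a -> ptime b -> ptime (fun t => teq (a t) (b t)).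
Proof.
move=> pa pb; apply: (ptime_comp (f := fun st => tif (ttl st) Leaf (thd st))
  (g := fun t => tfold teq_step (Node ttrue (b t)) (a t))).
  by ptime_auto.
apply: (@ptime_fold (fun=> teq_step) _ _ 1) => //; last by ptime_auto.
  by rewrite /teq_step; ptime_auto.
move=> e xs st; rewrite expn1 /teq_step /=.
have := tsize_gt0 e; have := tsize_gt0 xs.
case: st => [|ok [|b1 rest]] /=; case: (thd xs) => [|? ?] /=; try lia.
  by case: b1 => [|? ?] /=; lia.
by case: b1 => [|? ?] /=; lia.
Qed.

(* The state is a stack of queries together with the atoms found so far. *)
Definition atoms_step (st : tree) : tree :=
  let q := thd (thd st) in let r := ttl (thd st) in
  tif (thd (thd q))
    (tif (thd (ttl (thd q))) (Node (Node (ttl (ttl q)) r) (ttl st)) (Node r (ttl st)))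
    (tif (thd (ttl (thd q)))
      (Node (Node (thd (ttl q)) (Node (ttl (ttl q)) r)) (ttl st))
      (Node r (Node (ttl q) (ttl st)))).

(** Idling on the empty stack allows [tatoms] to iterate a number of times fixed in advance. *)
Definition atoms_step_idle (st : tree) : tree := tif (thd st) (atoms_step st) st.

(** The number of iterations is the size of the initial stack [Node q Leaf], which every step
    decreases. *)
Definition tatoms (q : tree) : tree :=
  ttl (iter (tsize q).+2 atoms_step_idle (Node (Node q Leaf) Leaf)).

Lemma atoms_step_size st : thd st <> Leaf ->
  tsize (thd (atoms_step st)) < tsize (thd st) /\
  tsize (atoms_step st) <= tsize st.
Proof.
case: st => [|[|q r] out] // _; rewrite /atoms_step /=.
case: q => [|tag body] /=; first by lia.
have := tsize_thd body; have := tsize_ttl body.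
case: (thd tag) => [|? ?] /=; case E: (thd (ttl tag)) => [|? ?] /=; try lia.
(* A tag whose second bit is set is large enough to pay for the two entries pushed on the stack. *)
have : 3 < tsize tag.
  by case: (tag) E => [|? [|[|u1 u2] v]] //= _; have := tsize_gt0 u1;
  have := tsize_gt0 u2; have := tsize_gt0 v; lia.
by case: body => [|b1 b2] /=; lia.
Qed.

(** Relates the fixed number of iterations to a while loop, which stops at the first empty stack. *)
Lemma atoms_iter m st : tsize (thd st) <= m ->
  exists n, [/\ n <= m,
    iter m atoms_step_idle st = iter n atoms_step st,
    thd (iter n atoms_step st) = Leaf
  & forall i, i <= n -> (i < n -> thd (iter i atoms_step st) <> Leaf)
                        /\ tsize (iter i atoms_step st) <= tsize st].
Proof.
elim: m st => [|m IHm] st; first by rewrite leqNgt tsize_gt0.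
move=> st_m; case E: (thd st) => [|u v].
  exists 0; split=> //; last by move=> i; rewrite leqn0 => /eqP ->.
  by elim: (m.+1) => //= j ->; rewrite /atoms_step_idle E.
have [|lt_m le_M] := @atoms_step_size st; first by rewrite E.
have [|n [nm itE itL itP]] := IHm (atoms_step st); first by lia.
exists n.+1; split=> //; first by rewrite iterSr {2}/atoms_step_idle E itE -iterSr.
  by rewrite iterSr.
case=> [|i] i_le; first by rewrite /= E; split.
rewrite iterSr; have [lf sz] := itP i i_le; split=> //.
exact: leq_trans sz le_M.
Qed.

Lemma ptime_atoms q : ptime q -> ptime (fun t => tatoms (q t)).
Proof.
apply: ptime_comp; rewrite /tatoms; apply: ptime_ttl.
apply: (@ptime_loop atoms_step (fun q => Node (Node q Leaf) Leaf) _ (fun n => n + 5)).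
- by rewrite /atoms_step; ptime_auto.
- by ptime_auto.
- by poly.
move=> t; have [|n [nm itE itL itP]] := @atoms_iter (tsize t).+2 (Node (Node t Leaf) Leaf).
  by rewrite /=; lia.
exists n; split=> //; try by rewrite itE.
  by lia.
move=> i /itP [lf sz]; split=> //; apply: leq_trans sz _.
by rewrite /=; lia.
Qed.

(** * Correctness of the tree programs on codes *)

(** Meant for conjunctive queries, hence the dummy value at [Or]. Their quantifiers form a prefix,
    so that dropping them merely leaves all variables to be valued at once. *)
Fixpoint atoms (q : query) : seq (name * seq term) :=
  match q with
  | Atom R us => [:: (R, us)]
  | And q1 q2 => atoms q1 ++ atoms q2
  | Or _ _ => [::]
  | Ex _ q1 => atoms q1
  end.

Lemma tcat_code (T : Type) (c : T -> tree) s1 s2 :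
  tcat (code_seq c s1) (code_seq c s2) = code_seq c (s1 ++ s2).
Proof. by rewrite /tcat; elim: s1 => //= x s ->. Qed.

Lemma tflatten_code (T : Type) (c : T -> tree) ss :
  tflatten (code_seq (code_seq c) ss) = code_seq c (flatten ss).
Proof.
by rewrite /tflatten; elim: ss => //= s ss IHss; rewrite IHss tcat_code.
Qed.

Fixpoint smap (A B : Type) (f : A -> seq A -> B) (s : seq A) : seq B :=
  if s is x :: r then f x r :: smap f r else [::].

Lemma smap_map (A B : Type) (f : A -> B) (s : seq A) : smap (fun x _ => f x) s = map f s.
Proof. by elim: s => //= x s ->. Qed.

Lemma tmap_code (A B : Type) (c : A -> tree) (d : B -> tree) F f s :
    (forall x r, F (c x) (code_seq c r) = d (f x r)) ->
  tmap F (code_seq c s) = code_seq d (smap f s).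
Proof. by move=> Ff; elim: s => //= x s ->; rewrite Ff. Qed.


Lemma teq_code (a b : name) : teq (code_name a) (code_name b) = code_bool (a == b).
Proof.
rewrite /teq /code_name.
have tif_same c u : tif c u u = u by case: c.
(* A false verdict stays false whatever is read afterwards. *)
have stuck a' o : thd (tfold teq_step (Node Leaf o) (code_seq code_bool a')) = Leaf.
  elim: a' o => //= x a' IH o; rewrite {2}/teq_step /=.
  by rewrite !tif_same.
suff H a' b' : tif (ttl (tfold teq_step (Node ttrue (code_seq code_bool b'))
    (code_seq code_bool a'))) Leaf (thd (tfold teq_step
      (Node ttrue (code_seq code_bool b')) (code_seq code_bool a'))) = code_bool (a' == b').
  exact: H.
elim: a' b' => [|x a' IHa] [|y b'] //=.
- by rewrite {2 4}/teq_step /= stuck; case: (ttl _).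
- rewrite {2 4}/teq_step /= eqseq_cons.
  by case: x y => -[] /=; rewrite ?IHa // stuck; case: (ttl _).
Qed.

Lemma atoms_stack q r out :
    let c := code_pair code_name (code_seq code_term) in
  exists n, iter n atoms_step_idle (Node (Node (code_query q) r) (code_seq c out)) =
    Node r (code_seq c (catrev (atoms q) out)).
Proof.
elim: q r out => [R us|q1 IH1 q2 IH2|q1 IH1 q2 IH2|x q IH] r out c.
- by exists 1.
- have [n1 E1] := IH1 (Node (code_query q2) r) out.
  have [n2 E2] := IH2 r (catrev (atoms q1) out).
  exists (n2 + n1).+1; rewrite iterSr iterD [atoms_step_idle _]/= E1 E2 /=.
  by rewrite !catrevE rev_cat catA.
- by exists 1.
- have [n E] := IH r out.
  by exists n.+1; rewrite iterSr.
Qed.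

Lemma tatoms_code q : tatoms (code_query q) =
  code_seq (code_pair code_name (code_seq code_term)) (rev (atoms q)).
Proof.
rewrite /tatoms; set st := Node (Node _ _) _.
have [|n [_ itE itL _]] := @atoms_iter (tsize (code_query q)).+2 st.
  by rewrite /=; lia.
have [m mE] := atoms_stack q Leaf [::]; rewrite -[code_seq _ [::]]/Leaf -/st in mE.
(* Both iteration counts lead to an empty stack, where further steps change nothing; hence both
   results equal the one for the sum of the counts. *)
have idle k l : thd (iter k atoms_step_idle st) = Leaf ->
    iter (l + k) atoms_step_idle st = iter k atoms_step_idle st.
  move=> kL; rewrite iterD; elim: l => //= l ->.
  by rewrite /atoms_step_idle kL.
rewrite -itE in itL; rewrite -(idle _ m itL) addnC idle mE //=.
Qed.

(** * Paths and positive queries *)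

Local Open Scope classical_set_scope.

(** A form of [is_path] without indices, suited to induction on the path. *)
Fixpoint path_ok (S : schema) (ACS : seq access_method) (I K : set fact)
    (p : trace) : Prop :=
  if p is (a, Resp) :: p' then
    [/\ is_access ACS a, is_response I a Resp, well_formed S K a
      & path_ok S ACS I (K `|` Resp) p']
  else True.

Lemma is_pathE S ACS I K p : is_path S ACS I K p <-> path_ok S ACS I K p.
Proof.
elim: p K => [|[a Resp] p IHp] K /=; first by split=> // _; split.
split=> [[[wfa wfp] acc]|[acca respa wfa /IHp [wfp accp]]].
  have [acca respa] := acc 0 isT a Resp erefl.
  by split=> //; apply/IHp; split=> // i; exact: (acc i.+1).
by split=> // -[_ b Resp' [<- <-]|i /accp].
Qed.

Lemma path_ok_trace S ACS I K p : path_ok S ACS I K p -> well_formed_trace S K p.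
Proof. by move=> /is_pathE []. Qed.

Lemma active_domainS S K K' : K `<=` K' -> active_domain S K `<=` active_domain S K'.
Proof. by move=> KK' p [R [t [ds [/KK' ? ? ?]]]]; exists R, t, ds. Qed.

Lemma active_domainU S K K' :
  active_domain S (K `|` K') = active_domain S K `|` active_domain S K'.
Proof.
apply/seteqP; split=> [p [R [t [ds [[Kt|Kt] ? ?]]]]|p [|]].
- by left; exists R, t, ds.
- by right; exists R, t, ds.
- by apply: active_domainS => ? ?; left.
- by apply: active_domainS => ? ?; right.
Qed.

(** Well-formedness depends on the configuration through its active domain only. *)
Lemma path_ok_active S ACS I K K' p : active_domain S K `<=` active_domain S K' ->
  path_ok S ACS I K p -> path_ok S ACS I K' p.
Proof.
elim: p K K' => [|[a Resp] p IHp] K K' KK' //= [? ? wfa okp]; split=> //.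
  by move=> /wfa wf ds /wf wfd v /wfd /KK'.
by apply: IHp okp; rewrite !active_domainU => v [/KK'|]; [left|right].
Qed.

Lemma final_cat K p q : final K (p ++ q) = final (final K p) q.
Proof. by elim: p K => [|[a Resp] p IHp] K // /=. Qed.

Lemma path_ok_cat S ACS I K p q :
  path_ok S ACS I K (p ++ q) <->
  path_ok S ACS I K p /\ path_ok S ACS I (final K p) q.
Proof.
elim: p K => [|[a Resp] p IHp] K /=; first by split=> // -[].
by rewrite (propext (IHp _)); split=> [[? ? ? []]|[[]]].
Qed.

Lemma finalU K L p : final (K `|` L) p = final K p `|` L.
Proof. by elim: p K => [|[a Resp] p IHp] K // /=; rewrite -IHp setUAC. Qed.

Lemma sub_final K p : K `<=` final K p.
Proof.
elim: p K => [|[a Resp] p IHp] K; first exact: subset_refl.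
by apply: subset_trans (IHp _); exact: subsetUl.
Qed.

Lemma final_sub S ACS I K p : K `<=` I -> path_ok S ACS I K p -> final K p `<=` I.
Proof.
elim: p K => [|[a Resp] p IHp] K KI //= [_ respa _]; apply: IHp.
by rewrite subUset; split=> // -[R t] /respa [].
Qed.

Lemma sat_mono K K' v q : K `<=` K' -> sat K v q -> sat K' v q.
Proof.
move=> KK'; elim: q v => [R us|q1 IH1 q2 IH2|q1 IH1 q2 IH2|x q IH] v /=.
- exact: KK'.
- by case=> /IH1 ? /IH2.
- by case=> [/IH1|/IH2]; [left|right].
- by case=> c /IH; exists c.
Qed.

(** Queries are monotone and the configuration is itself the least instance consistent with it. *)
Lemma certainE S K q : is_instance S K -> certain S K q <-> holds K q.
Proof.
move=> SK; split=> [cer|hq I SI KI]; first exact: cer.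
exact: sat_mono hq.
Qed.

Lemma is_instanceS S K K' : K `<=` K' -> is_instance S K' -> is_instance S K.
Proof. by move=> KK' SK' R t /KK' /SK'. Qed.

(* The response of the first access makes no value accessible, so that the
   truncated path is the rest of the path. *)
Lemma long_term_relevantE S ACS K a q :
    is_access ACS a -> well_formed S K a ->
    (forall I Resp, is_response I a Resp -> is_instance S Resp ->
      active_domain S Resp `<=` active_domain S K) ->
  long_term_relevant S ACS K a q <->
  exists I Resp p, [/\ is_instance S I /\ K `<=` I, is_response I a Resp,
    path_ok S ACS I K p, holds (final K p `|` Resp) q & ~ holds (final K p) q].
Proof.
move=> acca wfa noact.
have resp_sub I Resp : is_response I a Resp -> Resp `<=` I.
  by move=> resp -[R t] /resp [].
have noactU I Resp : is_response I a Resp -> is_instance S Resp ->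
    active_domain S (K `|` Resp) `<=` active_domain S K.
  by move=> resp SR; rewrite active_domainU subUset; split=> //; exact: noact resp SR.
split=> [[I [Resp [p [p' [[SI KI] /is_pathE [_ respa _ okp] tr cer ncer]]]]]|].
  have SR : is_instance S Resp := is_instanceS (resp_sub _ _ respa) SI.
  have okp' := path_ok_active (noactU _ _ respa SR) okp.
  have p'E : p' = p.
    case: tr => i [ip -> _ max]; apply: take_oversize; apply: max => //.
    by rewrite take_size; exact: path_ok_trace okp'.
  have finI := final_sub KI okp'.
  exists I, Resp, p; split=> //.
    apply/(@certainE S); last by rewrite -finalU.
    by apply: is_instanceS SI; rewrite subUset; split=> //; exact: resp_sub.
  by apply/(@certainE S); [exact: is_instanceS SI|rewrite -p'E].
case=> I [Resp [p [[SI KI] respa okp hq nhq]]].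
have finI := final_sub KI okp.
exists I, Resp, p, p; split=> //.
- apply/is_pathE; split=> //; apply: path_ok_active okp.
  by rewrite active_domainU; exact: subsetUl.
- exists (size p); split; rewrite ?take_size //.
  exact: path_ok_trace okp.
- rewrite /= finalU; apply/certainE => //; apply: is_instanceS SI.
  by rewrite subUset; split=> //; exact: resp_sub.
- by move=> /certainE hp; apply/nhq/hp; exact: is_instanceS SI.
Qed.

Lemma size_flatten_mem (T : eqType) (s : seq T) ss :
  s \in ss -> size s <= size (flatten ss).
Proof.
elim: ss => [//|r ss IHss]; rewrite inE /= size_cat => /orP [/eqP ->|/IHss].
  exact: leq_addr.
by move=> /leq_trans; apply; exact: leq_addl.
Qed.

(** Longer than every name of [s]; most of the later separations of names compare lengths. *)
Definition fresh (s : seq name) : name := true :: flatten s.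

Lemma fresh_size s x : x \in s -> size x < size (fresh s).
Proof. by move=> /size_flatten_mem. Qed.

Lemma fresh_notin s : fresh s \notin s.
Proof. by apply/negP => /fresh_size; rewrite ltnn. Qed.

Lemma schema_uniq S R ds ds' : wf_schema S -> (R, ds) \in S -> (R, ds') \in S -> ds = ds'.
Proof.
rewrite /wf_schema; elim: S => //= -[R1 ds1] s IHs /= /andP [R1s us].
rewrite !inE => /orP [/eqP e1|h] /orP [/eqP e2|h'].
- exact: etrans (congr1 snd e1) (esym (congr1 snd e2)).
- by case/negP: R1s; rewrite -[R1](congr1 fst e1); exact: (map_f fst h').
- by case/negP: R1s; rewrite -[R1](congr1 fst e2); exact: (map_f fst h).
- exact: IHs.
Qed.

(** * The reduction for positive queries *)

Section PositiveQueries.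

Definition pq_flag (x : containment_input) : name := fresh (unzip1 (cont_schema x)).

Definition pq_reduction (x : containment_input) : relevance_input :=
  let F := pq_flag x in
  RelevanceInput ((F, [::]) :: cont_schema x) ((F, [::], false) :: cont_methods x)
    (cont_conf x) ((F, [::], false), [::])
    (Or (cont_query2 x) (And (cont_query1 x) (Atom F [::]))).

Definition pq_program (t : tree) : tree :=
  let F := Node ttrue (tflatten (tmap (fun e _ => thd e) (thd t))) in
  let m := Node (Node F Leaf) Leaf in
  let q1 := thd (ttl (ttl (ttl t))) in
  let q2 := ttl (ttl (ttl (ttl t))) in
  Node (Node (Node F Leaf) (thd t))
 (Node (Node m (thd (ttl t)))
 (Node (thd (ttl (ttl t)))
 (Node (Node m Leaf)
       (Node (code_seq code_bool [:: true; false])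
         (Node q2 (Node (code_seq code_bool [:: false; true])
           (Node q1 (Node (code_seq code_bool [:: false; false])
             (Node F Leaf))))))))).

Lemma pq_program_ptime : ptime pq_program.
Proof. by rewrite /pq_program /=; ptime_auto. Qed.

Lemma fresh_code (T : Type) (c : T -> tree) (g : T -> name) F (s : seq T) :
    (forall y, F (c y) = code_name (g y)) ->
  Node ttrue (tflatten (tmap (fun e _ => F e) (code_seq c s))) =
  code_name (fresh (map g s)).
Proof.
move=> Fg; rewrite /code_name /fresh /=; congr Node.
rewrite -tflatten_code; congr tflatten.
by rewrite -smap_map; apply: tmap_code => y _; exact: Fg.
Qed.

Lemma pq_program_code x : code_relevance (pq_reduction x) = pq_program (code_containment x).
Proof.
by rewrite /pq_program /= (fresh_code (g := fst)).
Qed.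

Definition off_rel (F : name) : set fact := [set f | f.1 <> F].

(** A query typed over [S] mentions relations of [S] only, so it does not see the facts of [F]. *)
Lemma typed_off S G F q K v : F \notin unzip1 S -> typed S G q ->
  sat K v q -> sat (K `&` off_rel F) v q.
Proof.
move=> FS; elim: q G v => [R us|q1 IH1 q2 IH2|q1 IH1 q2 IH2|x q IH] G v /=.
- case=> ds RS _ KR; split=> // RF; move: FS; rewrite -RF.
  by move/negP; apply; exact: (map_f fst RS).
- by case=> /IH1 t1 /IH2 t2 [/t1 ? /t2 ?].
- by case=> /IH1 t1 /IH2 t2 [/t1|/t2]; [left|right].
- by case=> d /IH t [c /t]; exists c.
Qed.

Variables (S : schema) (ACS : seq access_method) (F : name).
Hypotheses (FS : F \notin unzip1 S) (wfACS : forall m, m \in ACS -> wf_method S m).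

Let S' : schema := (F, [::]) :: S.
Let m : access_method := (F, [::], false).

Lemma off_schema R ds : (R, ds) \in S -> R <> F.
Proof. by move=> /(map_f fst) /= RS RF; move: FS; rewrite -RF RS. Qed.

(** Having no attribute, [F] contributes no value. *)
Lemma flag_active K : active_domain S' K = active_domain S (K `&` off_rel F).
Proof.
apply/seteqP; split=> p [R [t [ds [KR Rds pz]]]].
  move: Rds; rewrite inE => /orP [/eqP [RF dsE]|Rds].
    by move: pz; rewrite dsE; case: (t).
  by exists R, t, ds; split=> //; split=> //; exact: off_schema Rds.
by exists R, t, ds; split=> //; [case: KR|rewrite inE Rds orbT].
Qed.

(** Accesses to [F] only add facts of [F], which carry no value; deleting these accesses keeps the
    others well-formed. *)
Lemma off_path I K p : path_ok S' (m :: ACS) I K p ->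
  let p' := [seq x <- p | am_rel x.1.1 != F] in
  path_ok S ACS (I `&` off_rel F) (K `&` off_rel F) p' /\
  final (K `&` off_rel F) p' = final K p `&` off_rel F.
Proof.
elim: p K => [|[[b bind] Resp] p IHp] K //= [[bACS bsz] respb wfb /IHp [okp finp]].
rewrite inE in bACS; case: eqP => [bF|/eqP bF] /=.
  have -> : K `&` off_rel F = (K `|` Resp) `&` off_rel F.
    rewrite setIUl [X in _ `|` X](_ : _ = set0) ?setU0 //.
    by apply/seteqP; split=> // -[R t] [/respb [_ /= RF _]]; case; rewrite RF.
  by [].
have RespE : Resp `&` off_rel F = Resp.
  apply/seteqP; split=> [f []//|[R t] RespR]; split=> //.
  by have [_ /= -> _] := respb _ _ RespR; apply/eqP.
rewrite setIUl RespE in okp finp; split=> //; split=> //.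
- move: bACS => /orP [/eqP bm|]; last by split.
  by move: bF; rewrite -[b]/(b, bind).1 bm eqxx.
- move=> R t RespR; have [IR RE masks] := respb _ _ RespR.
  by split=> //; split=> //= RF; move: bF; rewrite -RF RE eqxx.
- move=> dep ds Rds p' p'z; rewrite -flag_active.
  by apply: (wfb dep ds) => //; rewrite inE Rds orbT.
Qed.

Lemma flag_path I I' K p : I `<=` I' -> path_ok S ACS I K p ->
  path_ok S' (m :: ACS) I' K p.
Proof.
move=> II'; elim: p K => [|[a Resp] p IHp] K //= [[aACS asz] respa wfa /IHp okp].
split=> //.
- by split=> //; rewrite inE aACS orbT.
- by move=> R t /respa [/II'].
move=> dep ds; rewrite inE => /orP [/eqP [aF _]|Rds p' p'z].
  have [ds' Rds _] := wfACS aACS.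
  by case: (off_schema Rds).
have [R [t [ds' [? R' ?]]]] := wfa dep ds Rds p' p'z.
by exists R, t, ds'; split=> //; rewrite inE R' orbT.
Qed.

End PositiveQueries.

Lemma pq_reduction_correct (x : containment_input) (P := containment is_pq)
    (P' := non_relevance is_pq) :
  @valid P x -> @valid P' (pq_reduction x) /\
    (@yes P x <-> @yes P' (pq_reduction x)).
Proof.
case: x => S ACS Conf q1 q2; rewrite /P /P' /=.
case=> [[wfS wfACS SConf] _ [ty1 c1] [ty2 c2]].
rewrite /pq_reduction /pq_flag /=; set F := fresh _.
have FS : F \notin unzip1 S := fresh_notin _.
have offS R ds : (R, ds) \in S -> R <> F by exact: off_schema.
have inS' : is_instance ((F, [::]) :: S) [set` Conf].
  by move=> R t /SConf [ds Rds sz]; exists ds; rewrite // inE Rds orbT.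
have acc : is_access ((F, [::], false) :: ACS) ((F, [::], false), [::]).
  by split; rewrite //= inE eqxx.
have wfa : well_formed ((F, [::]) :: S) [set` Conf] ((F, [::], false), [::]) by [].
have tyS' G q : typed S G q -> typed ((F, [::]) :: S) G q.
  elim: q G => [R us|q IH q' IH'|q IH q' IH'|y q IH] G /=.
  - by case=> ds Rds tds; exists ds; rewrite // inE Rds orbT.
  - by case=> /IH ? /IH'.
  - by case=> /IH ? /IH'.
  - by case=> d /IH; exists d.
split.
  split=> //.
  - split=> //; first by rewrite /wf_schema /= FS.
    move=> b; rewrite inE => /orP [/eqP ->|/wfACS [ds Rds sz]].
      by exists [::]; rewrite // inE eqxx.
    by exists ds; rewrite // inE Rds orbT.
  - split.
      split; first exact: tyS'.
      by split; [exact: tyS'|exists [::]; rewrite // inE eqxx].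
    by move=> c; rewrite /= !mem_cat => /or3P [/c2|/c1|].
have respF I Resp : is_response I ((F, [::], false), [::]) Resp ->
    Resp `&` off_rel F `<=` set0.
  by move=> respa [R t] [/respa [_ -> _]].
rewrite long_term_relevantE //; last first.
  move=> I Resp respa SR p [R [t [ds [RespR Rds pz]]]].
  have [_ RF _] := respa _ _ RespR.
  move: Rds; rewrite inE => /orP [/eqP [_ dsE]|/offS].
    by move: pz; rewrite dsE; case: (t).
  by rewrite RF.
split=> [cont|ncont].
  case=> I [Resp [p [[SI KI] respa okp hq nhq]]].
  have [okr finr] := off_path FS okp.
  have resp0 : final [set` Conf] p `&` off_rel F =
      (final [set` Conf] p `|` Resp) `&` off_rel F.
    apply/seteqP; split=> [f [Kf Ff]|f [[Kf|Rf] Ff]]; split=> //; first by left.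
    by have [] := respF _ _ respa f.
  have h2 : ~ holds (final [set` Conf] p `&` off_rel F) q2.
    by move=> h; apply: nhq; left; apply: sat_mono h; exact: subIsetl.
  have confE : [set` Conf] `&` off_rel F = [set` Conf].
    apply/seteqP; split=> [f []//|[R t] Kf]; split=> //.
    by have [ds Rds _] := SConf _ _ Kf; exact: offS Rds.
  (* Neither [q1] nor [q2] sees the response, which consists of facts of [F]. *)
  case: hq => [h|[h _]]; first by apply: h2; rewrite resp0; exact: typed_off FS ty2 h.
  apply: h2; apply: cont; last by rewrite resp0; exact: typed_off FS ty1 h.
  exists (I `&` off_rel F), [seq x <- p | am_rel x.1.1 != F]; split.
  - move=> R t [/SI [ds]]; rewrite inE => /orP [/eqP [-> _]|Rds] sz //.
    by exists ds.
  - by rewrite -confE; apply: setSI.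
  - by apply/is_pathE; rewrite -confE.
  - by rewrite -finr confE.
move=> K' [I [p [SI KI /is_pathE okp K'E]]] h1; apply: contrapT => h2.
(* The fact of [F] is added to the instance and returned by the first access. *)
apply: ncont; exists (I `|` [set (F, [::])]), [set (F, [::])], p.
have KI' := final_sub KI okp.
split.
- split; last by move=> f /KI; left.
  move=> R t [/SI [ds Rds sz]|[-> ->]]; first by exists ds; rewrite // inE Rds orbT.
  by exists [::]; rewrite // inE eqxx.
- by move=> R t [-> ->]; split=> //; right.
- by apply: flag_path okp => //; exact: subsetUl.
- right; split; last by right.
  by rewrite -K'E; apply: sat_mono h1; exact: subsetUl.
(* The atom of [F] fails because [K'] lies in an instance of [S], which has no fact of [F]. *)
- rewrite -K'E => -[//|[_ /=]]; rewrite K'E => /KI' /SI [ds /offS]; exact.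
Qed.

(** * Conjunctive queries as lists of atoms *)

Lemma term_codeK : cancel (fun u => match u with Var x => (false, x) | Cst c => (true, c) end)
  (fun p => if p.1 then Cst p.2 else Var p.2).
Proof. by case. Qed.
HB.instance Definition _ := Equality.copy term (can_type term_codeK).

(** The length of the list in unary, as a bit string that can be part of the names of relations and
    variables. *)
Definition idx (T : Type) (s : seq T) : name := [seq true | _ <- s].

Lemma idxE (T : Type) (s : seq T) : idx s = nseq (size s) true.
Proof. by elim: s => //= x s ->. Qed.

Lemma size_idx (T : Type) (s : seq T) : size (idx s) = size s.
Proof. exact: size_map. Qed.

Lemma idx_eq (T U : Type) (s : seq T) (r : seq U) : (idx s == idx r) = (size s == size r).
Proof.
apply/eqP/eqP => [/(congr1 size)|sr]; first by rewrite !size_idx.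
by rewrite !idxE sr.
Qed.

Section Smap.
Variables (A : eqType) (B : Type).
Implicit Types (f : A -> seq A -> B) (s r : seq A).

Lemma size_smap f s : size (smap f s) = size s.
Proof. by elim: s => //= x s ->. Qed.

Lemma eq_smap f g s : (forall x r, f x r = g x r) -> smap f s = smap g s.
Proof. by move=> fg; elim: s => //= x s ->; rewrite fg. Qed.
End Smap.

Lemma map_smap (A : eqType) (B C : Type) (h : B -> C) (f : A -> seq A -> B) s :
  map h (smap f s) = smap (fun x r => h (f x r)) s.
Proof. by elim: s => //= x s ->. Qed.

Lemma mem_smap (A B : eqType) (f : A -> seq A -> B) s y :
  y \in smap f s <-> exists s1 x r, s = s1 ++ x :: r /\ y = f x r.
Proof.
elim: s => [|x s IHs] /=.
  by split=> // -[[|? ?] [? [? []]]].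
rewrite inE; split.
  case/orP => [/eqP ->|/IHs [s1 [z [r [-> ->]]]]]; first by exists [::], x, s.
  by exists (x :: s1), z, r.
case=> -[|x1 s1] [z [r [[xE sE] yE]]]; first by rewrite xE sE yE eqxx.
by apply/orP; right; apply/IHs; exists s1, z, r.
Qed.

(** Entries are numbered by how many entries follow them, hence the reversal: [nth b (rev t) n] is
    the entry of [t] followed by [n] others. *)
Lemma smap_nth (A : eqType) (B : Type) (b : B) (s : seq A) (t : seq B) :
  size t = size s -> smap (fun _ r => nth b (rev t) (size r)) s = t.
Proof.
elim: s t => [|x s IHs] [|y t] //= [sz]; congr cons.
  by rewrite rev_cons -sz -size_rev -cats1 nth_cat ltnn subnn.
rewrite -[RHS](IHs t sz).
(* Adding an entry in front does not change the numbers of the others. *)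
have H r : size r <= size s ->
    smap (fun _ (r' : seq A) => nth b (rev (y :: t)) (size r')) r =
    smap (fun _ r' => nth b (rev t) (size r')) r.
  elim: r => //= z r IHr rs; rewrite IHr ?(ltnW rs) //; congr cons.
  by rewrite rev_cons -cats1 nth_cat size_rev sz rs.
exact: H.
Qed.

Lemma zip_splitP (A B : eqType) (x : A) (y : B) s t : size s = size t ->
  (x, y) \in zip s t <-> exists s1 s2 t1 t2,
    [/\ s = s1 ++ x :: s2, t = t1 ++ y :: t2, size s1 = size t1 & size s2 = size t2].
Proof.
elim: s t => [|x1 s IHs] [|y1 t] //=.
  by split=> // -[[|? ?] [? [? [? []]]]].
case=> sz; rewrite inE; split.
  case/orP => [/eqP [-> ->]|]; first by exists [::], s, [::], t.
  case/(IHs _ sz) => s1 [s2 [t1 [t2 [-> -> ? ?]]]].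
  by exists (x1 :: s1), s2, (y1 :: t1), t2; split=> //=; congr S.
case=> -[|? s1] [s2 [[|? t1] [t2 [[xE sE] [yE tE] // szl szr]]]].
  by rewrite xE yE eqxx.
apply/orP; right; apply/(IHs _ sz); exists s1, s2, t1, t2; split=> //.
by case: szl.
Qed.

Lemma mem_flatten_map (A B : eqType) (f : A -> seq B) s y :
  y \in flatten (map f s) <-> exists2 x, x \in s & y \in f x.
Proof. by apply: iff_sym; apply: rwP; exact: flatten_mapP. Qed.

Lemma mem_map_iff (A B : eqType) (f : A -> B) s y :
  y \in map f s <-> exists2 x, x \in s & y = f x.
Proof. by apply: iff_sym; apply: rwP; exact: mapP. Qed.

Definition atom : Type := (name * seq term)%type.

Definition satisfied (K : set fact) (v : name -> name) (A : seq atom) : Prop :=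
  forall a, a \in A -> K (a.1, map (tval v) a.2).

Definition typed_atom (S : schema) (G : name -> option name) (a : atom) : Prop :=
  typed S G (Atom a.1 a.2).

Lemma conjunction_sat K q v : is_conjunction q -> sat K v q <-> satisfied K v (atoms q).
Proof.
elim: q => [R us|q1 IH1 q2 IH2|//|//] /=.
  by move=> _; split=> [h a|h]; [rewrite inE => /eqP ->|apply: (h (R, us)); rewrite inE].
case/andP=> /IH1 -> /IH2 ->; split=> [[h1 h2] a|h].
  by rewrite mem_cat => /orP [/h1|/h2].
by split=> a aq; apply: h; rewrite mem_cat aq ?orbT.
Qed.

Lemma cq_sat K q v : is_cq q -> sat K v q -> exists v', satisfied K v' (atoms q).
Proof.
elim: q v => [R us|q1 _ q2 _|//|x q IH] v cq h.
- by exists v; apply/conjunction_sat.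
- by exists v; apply/conjunction_sat.
- by have [c /(IH _ cq)] := h.
Qed.

Lemma satisfied_sat K q v : is_cq q -> satisfied K v (atoms q) -> sat K v q.
Proof.
elim: q => [R us|q1 _ q2 _|//|x q IH] cq h.
- by apply/conjunction_sat.
- by apply/conjunction_sat.
- exists (v x); rewrite (_ : (fun y => _) = v); first exact: IH.
  by apply: funext => y; case: eqP => [->|].
Qed.

Lemma typed_sat S G K q v v' : typed S G q -> (forall x, G x <> None -> v x = v' x) ->
  sat K v q -> sat K v' q.
Proof.
elim: q G v v' => [R us|q1 IH1 q2 IH2|q1 IH1 q2 IH2|x q IH] G v v' /=.
- case=> ds _ tus vv'; rewrite (_ : map (tval v') us = map (tval v) us) //.
  elim: us ds tus => [|u us IHus] [|d ds] //= /andP [tu /IHus ->]; congr cons.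
  by case: u tu => //= y /eqP Gy; rewrite vv' ?Gy.
- by case=> t1 t2 vv' [/(IH1 _ _ _ t1 vv') ? /(IH2 _ _ _ t2 vv')].
- by case=> t1 t2 vv' [/(IH1 _ _ _ t1 vv')|/(IH2 _ _ _ t2 vv')]; [left|right].
- case=> d tq vv' [c h]; exists c; apply: IH tq _ h => y.
  by case: eqP => // _ /vv'.
Qed.

(** The query is closed, so the valuation found for its atoms and the initial one may differ
    freely. *)
Lemma holds_cq S K q : is_cq q -> typed S (fun=> None) q ->
  holds K q <-> exists v, satisfied K v (atoms q).
Proof.
move=> cq tq; split=> [|[v /(satisfied_sat cq)]]; first exact: cq_sat.
exact: typed_sat tq _.
Qed.

(** The typing in force below the quantifier prefix serves for all atoms. *)
Lemma typed_atoms S G q : is_cq q -> typed S G q ->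
  exists G', forall a, a \in atoms q -> typed_atom S G' a.
Proof.
have conj p G' : is_conjunction p -> typed S G' p ->
    forall a, a \in atoms p -> typed_atom S G' a.
  elim: p => [R us _ h a|p1 IH1 p2 IH2 /andP [c1 c2] [h1 h2] a|//|//] /=.
    by rewrite inE => /eqP ->.
  by rewrite mem_cat => /orP [/(IH1 c1 h1)|/(IH2 c2 h2)].
elim: q G => [R us|q1 _ q2 _|//|x q IH] G cq.
- by move=> tq; exists G; exact: conj.
- by move=> tq; exists G; exact: conj.
- by case=> d; exact: IH.
Qed.

Lemma constants_atoms q a c : is_cq q -> a \in atoms q -> Cst c \in a.2 -> c \in constants q.
Proof.
have H R us : Cst c \in us -> c \in constants (Atom R us).
  by move=> cu; rewrite /= mem_pmap; apply/mapP; exists (Cst c).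
move=> _; elim: q => [R us|q1 IH1 q2 IH2|//|x q IH] /=.
- by rewrite inE => /eqP -> /=; exact: H R us.
- by rewrite !mem_cat => /orP [/IH1 h|/IH2 h] /h ->; rewrite ?orbT.
- exact: IH.
Qed.

Definition vars (a : atom) : seq name :=
  flatten [seq if u is Var x then [:: x] else [::] | u <- a.2].

(** The atom [a0] is singled out because the syntax has no empty conjunction. The folds go from the
    left, as [tfold] does, and a variable may be quantified several times. *)
Definition close (a0 : atom) (A : seq atom) : query :=
  foldl (fun q x => Ex x q)
    (foldl (fun q a => And (Atom a.1 a.2) q) (Atom a0.1 a0.2) A)
    (flatten [seq vars a | a <- a0 :: A]).

Lemma atoms_close a0 A : atoms (close a0 A) =i a0 :: A.
Proof.
have E q xs : atoms (foldl (fun q x => Ex x q) q xs) = atoms q.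
  by elim: xs q => //= x xs IH q; rewrite IH.
move=> a; rewrite E.
suff -> q : a \in atoms (foldl (fun q a => And (Atom a.1 a.2) q) q A) =
    (a \in atoms q) || (a \in A).
  by case: a0 => R us /=; rewrite !inE.
elim: A q => [|b A IH] q /=; first by rewrite orbF.
by rewrite IH /= !inE -!surjective_pairing orbCA orbA.
Qed.

Lemma is_cq_close a0 A : is_cq (close a0 A).
Proof.
have E q xs : is_cq q -> is_cq (foldl (fun q x => Ex x q) q xs).
  by elim: xs q => //= x xs IH q cq; exact: IH.
apply: E; suff H q : is_conjunction q ->
    is_conjunction (foldl (fun q a => And (Atom a.1 a.2) q) q A).
  by have := H (Atom a0.1 a0.2) isT; case: (foldl _ _ _).
by elim: A q => //= b A IH q cq; apply: IH.
Qed.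

Lemma typed_close S G a0 A : (forall a, a \in a0 :: A -> typed_atom S G a) ->
  typed S (fun=> None) (close a0 A).
Proof.
move=> tA; rewrite /close; set xs := flatten _; set q := foldl _ _ A.
(* The typing of a subformula is restricted to the variables still to be quantified. The first
   variable of [xs] gets the innermost quantifier, so the induction on [xs] goes outwards. *)
pose G' x := if x \in xs then G x else None.
have Gx x : x \in xs -> G x <> None.
  move=> /mem_flatten_map [a /tA [ds _ tus]]; rewrite /vars.
  elim: (a.2) ds tus => [|u us IHus] [|d ds] //= /andP [tu /IHus].
  rewrite mem_cat => IH /orP [|]; last exact: IH.
  by case: u tu => // y /eqP yd; rewrite inE => /eqP ->; rewrite yd.
have tq : typed S G' q.
  have tA' a : a \in a0 :: A -> typed_atom S G' a.
    move=> aA; have [ds Rds tus] := tA a aA; exists ds => //.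
    have : {subset vars a <= xs}.
      by move=> x xa; apply/mem_flatten_map; exists a.
    rewrite /vars; elim: (a.2) ds {Rds} tus => [|u us IHus] [|d ds] //=.
    case/andP=> tu /IHus IH sub; rewrite IH ?andbT.
      by case: u tu sub => // y yd /(_ y); rewrite /G' mem_head => ->.
    by move=> x xu; apply: sub; rewrite mem_cat xu orbT.
  rewrite /q; have : typed S G' (Atom a0.1 a0.2) by apply: tA'; rewrite mem_head.
  have : forall a, a \in A -> typed_atom S G' a.
    by move=> a aA; apply: tA'; rewrite inE aA orbT.
  elim: (A) (Atom _ _) => //= b B IHB q' tB tq'.
  apply: IHB => [a aB|]; first by apply: tB; rewrite inE aB orbT.
  by split=> //; apply: tB; rewrite mem_head.
rewrite /G' in tq; move: xs {G'} Gx q tq => xs Gx.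
elim: xs Gx => [|x xs IH] Gx q tq /=.
  exact: tq.
apply: IH => [y yxs|]; first by apply: Gx; rewrite inE yxs orbT.
case E: (G x) => [d|]; last by have := Gx x (mem_head _ _).
exists d; rewrite (_ : (fun y => _) = (fun y => if y \in x :: xs then G y else None)) //.
by apply: funext => y; rewrite inE; case: eqP => [->|].
Qed.

Lemma constants_close a0 A c : c \in constants (close a0 A) ->
  exists2 a, a \in a0 :: A & Cst c \in a.2.
Proof.
have E q xs : constants (foldl (fun q x => Ex x q) q xs) = constants q.
  by elim: xs q => //= x xs IH q; rewrite IH.
have C a : c \in constants (Atom a.1 a.2) -> Cst c \in a.2.
  rewrite /= mem_pmap => /mapP [[x|c'] // ca [->]]; exact: ca.
rewrite E; suff H q : c \in constants (foldl (fun q a => And (Atom a.1 a.2) q) q A) ->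
    (c \in constants q) \/ exists2 a, a \in A & Cst c \in a.2.
  case/H => [/C|[a aA ca]]; first by exists a0; rewrite // mem_head.
  by exists a; rewrite // inE aA orbT.
elim: A q => [|b A IH] q /=; first by left.
case/IH => [|[a aA ca]].
  by rewrite mem_cat => /orP [/C cb|]; [right; exists b; rewrite // mem_head|left].
by right; exists a; rewrite // inE aA orbT.
Qed.

(** * The reduction for conjunctive queries *)

Definition tag0 : name := [::].
Definition tag1 : name := [:: true].

(* A position of a relation is determined by the number of the attributes that
   follow it, in unary. *)
Definition position : Type := (name * (seq name * (name * name)))%type.
Definition prel (p : position) : name := p.1.
Definition pdoms (p : position) : seq name := p.2.1.
Definition pidx (p : position) : name := p.2.2.1.
Definition pdom (p : position) : name := p.2.2.2.

Definition positions (S : schema) : seq position :=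
  flatten [seq smap (fun d r => (e.1, (e.2, (idx r, d)))) e.2 | e <- S].

(** The pairs are ordered and include each position with itself, since the two facts of a collision
    play different parts. *)
Definition pairs (P : seq position) : seq (position * position) :=
  flatten [seq flatten [seq if pdom p == pdom q then [:: (p, q)] else [::] | q <- P]
          | p <- P].

(* The variables of the constructed query, by [k]: 0 and 1, those of the first
   and of the second query; 2, those replacing the constants of the second; 3,
   the common value of the [n]-th collision, 4 and 5, the other values in its
   facts, 6, the tag of its second fact; 8, the tag of the second query; 9, the
   value of the flag; 7, the disjunction of 8, 9 and of the tags 6 of the
   collisions of index at least [n]. *)
Definition vname (k : nat) (n r : name) : name :=
  nseq k true ++ false :: n ++ false :: r.

(** One variable per constant and position, [m] being the relation M of the position. The length of
    [c] in unary allows [c ++ m] to be split again. *)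
Definition cvar (m c : name) : name := vname 2 (idx c) (c ++ m).

Section Reduction.
Variable x : containment_input.

Let S := cont_schema x.
Let ACS := cont_methods x.
Let Conf := cont_conf x.

Definition flag_rel : name := fresh (unzip1 S).
Definition or_rel : name := true :: flag_rel.
(** Longer than [flag_rel] and hence than all relations of [S]. The index [i] is unary and ends at
    the first false bit, so that [i] and [R] can be read off. *)
Definition mark_name (i R : name) : name := i ++ false :: flag_rel ++ R.
Definition bot_value : name := fresh (flatten (unzip2 Conf)).
Definition bdom : name := fresh (flatten (unzip2 S)).
(** The second attributes of the relations M have a domain of their own, so that the constants of
    the dummy facts M(bot, c) do not become accessible at the domains of [S]. *)
Definition cdom : name := true :: bdom.

Let P := positions S.
Let PP := pairs P.
Let C : seq name := flatten (unzip2 Conf).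

Definition pmark (p : position) : name := mark_name (pidx p) (prel p).

(** The facts of the configuration hold in every reachable configuration; as atoms, they make the
    constants of the configuration count as constants of the first query. The reversal is due to
    [tatoms]. *)
Definition atoms1 : seq atom :=
  rev (atoms (cont_query1 x)) ++ [seq (f.1, map Cst f.2) | f <- Conf].
Definition atoms2 : seq atom := rev (atoms (cont_query2 x)).

Definition cq_schema : schema :=
  [seq (e.1, bdom :: e.2) | e <- S] ++
  [seq (pmark p, [:: pdom p; cdom]) | p <- P] ++
  [:: (flag_rel, [:: bdom]); (or_rel, [:: bdom; bdom; bdom])].

(* An independent method can return any tuple, so that it may as well have no
   input but the tag. *)
Definition cq_method (m : access_method) : access_method :=
  (am_rel m, true :: (if am_dependent m then am_inputs m
                      else [seq false | _ <- am_inputs m]), true).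

Definition mark_method (m : name) : access_method := (m, [:: true; true], true).
Definition flag_method : access_method := (flag_rel, [:: true], true).

Definition cq_methods : seq access_method :=
  [seq cq_method m | m <- ACS] ++ [seq mark_method (pmark p) | p <- P] ++
  [:: flag_method].

(** The third column is the disjunction of the other two. No row has two true disjuncts, as
    [query_witness] makes exactly one of them true. *)
Definition or_table : seq (seq name) :=
  [:: [:: tag0; tag0; tag0]; [:: tag0; tag1; tag1]; [:: tag1; tag0; tag1]].

Definition cq_conf : seq fact :=
  [seq (f.1, tag1 :: f.2) | f <- Conf] ++
  [seq (e.1, tag0 :: [seq bot_value | _ <- e.2]) | e <- S] ++
  flatten [seq [seq (pmark p, [:: bot_value; c]) | c <- C] | p <- P] ++
  ((flag_rel, [:: tag0]) :: [seq (or_rel, t) | t <- or_table]).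

Definition term1 (u : term) : term :=
  if u is Var y then Var (vname 0 [::] y) else u.

Definition query_atoms1 : seq atom :=
  [seq (a.1, Cst tag1 :: map term1 a.2) | a <- atoms1].

(** If [c] occurs at the position named by [m], the fact M(c, c) is required for every position of
    the same domain. *)
Definition constant_marks (m c : name) : seq atom :=
  flatten [seq if m == pmark pq.1 then [:: (pmark pq.2, [:: Cst c; Cst c])] else [::]
          | pq <- PP].

Definition mark_atoms1 : seq atom :=
  flatten [seq flatten (smap (fun u r =>
    if u is Cst c then constant_marks (mark_name (idx r) a.1) c else [::]) a.2)
  | a <- atoms1].

Definition term2 (m : name) (u : term) : term :=
  match u with Var y => Var (vname 1 [::] y) | Cst c => Var (cvar m c) end.

Definition query_atoms2 : seq atom :=
  [seq (a.1, Var (vname 8 [::] [::]) ::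
     smap (fun u r => term2 (mark_name (idx r) a.1) u) a.2)
  | a <- atoms2].

Definition mark_atoms2 : seq atom :=
  flatten [seq flatten (smap (fun u r =>
    if u is Cst c then
      let m := mark_name (idx r) a.1 in [:: (m, [:: Var (cvar m c); Cst c])]
    else [::]) a.2)
  | a <- atoms2].

Definition collision_terms (c : nat) (k : name) (p : position) : seq term :=
  smap (fun _ r => if idx r == pidx p then Var (vname 3 k [::])
                   else Var (vname c k (idx r))) (pdoms p).

(** The third atom splits the disjunction from index [k] on into the one from the next index on and
    the tag of the second fact. When that tag is 0, dummy facts satisfy the first two atoms. *)
Definition collision (k : name) (pq : position * position) : seq atom :=
  [:: (prel pq.1, Cst tag0 :: collision_terms 4 k pq.1);
      (prel pq.2, Var (vname 6 k [::]) :: collision_terms 5 k pq.2);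
      (or_rel, [:: Var (vname 7 (true :: k) [::]); Var (vname 6 k [::]);
                   Var (vname 7 k [::])])].

Definition collision_atoms : seq atom :=
  flatten (smap (fun pq r => collision (idx r) pq) PP).

Definition flag_atoms : seq atom :=
  [:: (flag_rel, [:: Var (vname 9 [::] [::])]);
      (or_rel, [:: Var (vname 9 [::] [::]); Var (vname 8 [::] [::]);
                   Var (vname 7 (idx PP) [::])])].

(** The only row of the table that ends in 0, 1 begins with 1, so this atom makes the whole
    disjunction true. *)
Definition final_atom : atom :=
  (or_rel, [:: Var (vname 7 [::] [::]); Cst tag0; Cst tag1]).

Definition cq_atoms : seq atom :=
  query_atoms1 ++ mark_atoms1 ++ query_atoms2 ++ mark_atoms2 ++
  collision_atoms ++ flag_atoms.

Definition cq_query : query := close final_atom cq_atoms.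

Definition flag_access : access := (flag_method, [:: tag1]).

Definition cq_reduction : relevance_input :=
  RelevanceInput cq_schema cq_methods cq_conf flag_access cq_query.

End Reduction.

(** * Computing the reduction in polynomial time *)

Lemma tmap_map (A B : Type) (c : A -> tree) (d : B -> tree) F f s :
    (forall y r, F (c y) (code_seq c r) = d (f y)) ->
  tmap F (code_seq c s) = code_seq d (map f s).
Proof. by move=> Ff; rewrite -smap_map; exact: tmap_code. Qed.

Lemma tflatmap (A B : Type) (c : A -> tree) (d : B -> tree) F f s :
    (forall y r, F (c y) (code_seq c r) = code_seq d (f y)) ->
  tflatten (tmap F (code_seq c s)) = code_seq d (flatten (map f s)).
Proof. by move=> Ff; rewrite (tmap_map (d := code_seq d) (f := f)) ?tflatten_code. Qed.

Lemma tif_bool b t u : tif (code_bool b) t u = if b then t else u.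
Proof. by case: b. Qed.

Definition code_atom : atom -> tree := code_pair code_name (code_seq code_term).
Definition code_position : position -> tree :=
  code_pair code_name (code_pair (code_seq code_name) (code_pair code_name code_name)).

Definition tidx (r : tree) : tree := tmap (fun _ _ => ttrue) r.
Definition tmark (F i R : tree) : tree := tcat i (Node Leaf (tcat F R)).
Definition tvname (k : nat) (n r : tree) : tree :=
  tcat (code_name (nseq k true)) (Node Leaf (tcat n (Node Leaf r))).
Definition tcvar (m c : tree) : tree := tvname 2 (tidx c) (tcat c m).
Definition tcst (c : tree) : tree := Node ttrue c.
Definition tvar (c : tree) : tree := Node Leaf c.
Definition tpmark (F p : tree) : tree := tmark F (thd (ttl (ttl p))) (thd p).
Definition tzero : tree := code_name tag0.
Definition tone : tree := code_name tag1.

Lemma tidxE (T : Type) (c : T -> tree) s : tidx (code_seq c s) = code_name (idx s).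
Proof. exact: tmap_map. Qed.

Lemma node_false s : Node Leaf (code_seq code_bool s) = code_seq code_bool (false :: s).
Proof. by []. Qed.

Lemma tmarkE F i R :
  tmark (code_name F) (code_name i) (code_name R) = code_name (i ++ false :: F ++ R).
Proof.
by rewrite /tmark /code_name !(tcat_code, node_false).
Qed.

Lemma tvnameE k n r : tvname k (code_name n) (code_name r) = code_name (vname k n r).
Proof.
by rewrite /tvname /code_name !(tcat_code, node_false).
Qed.

Lemma tcvarE m c : tcvar (code_name m) (code_name c) = code_name (cvar m c).
Proof. by rewrite /tcvar tidxE /code_name tcat_code -/code_name tvnameE. Qed.

Definition tpositions (S : tree) : tree :=
  tflatten (tmap (fun e _ =>
    tmap (fun d r => Node (thd e) (Node (ttl e) (Node (tidx r) d))) (ttl e)) S).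

Lemma tpositionsE S : tpositions (code_schema S) = code_seq code_position (positions S).
Proof.
apply: tflatmap => -[R ds] _ /=.
by apply: (tmap_code (d := code_position)) => d r; rewrite tidxE.
Qed.

Definition tpairs (P : tree) : tree :=
  tflatten (tmap (fun p _ => tflatten (tmap (fun q _ =>
    tif (teq (ttl (ttl (ttl p))) (ttl (ttl (ttl q)))) (Node (Node p q) Leaf) Leaf) P)) P).

Lemma tpairsE P : tpairs (code_seq code_position P) =
  code_seq (code_pair code_position code_position) (pairs P).
Proof.
apply: tflatmap => p _; apply: tflatmap => q _ /=.
by rewrite teq_code tif_bool /pdom; case: (_ == _).
Qed.

(** The data shared by the parts of the output are computed once and put in front of the input:
    [flag_rel], the constants of the configuration, [bdom], the positions, their pairs, [atoms1] and
    [atoms2]. *)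
Definition tenv (t : tree) : tree :=
  Node (Node ttrue (tflatten (tmap (fun e _ => thd e) (thd t))))
 (Node (tflatten (tmap (fun f _ => ttl f) (thd (ttl (ttl t)))))
 (Node (Node ttrue (tflatten (tflatten (tmap (fun e _ => ttl e) (thd t)))))
 (Node (tpositions (thd t))
 (Node (tpairs (tpositions (thd t)))
 (Node (tcat (tatoms (thd (ttl (ttl (ttl t)))))
             (tmap (fun f _ => Node (thd f) (tmap (fun c _ => tcst c) (ttl f)))
                   (thd (ttl (ttl t)))))
 (Node (tatoms (ttl (ttl (ttl (ttl t)))))
  t)))))).

Definition eF e := thd e.
Definition eC e := thd (ttl e).
Definition eD e := thd (ttl (ttl e)).
Definition eP e := thd (ttl (ttl (ttl e))).
Definition ePP e := thd (ttl (ttl (ttl (ttl e)))).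
Definition eA1 e := thd (ttl (ttl (ttl (ttl (ttl e))))).
Definition eA2 e := thd (ttl (ttl (ttl (ttl (ttl (ttl e)))))).
Definition eS e := thd (ttl (ttl (ttl (ttl (ttl (ttl (ttl e))))))).
Definition eM e := thd (ttl (ttl (ttl (ttl (ttl (ttl (ttl (ttl e)))))))).
Definition eK e := thd (ttl (ttl (ttl (ttl (ttl (ttl (ttl (ttl (ttl e))))))))).

Definition tsingle (t : tree) : tree := Node t Leaf.

Definition tschema (e : tree) : tree :=
  tcat (tmap (fun y _ => Node (thd y) (Node (eD e) (ttl y))) (eS e))
 (tcat (tmap (fun p _ => Node (tpmark (eF e) p)
              (Node (ttl (ttl (ttl p))) (tsingle (Node ttrue (eD e))))) (eP e))
 (Node (Node (eF e) (tsingle (eD e)))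
 (tsingle (Node (Node ttrue (eF e)) (Node (eD e) (Node (eD e) (tsingle (eD e)))))))).

Definition tmethods (e : tree) : tree :=
  tcat (tmap (fun m _ => Node (Node (thd (thd m)) (Node ttrue
         (tif (ttl m) (ttl (thd m)) (tmap (fun _ _ => Leaf) (ttl (thd m)))))) ttrue) (eM e))
 (tcat (tmap (fun p _ => Node (Node (tpmark (eF e) p) (Node ttrue (tsingle ttrue))) ttrue) (eP e))
 (tsingle (Node (Node (eF e) (tsingle ttrue)) ttrue))).

Definition tconf (e : tree) : tree :=
  tcat (tmap (fun f _ => Node (thd f) (Node tone (ttl f))) (eK e))
 (tcat (tmap (fun y _ => Node (thd y) (Node tzero
         (tmap (fun _ _ => Node ttrue (tflatten (eC e))) (ttl y)))) (eS e))
 (tcat (tflatten (tmap (fun p _ => tmap (fun c _ => Node (tpmark (eF e) p)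
         (Node (Node ttrue (tflatten (eC e))) (tsingle c))) (eC e)) (eP e)))
 (Node (Node (eF e) (tsingle tzero))
   (tmap (fun t _ => Node (Node ttrue (eF e)) t) (code_seq (code_seq code_name) or_table))))).

Definition tquery_atoms1 (e : tree) : tree :=
  tmap (fun a _ => Node (thd a) (Node (tcst tone)
    (tmap (fun u _ => tif (thd u) u (tvar (tvname 0 Leaf (ttl u)))) (ttl a)))) (eA1 e).

Definition tconstant_marks (e m c : tree) : tree :=
  tflatten (tmap (fun pq _ => tif (teq m (tpmark (eF e) (thd pq)))
    (tsingle (Node (tpmark (eF e) (ttl pq)) (Node (tcst c) (tsingle (tcst c))))) Leaf) (ePP e)).

Definition tmark_atoms1 (e : tree) : tree :=
  tflatten (tmap (fun a _ => tflatten (tmap (fun u r => tif (thd u)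
    (tconstant_marks e (tmark (eF e) (tidx r) (thd a)) (ttl u)) Leaf) (ttl a))) (eA1 e)).

Definition tquery_atoms2 (e : tree) : tree :=
  tmap (fun a _ => Node (thd a) (Node (tvar (tvname 8 Leaf Leaf))
    (tmap (fun u r => tif (thd u)
       (tvar (tcvar (tmark (eF e) (tidx r) (thd a)) (ttl u)))
       (tvar (tvname 1 Leaf (ttl u)))) (ttl a)))) (eA2 e).

Definition tmark_atoms2 (e : tree) : tree :=
  tflatten (tmap (fun a _ => tflatten (tmap (fun u r => tif (thd u)
    (tsingle (Node (tmark (eF e) (tidx r) (thd a))
      (Node (tvar (tcvar (tmark (eF e) (tidx r) (thd a)) (ttl u)))
      (tsingle u)))) Leaf) (ttl a))) (eA2 e)).

Definition tcollision_terms (c : nat) (k p : tree) : tree :=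
  tmap (fun _ r => tif (teq (tidx r) (thd (ttl (ttl p)))) (tvar (tvname 3 k Leaf))
                   (tvar (tvname c k (tidx r)))) (thd (ttl p)).

Definition tcollision (F k pq : tree) : tree :=
  Node (Node (thd (thd pq)) (Node (tcst tzero) (tcollision_terms 4 k (thd pq))))
 (Node (Node (thd (ttl pq)) (Node (tvar (tvname 6 k Leaf)) (tcollision_terms 5 k (ttl pq))))
 (tsingle (Node (Node ttrue F) (Node (tvar (tvname 7 (Node ttrue k) Leaf))
    (Node (tvar (tvname 6 k Leaf)) (tsingle (tvar (tvname 7 k Leaf)))))))).

Definition tcollision_atoms (e : tree) : tree :=
  tflatten (tmap (fun pq r => tcollision (eF e) (tidx r) pq) (ePP e)).

Definition tflag_atoms (e : tree) : tree :=
  Node (Node (eF e) (tsingle (tvar (tvname 9 Leaf Leaf))))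
 (tsingle (Node (Node ttrue (eF e)) (Node (tvar (tvname 9 Leaf Leaf))
    (Node (tvar (tvname 8 Leaf Leaf)) (tsingle (tvar (tvname 7 (tidx (ePP e)) Leaf))))))).

Definition tfinal_atom (e : tree) : tree :=
  Node (Node ttrue (eF e)) (Node (tvar (tvname 7 Leaf Leaf))
    (Node (tcst tzero) (tsingle (tcst tone)))).

Definition tcq_atoms (e : tree) : tree :=
  tcat (tquery_atoms1 e) (tcat (tmark_atoms1 e) (tcat (tquery_atoms2 e)
    (tcat (tmark_atoms2 e) (tcat (tcollision_atoms e) (tflag_atoms e))))).

(** Quantifications and conjunctions are both coded by a tag and a pair, so one kind of fold serves
    for the two loops of [close]. *)
Definition ttag_fold (tag st xs : tree) : tree :=
  tfold (fun ys st => Node tag (Node (thd ys) st)) st xs.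

Definition tclose (a0 A : tree) : tree :=
  let atag := code_seq code_bool [:: false; false] in
  ttag_fold (code_seq code_bool [:: true; true])
    (ttag_fold (code_seq code_bool [:: false; true]) (Node atag a0)
       (tmap (fun a _ => Node atag a) A))
    (tflatten (tmap (fun a _ => tflatten (tmap (fun u _ =>
       tif (thd u) Leaf (tsingle (ttl u))) (ttl a))) (Node a0 A))).

Definition cq_assemble (e : tree) : tree :=
  Node (tschema e) (Node (tmethods e) (Node (tconf e)
    (Node (Node (Node (Node (eF e) (tsingle ttrue)) ttrue) (tsingle tone))
       (tclose (tfinal_atom e) (tcq_atoms e))))).

(** * Running time of the program for conjunctive queries *)

Lemma ptime_tag_fold tag h l : ptime h -> ptime l ->
  ptime (fun t => ttag_fold tag (h t) (l t)).
Proof.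
apply: (@ptime_fold (fun _ xs st => Node tag (Node (thd xs) st)) _ _ (tsize tag).+2).
  by ptime_auto.
move=> e xs st /=; have := tsize_thd xs; set n := (tsize e + _).+1.
have xs_n : tsize xs < n by rewrite ltnS leq_addl.
have n_gt1 : 1 < n by rewrite ltnS addn_gt0 tsize_gt0.
(* Since [n] is at least 2, the constant size of the tag is below a fixed power of [n]; one more
   factor [n] covers the entry. *)
have := ltn_expl (tsize tag).+1 n_gt1; rewrite [n ^ _.+2]expnS; nia.
Qed.

Ltac ptime_solve := cbv beta; repeat (cbv beta; first [assumption | lazymatch goal with
  | |- ptime (fun t => tatoms (@?a t)) => apply (@ptime_atoms a)
  | |- ptime (fun t => teq (@?a t) (@?b t)) => apply (@ptime_eq a b)
  | |- ptime (fun t => ttag_fold ?c (@?a t) (@?b t)) => apply (@ptime_tag_fold c a b)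
  | |- _ => progress ptime_auto
  end]).

Lemma ptime_env : ptime tenv.
Proof. by rewrite /tenv /tpairs /tpositions /tidx /tcst; ptime_solve. Qed.

Lemma ptime_schema : ptime tschema.
Proof.
by rewrite /tschema /tpmark /tmark /tsingle /eF /eD /eP /eS; ptime_solve.
Qed.

Lemma ptime_methods : ptime tmethods.
Proof.
by rewrite /tmethods /tpmark /tmark /tsingle /eF /eD /eP /eM; ptime_solve.
Qed.

Lemma ptime_conf : ptime tconf.
Proof.
by rewrite /tconf /tpmark /tmark /tsingle /eF /eC /eD /eP /eS /eK; ptime_solve.
Qed.

Lemma ptime_query_atoms1 : ptime tquery_atoms1.
Proof. by rewrite /tquery_atoms1 /tvar /tcst /tvname /eA1; ptime_solve. Qed.

Lemma ptime_mark_atoms1 : ptime tmark_atoms1.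
Proof.
rewrite /tmark_atoms1 /tconstant_marks /tpmark /tmark /tcst /tidx /tsingle.
by rewrite /eF /ePP /eA1; ptime_solve.
Qed.

Lemma ptime_query_atoms2 : ptime tquery_atoms2.
Proof.
rewrite /tquery_atoms2 /tcvar /tvar /tmark /tvname /tidx /eF /eA2.
by ptime_solve.
Qed.

Lemma ptime_mark_atoms2 : ptime tmark_atoms2.
Proof.
rewrite /tmark_atoms2 /tcvar /tvar /tmark /tvname /tidx /tsingle /eF /eA2.
by ptime_solve.
Qed.

Lemma ptime_collision_atoms : ptime tcollision_atoms.
Proof.
rewrite /tcollision_atoms /tcollision /tcollision_terms /tcst /tvar /tvname.
by rewrite /tidx /tsingle /eF /ePP; ptime_solve.
Qed.

Lemma ptime_flag_atoms : ptime tflag_atoms.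
Proof.
by rewrite /tflag_atoms /tvar /tvname /tidx /tsingle /eF /ePP; ptime_solve.
Qed.

Lemma ptime_final_atom : ptime tfinal_atom.
Proof.
by rewrite /tfinal_atom /tvar /tcst /tvname /tsingle /eF; ptime_solve.
Qed.

Lemma ptime_close f g : ptime f -> ptime g -> ptime (fun t => tclose (f t) (g t)).
Proof. by move=> pf pg; rewrite /tclose /tsingle; ptime_solve. Qed.

Lemma cq_program_ptime : ptime (fun t => cq_assemble (tenv t)).
Proof.
apply: (ptime_comp (f := cq_assemble) _ ptime_env).
have pA : ptime tcq_atoms.
  rewrite /tcq_atoms; repeat apply: ptime_cat.
  - exact: ptime_query_atoms1.
  - exact: ptime_mark_atoms1.
  - exact: ptime_query_atoms2.
  - exact: ptime_mark_atoms2.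
  - exact: ptime_collision_atoms.
  - exact: ptime_flag_atoms.
have := ptime_close ptime_final_atom pA.
have := ptime_schema; have := ptime_methods; have := ptime_conf.
by rewrite /cq_assemble /eF /tsingle => *; ptime_solve.
Qed.

(** * The program yields the code of the constructed input *)

Section Codes.
Variable x : containment_input.
Let t := code_containment x.
Let e := tenv t.
Let S := cont_schema x.
Let PP := pairs (positions S).

Lemma eFE : eF e = code_name (flag_rel x).
Proof. by rewrite /e /eF /= (fresh_code (g := fst)). Qed.

Lemma eCE : eC e = code_seq code_name (flatten (unzip2 (cont_conf x))).
Proof. by rewrite /e /eC /=; apply: tflatmap. Qed.

Lemma eDE : eD e = code_name (bdom x).
Proof.
rewrite /e /eD /= /bdom /fresh /code_name /=; congr Node.
rewrite -tflatten_code; congr tflatten.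
exact: tflatmap.
Qed.

Lemma ePE : eP e = code_seq code_position (positions S).
Proof. exact: tpositionsE. Qed.

Lemma ePPE : ePP e = code_seq (code_pair code_position code_position) PP.
Proof. by rewrite /e /ePP /= tpositionsE tpairsE. Qed.

Lemma eA1E : eA1 e = code_seq code_atom (atoms1 x).
Proof.
rewrite /e /eA1 /= tatoms_code -/code_atom /atoms1 -tcat_code; congr tcat.
apply: tmap_map => -[R u] r /=; congr Node.
exact: tmap_map.
Qed.

Lemma eA2E : eA2 e = code_seq code_atom (atoms2 x).
Proof. by rewrite /e /eA2 /= tatoms_code. Qed.

Lemma tpmarkE p : tpmark (eF e) (code_position p) = code_name (pmark x p).
Proof. by rewrite eFE /tpmark tmarkE. Qed.

Lemma tmark_idxE (T : Type) (c : T -> tree) r R :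
  tmark (eF e) (tidx (code_seq c r)) (code_name R) = code_name (mark_name x (idx r) R).
Proof. by rewrite eFE tidxE tmarkE. Qed.

Lemma tschemaE : tschema e = code_schema (cq_schema x).
Proof.
rewrite /tschema /code_schema /cq_schema -!tcat_code; congr tcat.
  by apply: tmap_map => -[R ds] r; rewrite eDE.
congr tcat; last by rewrite eFE eDE.
rewrite ePE; apply: tmap_map => p r.
by rewrite tpmarkE eDE.
Qed.

Lemma tmethodsE : tmethods e = code_seq code_method (cq_methods x).
Proof.
rewrite /tmethods /cq_methods -!tcat_code; congr tcat.
  apply: tmap_map => -[[R m] dep] r; rewrite /= tif_bool /code_method /code_pair /=.
  by case: dep => //=; congr (Node (Node _ (Node _ _)) _); exact: tmap_map.
congr tcat; last by rewrite eFE.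
by rewrite ePE; apply: tmap_map => p r; rewrite tpmarkE.
Qed.

Lemma tconfE : tconf e = code_seq code_fact (cq_conf x).
Proof.
have botE : Node ttrue (tflatten (eC e)) = code_name (bot_value x).
  by rewrite eCE /bot_value /fresh /code_name [RHS]/=; congr Node; exact: tflatten_code.
rewrite /tconf /cq_conf botE -!tcat_code; congr tcat; first exact: tmap_map.
congr tcat.
  apply: tmap_map => -[R ds] r; rewrite /code_fact /code_pair /=.
  by do 2!congr Node; exact: tmap_map.
congr tcat; last first.
  by rewrite eFE.
rewrite ePE; apply: tflatmap => p r; rewrite eCE.
by apply: tmap_map => c r'; rewrite tpmarkE.
Qed.

Lemma tquery_atoms1E : tquery_atoms1 e = code_seq code_atom (query_atoms1 x).
Proof.
rewrite /tquery_atoms1 eA1E; apply: tmap_map => -[R us] r.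
rewrite /code_atom /code_pair /=; do 2!congr Node.
by apply: tmap_map => -[y|c] r' //=; rewrite /tvar -(tvnameE 0 [::]).
Qed.

Lemma tconstant_marksE m c : tconstant_marks e (code_name m) (code_name c) =
  code_seq code_atom (constant_marks x m c).
Proof.
rewrite /tconstant_marks ePPE; apply: tflatmap => -[p q] r /=.
by rewrite !tpmarkE teq_code tif_bool /=; case: (_ == _).
Qed.

Lemma tmark_atoms1E : tmark_atoms1 e = code_seq code_atom (mark_atoms1 x).
Proof.
rewrite /tmark_atoms1 eA1E; apply: tflatmap => -[R us] r /=.
rewrite -tflatten_code; congr tflatten; apply: tmap_code => -[y|c] r' //=.
by rewrite tmark_idxE tconstant_marksE.
Qed.

Lemma tquery_atoms2E : tquery_atoms2 e = code_seq code_atom (query_atoms2 x).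
Proof.
rewrite /tquery_atoms2 eA2E; apply: tmap_map => -[R us] r.
rewrite /code_atom /code_pair /=; do 2!congr Node.
apply: tmap_code => -[y|c] r' /=; rewrite /tvar.
  by [].
by rewrite tmark_idxE tcvarE.
Qed.

Lemma tmark_atoms2E : tmark_atoms2 e = code_seq code_atom (mark_atoms2 x).
Proof.
rewrite /tmark_atoms2 eA2E; apply: tflatmap => -[R us] r /=.
rewrite -tflatten_code; congr tflatten; apply: tmap_code => -[y|c] r' //=.
by rewrite tmark_idxE tcvarE.
Qed.

Lemma tcollision_termsE c k p : tcollision_terms c (code_name k) (code_position p) =
  code_seq code_term (collision_terms c k p).
Proof.
apply: tmap_code => d r; rewrite tidxE teq_code tif_bool.
have h3 : tvname 3 (code_name k) Leaf = code_name (vname 3 k [::]).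
  exact: (tvnameE 3 k [::]).
by rewrite h3 tvnameE; case: (_ == _).
Qed.

Lemma tcollision_atomsE : tcollision_atoms e = code_seq code_atom (collision_atoms x).
Proof.
rewrite /tcollision_atoms /collision_atoms ePPE -tflatten_code; congr tflatten.
apply: tmap_code => -[p q] r; rewrite eFE tidxE.
have h k n : tvname k (code_name n) Leaf = code_name (vname k n [::]).
  exact: (tvnameE k n [::]).
rewrite /tcollision !tcollision_termsE.
by rewrite -[Node ttrue (code_name (idx r))]/(code_name (true :: idx r)) !h.
Qed.

Lemma tflag_atomsE : tflag_atoms e = code_seq code_atom (flag_atoms x).
Proof.
have h7 n : tvname 7 (code_name n) Leaf = code_name (vname 7 n [::]).
  exact: (tvnameE 7 n [::]).
by rewrite /tflag_atoms eFE ePPE tidxE h7.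
Qed.

Lemma tfinal_atomE : tfinal_atom e = code_atom (final_atom x).
Proof. by rewrite /tfinal_atom eFE. Qed.

Lemma tcq_atomsE : tcq_atoms e = code_seq code_atom (cq_atoms x).
Proof.
rewrite /tcq_atoms tquery_atoms1E tmark_atoms1E tquery_atoms2E tmark_atoms2E.
by rewrite tcollision_atomsE tflag_atomsE !tcat_code.
Qed.

Lemma tcloseE a0 A : tclose (code_atom a0) (code_seq code_atom A) = code_query (close a0 A).
Proof.
rewrite /tclose /close.
have -> : tflatten (tmap (fun a _ => tflatten (tmap (fun u _ =>
    tif (thd u) Leaf (tsingle (ttl u))) (ttl a))) (Node (code_atom a0) (code_seq code_atom A))) =
    code_seq code_name (flatten [seq vars a | a <- a0 :: A]).
  rewrite -[Node (code_atom a0) _]/(code_seq code_atom (a0 :: A)).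
  apply: tflatmap => a _; apply: tflatmap => -[y|c] _ //=.
move: (flatten _) => ys.
have foldEx q : ttag_fold (code_seq code_bool [:: true; true]) (code_query q) (code_seq code_name ys) =
    code_query (foldl (fun q x => Ex x q) q ys).
  by rewrite /ttag_fold; elim: ys q => //= y ys IH q; rewrite -IH.
rewrite -foldEx; congr ttag_fold.
rewrite (tmap_map (d := fun a => code_query (Atom a.1 a.2)) (f := id)) // map_id.
rewrite -[Node _ (code_atom a0)]/(code_query (Atom a0.1 a0.2)).
by rewrite /ttag_fold; elim: A (Atom _ _) => //= a A IH q; rewrite -IH.
Qed.

Lemma cq_program_code : code_relevance (cq_reduction x) = cq_assemble (tenv (code_containment x)).
Proof.
rewrite /cq_assemble -/t -/e tschemaE tmethodsE tconfE tfinal_atomE tcq_atomsE tcloseE.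
by rewrite eFE.
Qed.
End Codes.

(** * Correctness of the reduction for conjunctive queries *)

Section Correctness.
Variable x : containment_input.

Let S := cont_schema x.
Let ACS := cont_methods x.
Let Conf := cont_conf x.
Let P := positions S.
Let PP := pairs P.
Let C : seq name := flatten (unzip2 Conf).
Let L1 := atoms1 x.
Let L2 := atoms2 x.
Let F := flag_rel x.
Let N := or_rel x.
Let beta := bdom x.
Let mu := cdom x.
Let S' := cq_schema x.
Let mark := mark_name x.
Let bot := bot_value x.

Variables (G1 G2 : name -> option name).
Hypotheses (wfS : wf_schema S) (wfACS : forall m, m \in ACS -> wf_method S m)
  (SConf : is_instance S [set` Conf])
  (tyL1 : forall a, a \in L1 -> typed_atom S G1 a)
  (tyL2 : forall a, a \in L2 -> typed_atom S G2 a)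
  (cL1 : forall a c, a \in L1 -> Cst c \in a.2 -> c \in C)
  (cL2 : forall a c, a \in L2 -> Cst c \in a.2 -> c \in C)
  (confL1 : forall R t, (R, t) \in Conf -> (R, map Cst t) \in L1).

(** * Positions, names of relations and the extended schema *)

Lemma memP p : p \in P <-> exists R s d r, (R, s ++ d :: r) \in S /\
  p = (R, (s ++ d :: r, (idx r, d))).
Proof.
split.
  case/mem_flatten_map => -[R ds] RS /mem_smap [s [d [r [/= dsE ->]]]].
  by exists R, s, d, r; rewrite -dsE.
case=> R [s [d [r [RS ->]]]]; apply/mem_flatten_map; exists (R, s ++ d :: r) => //.
by apply/mem_smap; exists s, d, r.
Qed.

Lemma memPP pq : pq \in PP <-> [/\ pq.1 \in P, pq.2 \in P & pdom pq.1 = pdom pq.2].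
Proof.
split.
  case/mem_flatten_map => p pP /mem_flatten_map [q qP].
  by case: eqP => // E; rewrite inE => /eqP ->.
case: pq => p q [/= pP qP E]; apply/mem_flatten_map; exists p => //.
by apply/mem_flatten_map; exists q => //; rewrite E eqxx mem_head.
Qed.

Lemma S_uniq R ds ds' : (R, ds) \in S -> (R, ds') \in S -> ds = ds'.
Proof. exact: schema_uniq. Qed.

Lemma size_rel R ds : (R, ds) \in S -> size R < size F.
Proof. by move=> /(map_f fst) /fresh_size. Qed.

Lemma size_mark i R : size F < size (mark i R).
Proof. by rewrite /mark /mark_name !size_cat /= size_cat -/F; lia. Qed.

(** The first false bit ends the unary index, and the copy of [F] that follows has a known
    length. *)
Lemma mark_inj i i' R R' : i = nseq (size i) true -> i' = nseq (size i') true ->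
  mark i R = mark i' R' -> i = i' /\ R = R'.
Proof.
move=> -> ->; rewrite /mark /mark_name; move: (size i) (size i').
elim=> [|n IHn] [|m] //=.
- by case=> /(congr1 (drop (size F).-1)); rewrite !drop_size_cat // => ->.
- by case=> /IHn [/(congr1 size)]; rewrite !size_nseq => -> ->.
Qed.

(** Lengths alone do not suffice: with empty index and empty relation name, both names have one bit
    more than [F], and their first bits differ. *)
Lemma mark_or i R : i = nseq (size i) true -> mark i R <> N.
Proof.
move=> ->; rewrite /mark /mark_name /N /or_rel; case: (size i) => [|n] //= [].
by move/(congr1 size); rewrite !size_cat /= size_cat -/F; lia.
Qed.

Lemma P_idx p : p \in P -> pidx p = nseq (size (pidx p)) true.
Proof. by case/memP => R [s [d [r [_ ->]]]]; rewrite /pidx /= size_idx idxE. Qed.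

Lemma pmark_inj p q : p \in P -> q \in P -> pmark x p = pmark x q -> p = q.
Proof.
move=> pP qP /(mark_inj (P_idx pP) (P_idx qP)).
case/memP: pP => R [s [d [r [RS ->]]]]; case/memP: qP => R' [s' [d' [r' [RS' ->]]]].
rewrite /pidx /prel /= => -[/eqP]; rewrite idx_eq => /eqP szr RR'; subst R'.
have E := S_uniq RS RS'; rewrite -E in RS' *.
have szs : size s = size s'.
  by move/(congr1 size): E; rewrite !size_cat /=; lia.
have [_ [-> ->]] : s = s' /\ d :: r = d' :: r'.
  by move/eqP: E; rewrite eqseq_cat // => /andP [/eqP -> /eqP ->].
by [].
Qed.

Lemma mem_S' R ds : (R, ds) \in S' <->
  [\/ exists2 ds0, (R, ds0) \in S & ds = beta :: ds0,
      exists2 p, p \in P & R = pmark x p /\ ds = [:: pdom p; mu],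
      R = F /\ ds = [:: beta] | R = N /\ ds = [:: beta; beta; beta]].
Proof.
rewrite /S' /cq_schema !mem_cat; split.
  case/or3P => [/mem_map_iff [[R0 ds0] RS [-> ->]]|/mem_map_iff [p pP [-> ->]]|].
  - by apply: Or41; exists ds0.
  - by apply: Or42; exists p.
  - by rewrite !inE => /orP [/eqP [-> ->]|/eqP [-> ->]]; [apply: Or43|apply: Or44].
case=> [[ds0 RS ->]|[p pP [-> ->]]|[-> ->]|[-> ->]]; apply/or3P.
- by apply: Or31; apply/mem_map_iff; exists (R, ds0).
- by apply: Or32; apply/mem_map_iff; exists p.
- by apply: Or33; rewrite !inE eqxx.
- by apply: Or33; rewrite !inE eqxx orbT.
Qed.

(** Relations of [S] are shorter than [F], while all new relations are at least as long as [F]. *)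
Lemma S_off R ds p : (R, ds) \in S -> [/\ R <> F, R <> N & p \in P -> R <> pmark x p].
Proof.
move=> /size_rel RF; split=> [E|E|_ E]; move: RF; rewrite E ?ltnn //.
  by rewrite /N /or_rel /= ltnNge leqnSn.
by rewrite ltnNge ltnW // size_mark.
Qed.

Lemma mark_off p : p \in P -> pmark x p <> F /\ pmark x p <> N.
Proof.
move=> pP; split; last exact: mark_or (P_idx pP).
have h : size F < size (pmark x p) by exact: size_mark.
by move=> E; rewrite E ltnn in h.
Qed.

Lemma beta_fresh R ds d : (R, ds) \in S -> d \in ds -> d <> beta /\ d <> mu.
Proof.
move=> RS dds; have : size d < size beta.
  by apply: fresh_size; apply/flattenP; exists ds => //; exact: (map_f snd RS).
by move=> lt; split=> E; move: lt; rewrite E ?ltnn //= ltnNge leqnSn.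
Qed.

Lemma F_neq_N : F <> N.
Proof. by move/(congr1 size) => /=; lia. Qed.

Lemma C_bot c : c \in C -> size c < size bot.
Proof. exact: fresh_size. Qed.

Lemma wf_S' : wf_schema S'.
Proof.
have uP : uniq P.
  rewrite /P /positions; move: wfS; rewrite /wf_schema.
  elim: S => //= -[R ds] s IHs /andP [Rs /IHs us]; rewrite cat_uniq us andbT.
  apply/andP; split.
    have uds ds' : uniq (smap (fun d r => (R, (ds', (idx r, d)))) ds).
      elim: {Rs} ds => //= d ds IH; rewrite IH andbT; apply/negP.
      move=> /mem_smap [s1 [d1 [r [E []]]]] /eqP; rewrite idx_eq => /eqP E' _.
      move/(congr1 size): E; rewrite size_cat /= E' => /eqP.
      by rewrite ltn_eqF // addnS ltnS leq_addl.
    exact: uds.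
  apply/hasPn => -[R' p] /mem_flatten_map [[R0 ds0] /(map_f fst) /= R0s].
  move=> /mem_smap [s1 [d1 [r [_ [-> _]]]]]; apply/negP => /mem_smap [? [? [? [_ [E]]]]] _.
  by move: Rs; rewrite -E R0s.
rewrite /wf_schema /S' /cq_schema /unzip1 !map_cat -!map_comp !cat_uniq.
apply/and3P; split; last (apply/and3P; split).
- by rewrite (eq_map (g := fst)) //; exact: wfS.
- apply/hasPn => R; rewrite mem_cat => h; apply/negP => /mem_map_iff [[R0 ds] RS /= E].
  subst R0; case/orP: h => [/mem_map_iff [p pP /= E]|].
    by have [_ _ /(_ pP)] := S_off p RS.
  have [RF RN _] := S_off (R, (ds, (R, R))) RS.
  by rewrite /= !inE => /orP [/eqP|/eqP].
- rewrite map_inj_in_uniq // => p q pP qP /=; exact: pmark_inj.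
- apply/hasPn => R; rewrite /= !inE => h; apply/negP => /mem_map_iff [p pP /= E].
  have [mF mN] := mark_off pP.
  by case/orP: h => /eqP E'; [apply: mF|apply: mN]; rewrite -E E'.
- by rewrite /= inE andbT; apply/eqP; exact: F_neq_N.
Qed.

(** These are the constants that a renaming at the domain [d] has to leave alone; those of the
    configuration are included, its facts being atoms of [L1]. *)
Definition known (c d : name) : Prop := exists a ds,
  [/\ a \in L1, (a.1, ds) \in S & (Cst c, d) \in zip a.2 ds].

Lemma all2P (T U : eqType) (r : T -> U -> bool) s t :
  all2 r s t -> size s = size t /\ forall u v, (u, v) \in zip s t -> r u v.
Proof.
elim: s t => [|u s IHs] [|v t] //= /andP [ruv /IHs [-> st]]; split=> // u' v'.
by rewrite inE => /orP [/eqP [-> ->]|/st].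
Qed.

Lemma typed_atomP S0 G a : typed_atom S0 G a -> exists ds,
  [/\ (a.1, ds) \in S0, size a.2 = size ds
    & forall y d, (Var y, d) \in zip a.2 ds -> G y = Some d].
Proof.
case=> ds Rds /all2P [sz h]; exists ds; split=> // y d /h.
by move=> /eqP.
Qed.

Lemma typed_atomI S0 (G : name -> option name) R us ds : (R, ds) \in S0 -> size us = size ds ->
  (forall y d, (Var y, d) \in zip us ds -> G y = Some d) -> typed_atom S0 G (R, us).
Proof.
move=> Rds sz h; exists ds => //=; elim: us ds sz h {Rds} => [|u us IH] [|d ds] //= [sz] h.
rewrite IH // => [|y d' yd]; last by apply: h; rewrite inE yd orbT.
by rewrite andbT; case: u h => // y h; rewrite (h y d) ?mem_head.
Qed.

Lemma pmarkE R s d r (T : Type) (r' : seq T) : size r' = size r ->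
  pmark x (R, (s ++ d :: r, (idx r, d))) = mark (idx r') R.
Proof. by rewrite /pmark /= => sz; rewrite !idxE sz. Qed.

Lemma position_of R ds s d r (T : Type) (r' : seq T) : (R, ds) \in S ->
    ds = s ++ d :: r -> size r' = size r ->
  (R, (ds, (idx r, d))) \in P /\ pmark x (R, (ds, (idx r, d))) = mark (idx r') R.
Proof.
move=> RS dsE szr; split; first by apply/memP; exists R, s, d, r; rewrite -dsE.
by rewrite {1}dsE (pmarkE _ _ _ szr).
Qed.

Lemma term_position G a s u r : typed_atom S G a -> a.2 = s ++ u :: r ->
  exists ds d s' r', [/\ (a.1, ds) \in S, ds = s' ++ d :: r', size s = size s',
    (a.1, (ds, (idx r', d))) \in P
    & pmark x (a.1, (ds, (idx r', d))) = mark (idx r) a.1].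
Proof.
move=> /typed_atomP [ds [RS sz _]] aE.
have lt : size s < size ds by rewrite -sz aE size_cat /= addnS ltnS leq_addr.
case dsE: (drop (size s) ds) => [|d r'].
  by move/(congr1 size)/eqP: dsE; rewrite size_drop subn_eq0 leqNgt lt.
have szs : size (take (size s) ds) = size s by rewrite size_take lt.
have {}dsE : ds = take (size s) ds ++ d :: r' by rewrite -dsE cat_take_drop.
have szr : size r = size r'.
  by move/eqP: sz; rewrite dsE aE !size_cat /= szs eqn_add2l => /eqP [].
have [pP pE] := position_of RS dsE szr.
by exists ds, d, (take (size s) ds), r'.
Qed.

Lemma zip_cat_cons (T U : eqType) s1 s2 (u : T) (v : U) t1 t2 :
  size s1 = size t1 -> (u, v) \in zip (s1 ++ u :: s2) (t1 ++ v :: t2).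
Proof. by move=> sz; rewrite zip_cat // mem_cat /= mem_head orbT. Qed.

Lemma mem_mark_atoms1 b : b \in mark_atoms1 x <-> exists c d p,
  [/\ known c d, p \in P, pdom p = d & b = (pmark x p, [:: Cst c; Cst c])].
Proof.
split.
  case/mem_flatten_map => a aL1 /flattenP [A /mem_smap [s [[y|c] [r [aE ->]]]] //].
  case/mem_flatten_map => -[p q] /memPP [/= pP qP pq].
  case: eqP => // E; rewrite inE => /eqP ->.
  have [ds [d [s' [r' [RS dsE sz p'P p'E]]]]] := term_position (tyL1 aL1) aE.
  exists c, (pdom q), q; split=> //.
  rewrite -pq; have -> : p = (a.1, (ds, (idx r', d))).
    by apply: pmark_inj; rewrite // p'E -E.
  by exists a, ds; split=> //; rewrite /pdom /= aE dsE; exact: zip_cat_cons.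
case=> c [d [q [[a [ds [aL1 Rds cd]]] qP qd ->]]].
have [ds' [Rds' sz _]] := typed_atomP (tyL1 aL1).
rewrite -(S_uniq Rds Rds') in sz.
have [s1 [s2 [t1 [t2 [aE dsE sz1 sz2]]]]] := (zip_splitP _ _ sz).1 cd.
apply/mem_flatten_map; exists a => //; apply/flattenP.
exists (constant_marks x (mark (idx s2) a.1) c).
  by apply/mem_smap; exists s1, (Cst c), s2.
apply/mem_flatten_map; exists ((a.1, (ds, (idx t2, d))), q).
  apply/memPP; split=> //.
  by apply/memP; exists a.1, t1, d, t2; rewrite -dsE.
by rewrite {1}dsE (pmarkE _ _ _ sz2) eqxx mem_head.
Qed.

Lemma mem_mark_atoms2 b : b \in mark_atoms2 x <-> exists a s c r,
  [/\ a \in L2, a.2 = s ++ Cst c :: r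
    & b = (mark (idx r) a.1, [:: Var (cvar (mark (idx r) a.1) c); Cst c])].
Proof.
split.
  case/mem_flatten_map => a aL2 /flattenP [A /mem_smap [s [[y|c] [r [aE ->]]]] //].
  by rewrite inE => /eqP ->; exists a, s, c, r.
case=> a [s [c [r [aL2 aE ->]]]]; apply/mem_flatten_map; exists a => //.
apply/flattenP; set b0 := (_, _); exists [:: b0]; last exact: mem_head.
by apply/mem_smap; exists s, (Cst c), r.
Qed.

Lemma mem_collision_atoms b : b \in collision_atoms x <-> exists s pq r,
  PP = s ++ pq :: r /\ b \in collision x (idx r) pq.
Proof.
split.
  by case/flattenP => A /mem_smap [s [pq [r [E ->]]]] ?; exists s, pq, r.
case=> s [pq [r [E br]]]; apply/flattenP; exists (collision x (idx r) pq) => //.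
by apply/mem_smap; exists s, pq, r.
Qed.

(** The case analysis behind the typing, the satisfaction and the constants of the constructed
    query. *)
Lemma cq_atoms_ind (Q : atom -> Prop) :
    (forall a, a \in L1 -> Q (a.1, Cst tag1 :: map term1 a.2)) ->
    (forall c p, known c (pdom p) -> p \in P -> Q (pmark x p, [:: Cst c; Cst c])) ->
    (forall a, a \in L2 -> Q (a.1, Var (vname 8 [::] [::]) ::
       smap (fun u r => term2 (mark (idx r) a.1) u) a.2)) ->
    (forall a s c r, a \in L2 -> a.2 = s ++ Cst c :: r ->
       Q (mark (idx r) a.1, [:: Var (cvar (mark (idx r) a.1) c); Cst c])) ->
    (forall s pq r, PP = s ++ pq :: r -> forall b, b \in collision x (idx r) pq -> Q b) ->
    (forall b, b \in flag_atoms x -> Q b) -> Q (final_atom x) ->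
  forall b, b \in final_atom x :: cq_atoms x -> Q b.
Proof.
move=> q1 m1 q2 m2 k f l b; rewrite inE => /orP [/eqP -> //|].
rewrite !mem_cat => /or4P [| | |/or3P []].
- by case/mem_map_iff => a aL ->; exact: q1.
- by case/mem_mark_atoms1 => c [d [p [cd pP pd ->]]]; apply: m1; rewrite ?pd.
- by case/mem_map_iff => a aL ->; exact: q2.
- by case/mem_mark_atoms2 => a [s [c [r [aL aE ->]]]]; exact: m2 aE.
- by case/mem_collision_atoms => s [pq [r [E br]]]; exact: k E _ br.
- exact: f.
Qed.

(** * Parsing of variable names and typing of the constructed query *)

Fixpoint untally (s : name) : nat * name :=
  match s with
  | true :: s' => let: (n, r) := untally s' in (n.+1, r)
  | false :: s' => (0, s')
  | [::] => (0, [::])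
  end.

Lemma untallyE n r : untally (nseq n true ++ false :: r) = (n, r).
Proof. by elim: n => //= n ->. Qed.

(** Inverts [vname] at unary indices, so that typings and valuations can be defined by cases on the
    kind of a variable. *)
Definition vparse (s : name) : nat * (nat * name) :=
  let: (k, s1) := untally s in (k, untally s1).

Lemma vparseE k n r : n = nseq (size n) true -> vparse (vname k n r) = (k, (size n, r)).
Proof. by move=> ->; rewrite /vparse /vname untallyE untallyE size_nseq. Qed.

Lemma vparse0 k r : vparse (vname k [::] r) = (k, (0, r)).
Proof. exact: vparseE. Qed.

Lemma vparse_idx (T : Type) k (s : seq T) r : vparse (vname k (idx s) r) = (k, (size s, r)).
Proof. by rewrite vparseE ?size_idx // idxE. Qed.

Lemma vparse_idxS (T : Type) k (s : seq T) r :
  vparse (vname k (true :: idx s) r) = (k, ((size s).+1, r)).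
Proof. by rewrite vparseE /= ?size_idx // idxE. Qed.

Lemma zip_smapP (T B U : eqType) (f : T -> seq T -> B) us (ds : seq U) b d :
  size us = size ds -> (b, d) \in zip (smap f us) ds -> exists s u r s' r',
    [/\ us = s ++ u :: r, ds = s' ++ d :: r', size s = size s', size r = size r'
      & b = f u r].
Proof.
elim: us ds => [|u us IH] [|d0 ds] //= [sz]; rewrite inE => /orP [/eqP [-> ->]|].
  by exists [::], u, us, [::], ds.
case/(IH _ sz) => s [u1 [r [s' [r' [-> -> ? ? ->]]]]].
by exists (u :: s), u1, r, (d0 :: s'), r'; split=> //=; congr _.+1.
Qed.

Lemma zip_mapP (T B U : eqType) (f : T -> B) us (ds : seq U) b d :
  (b, d) \in zip (map f us) ds -> exists2 u, (u, d) \in zip us ds & b = f u.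
Proof.
elim: us ds => [|u us IH] [|d0 ds] //=; rewrite inE => /orP [/eqP [-> ->]|].
  by exists u; rewrite // mem_head.
by case/IH => u1 ? ->; exists u1; rewrite // inE orbC; apply/orP; left.
Qed.

Lemma nth_rev_cat (T : Type) (y0 : T) s y r : nth y0 (rev (s ++ y :: r)) (size r) = y.
Proof. by rewrite rev_cat rev_cons -cats1 -catA nth_cat size_rev ltnn subnn. Qed.

Let pos0 : position := ([::], ([::], ([::], [::]))).
(** The index of a pair in the names of variables is the number of pairs after it, hence the
    reversal. *)
Definition pair_at (n : nat) : position * position := nth (pos0, pos0) (rev PP) n.

Lemma pair_atE s pq (r : seq (position * position)) :
  PP = s ++ pq :: r -> pair_at (size r) = pq.
Proof. by move=> E; rewrite /pair_at E nth_rev_cat. Qed.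

Lemma pair_split s pq r : PP = s ++ pq :: r ->
  [/\ pq.1 \in P, pq.2 \in P & pdom pq.1 = pdom pq.2].
Proof. by move=> E; apply/memPP; rewrite E mem_cat mem_head orbT. Qed.

(** The variable replacing a constant only carries the name of a relation M; its domain is recovered
    as that of the first attribute of this relation. *)
Definition mark_dom (m : name) : name :=
  head [::] (nth [::] (unzip2 S') (index m (unzip1 S'))).

Lemma mark_domE p : p \in P -> mark_dom (pmark x p) = pdom p.
Proof.
move=> pP; have mS : (pmark x p, [:: pdom p; mu]) \in S'.
  by apply/mem_S'; apply: Or42; exists p.
rewrite /mark_dom; have iS : index (pmark x p) (unzip1 S') < size S'.
  by rewrite -(size_map fst) index_mem (map_f fst mS).
have E : nth ([::], [::]) S' (index (pmark x p) (unzip1 S')) = (pmark x p, [:: pdom p; mu]).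
  case E : (nth _ _ _) => [R ds]; have RS := mem_nth ([::], [::]) iS.
  rewrite E in RS.
  have RE : R = pmark x p.
    by rewrite -[R]/(R, ds).1 -E -(nth_map _ [::]) // nth_index // (map_f fst mS).
  rewrite RE in RS *; congr pair.
  exact: schema_uniq wf_S' RS mS.
by rewrite /unzip2 (nth_map ([::], [::])) // E.
Qed.

(** In kind 2, dropping the constant from [r] leaves the name of the relation M. In kinds 4 and 5,
    [r] is the index of the attribute in unary. The kinds from 6 on are tags. *)
Definition query_dom (s : name) : option name :=
  let: (k, (n, r)) := vparse s in
  match k with
  | 0 => G1 r
  | 1 => G2 r
  | 2 => Some (mark_dom (drop n r))
  | 3 => Some (pdom (pair_at n).1)
  | 4 => Some (nth [::] (rev (pdoms (pair_at n).1)) (size r))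
  | 5 => Some (nth [::] (rev (pdoms (pair_at n).2)) (size r))
  | _ => Some beta
  end.

Lemma cvar_parse m c : vparse (cvar m c) = (2, (size c, c ++ m)).
Proof. exact: vparse_idx. Qed.

Lemma position_split p : p \in P -> exists s r,
  [/\ (prel p, pdoms p) \in S, pdoms p = s ++ pdom p :: r & pidx p = idx r].
Proof. by case/memP => R [s [d [r [RS ->]]]]; exists s, r. Qed.

Lemma split_eq (T : Type) (s s' : seq T) y y' r r' : size r = size r' ->
  s ++ y :: r = s' ++ y' :: r' -> y = y'.
Proof.
by move=> sz /(congr1 (fun l => nth y (rev l) (size r))); rewrite nth_rev_cat sz nth_rev_cat.
Qed.

Lemma typed_query b : b \in final_atom x :: cq_atoms x -> typed_atom S' query_dom b.
Proof.
have NS : (N, [:: beta; beta; beta]) \in S' by apply/mem_S'; apply: Or44.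
have FS : (F, [:: beta]) \in S' by apply/mem_S'; apply: Or43.
have relS R ds : (R, ds) \in S -> (R, beta :: ds) \in S'.
  by move=> RS; apply/mem_S'; apply: Or41; exists ds.
have markS p : p \in P -> (pmark x p, [:: pdom p; mu]) \in S'.
  by move=> pP; apply/mem_S'; apply: Or42; exists p.
(* Common to the two facts of a collision, whose shared variable is typed by the domain of the first
   position. *)
have collS c p k : k = idx (nseq (size k) true) -> p \in P -> pdom p = pdom (pair_at (size k)).1 ->
    (forall (r : seq name), query_dom (vname c k (idx r)) = Some (nth [::] (rev (pdoms p)) (size r))) ->
    forall t, (forall y, t = Var y -> query_dom y = Some beta) ->
    typed_atom S' query_dom (prel p, t :: collision_terms c k p).
  move=> kE pP pd Gc t Gt; have [s [r [RS dsE idxr]]] := position_split pP.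
  apply: (typed_atomI (relS _ _ RS)) => /=; first by rewrite size_smap.
  move=> y d; rewrite inE => /orP [/eqP [tE ->]|]; first exact: Gt.
  case/zip_smapP => // s1 [u [r1 [s2 [r2 [E1 E2 _ sz12 ye]]]]].
  have ud : u = d := split_eq sz12 (etrans (esym E1) E2).
  move: ye; case: eqP => [ir [->]|_ [->]].
    rewrite /query_dom vparseE; last by rewrite {1}kE idxE size_nseq.
    rewrite -pd -ud; congr Some; apply: (@split_eq _ s s1 _ _ r r1).
      by rewrite -(size_idx r) -(size_idx r1) ir idxr.
    by rewrite -dsE E1.
  by rewrite Gc {1}E1 nth_rev_cat ud.
apply: cq_atoms_ind => [a aL|c p cd pP|a aL|a s c r aL aE|s pq r E b'|b'|].
- have [ds [RS sz Ga]] := typed_atomP (tyL1 aL).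
  apply: (typed_atomI (relS _ _ RS)) => /=; first by rewrite size_map sz.
  move=> y d; rewrite inE => /orP [/eqP []//|/zip_mapP [[z|c] zd //= [->]]].
  by rewrite /query_dom vparse0; exact: Ga.
- by apply: typed_atomI (markS _ pP) _ _ => //= y d; rewrite !inE.
- have [ds [RS sz Ga]] := typed_atomP (tyL2 aL).
  apply: (typed_atomI (relS _ _ RS)) => /=; first by rewrite size_smap sz.
  move=> y d; rewrite inE => /orP [/eqP [-> ->]|]; first by rewrite /query_dom vparse0.
  case/zip_smapP => // s1 [u [r1 [s2 [r2 [E1 E2 sz1 sz2]]]]].
  case: u E1 => [z|c] E1 [->].
    by rewrite /query_dom vparse0; apply: Ga; rewrite E1 E2 zip_cat_cons.
  rewrite /query_dom cvar_parse drop_size_cat //.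
  have [pP pE] := position_of RS E2 sz2.
  by rewrite -pE mark_domE.
- have [ds [d [s' [r' [_ _ _ pP pE]]]]] := term_position (tyL2 aL) aE.
  rewrite -pE; apply: typed_atomI (markS _ pP) _ _ => //= y d'.
  rewrite !inE => /orP [/eqP [-> ->]|/eqP []//].
  by rewrite /query_dom cvar_parse drop_size_cat // mark_domE.
- have [pP qP pq12] := pair_split E; have pE := pair_atE E.
  rewrite !inE => /or3P [] /eqP ->.
  + apply: collS => //; rewrite ?size_idx ?pE ?idxE ?size_nseq // => r1.
    by rewrite -!idxE /query_dom vparse_idx pE size_idx.
  + apply: collS => //; rewrite ?size_idx ?pE ?idxE ?size_nseq //.
      by move=> r1; rewrite -!idxE /query_dom vparse_idx pE size_idx.
    by move=> y [<-]; rewrite -idxE /query_dom vparse_idx.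
  + apply: typed_atomI NS _ _ => //= y d; rewrite !inE.
    case/or3P => /eqP [-> ->]; rewrite /query_dom ?vparse_idx ?vparse_idxS //.
- rewrite !inE => /orP [] /eqP ->.
    by apply: typed_atomI FS _ _ => //= y d; rewrite !inE => /eqP [-> ->]; rewrite /query_dom vparse0.
  apply: typed_atomI NS _ _ => //= y d; rewrite !inE.
  by case/or3P => /eqP [-> ->]; rewrite /query_dom ?vparse_idx ?vparse0.
- apply: typed_atomI NS _ _ => //= y d; rewrite !inE.
  by case/or3P => /eqP [] // -> ->; rewrite /query_dom vparse0.
Qed.

(** * The initial configuration of the constructed input *)

Let K0 : set fact := [set` cq_conf x].

Lemma conf_fact R t : (R, t) \in Conf -> K0 (R, tag1 :: t).
Proof.
by move=> Rt; rewrite /K0 /= /cq_conf mem_cat; apply/orP; left; apply/mem_map_iff; exists (R, t).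
Qed.

Lemma conf_dummy R ds : (R, ds) \in S -> K0 (R, tag0 :: [seq bot | _ <- ds]).
Proof.
move=> RS; rewrite /K0 /= /cq_conf !mem_cat; apply/or4P; apply: Or42.
by apply/mem_map_iff; exists (R, ds).
Qed.

Lemma conf_mark p c : p \in P -> c \in C -> K0 (pmark x p, [:: bot; c]).
Proof.
move=> pP cC; rewrite /K0 /= /cq_conf !mem_cat; apply/or4P; apply: Or43.
by apply/mem_flatten_map; exists p => //; apply/mem_map_iff; exists c.
Qed.

Lemma conf_flag : K0 (F, [:: tag0]).
Proof. by rewrite /K0 /= /cq_conf !mem_cat mem_head !orbT. Qed.

Lemma conf_or t : t \in or_table -> K0 (N, t).
Proof.
move=> tT; rewrite /K0 /= /cq_conf !mem_cat; apply/or4P; apply: Or44.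
by rewrite inE; apply/orP; right; apply/mem_map_iff; exists t.
Qed.

Lemma conf_cases R t : K0 (R, t) ->
  [\/ exists2 t0, (R, t0) \in Conf & t = tag1 :: t0,
      exists2 ds, (R, ds) \in S & t = tag0 :: [seq bot | _ <- ds],
      exists p c, [/\ p \in P, c \in C, R = pmark x p & t = [:: bot; c]]
    | (R = F /\ t = [:: tag0]) \/ (R = N /\ t \in or_table)].
Proof.
rewrite /K0 /= /cq_conf !mem_cat => /or4P [].
- by case/mem_map_iff => -[R0 t0] ? [-> ->]; apply: Or41; exists t0.
- by case/mem_map_iff => -[R0 ds] ? [-> ->]; apply: Or42; exists ds.
- case/mem_flatten_map => p pP /mem_map_iff [c cC [-> ->]].
  by apply: Or43; exists p, c.
- rewrite inE => /orP [/eqP [-> ->]|/mem_map_iff [u uT [-> ->]]]; apply: Or44.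
    by left.
  by right.
Qed.

Lemma conf_instance : is_instance S' K0.
Proof.
move=> R t /conf_cases [[t0 Rt ->]|[ds RS ->]|[p [c [pP cC -> ->]]]|].
- have [ds RS sz] := SConf Rt; exists (beta :: ds); last by rewrite /= sz.
  by apply/mem_S'; apply: Or41; exists ds.
- exists (beta :: ds); last by rewrite /= size_map.
  by apply/mem_S'; apply: Or41; exists ds.
- exists [:: pdom p; mu] => //.
  by apply/mem_S'; apply: Or42; exists p.
case=> [[-> ->]|[-> tT]].
  by exists [:: beta] => //; apply/mem_S'; apply: Or43.
exists [:: beta; beta; beta]; first by apply/mem_S'; apply: Or44.
by move: tT; rewrite !inE => /or3P [] /eqP ->.
Qed.

(** * What the constructed query expresses *)

Lemma holds_query K : holds K (cq_query x) <->
  exists v, satisfied K v (final_atom x :: cq_atoms x).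
Proof.
rewrite (@holds_cq S'); last first.
- by apply: typed_close; exact: typed_query.
- exact: is_cq_close.
by split=> -[v h]; exists v => a aA; apply: h; rewrite ?atoms_close // -atoms_close.
Qed.

Definition query1_holds (K : set fact) : Prop := exists v,
  (forall a, a \in L1 -> K (a.1, tag1 :: map (tval v) a.2)) /\
  (forall c p, known c (pdom p) -> p \in P -> K (pmark x p, [:: c; c])).

(** The value [w m c] stands for the constant [c] at the position of the relation [m]; only a fact
    of [m], demanded by [query2_holds], ties it to [c]. *)
Definition values2 (v : name -> name) (w : name -> name -> name) (a : atom) : seq name :=
  smap (fun u r => match u with Var y => v y | Cst c => w (mark (idx r) a.1) c end) a.2.

Definition query2_holds (K : set fact) : Prop := exists v w,
  (forall a, a \in L2 -> K (a.1, tag1 :: values2 v w a)) /\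
  (forall a s c r, a \in L2 -> a.2 = s ++ Cst c :: r ->
     K (mark (idx r) a.1, [:: w (mark (idx r) a.1) c; c])).

(** The common entry [e] is a pair of a value and a domain, so that the two attributes have the same
    domain. *)
Definition collides (K : set fact) : Prop := exists R ds t R' ds' t' e,
  [/\ ((R, ds) \in S) && ((R', ds') \in S), K (R, tag0 :: t), K (R', tag1 :: t'),
      e \in zip t ds & e \in zip t' ds'].

Lemma or_table_true K a b c : (forall t, K (N, t) -> t \in or_table) ->
  K (N, [:: a; b; c]) -> c = tag1 -> a = tag1 \/ b = tag1.
Proof. by move=> KN /KN; rewrite !inE => /or3P [] /eqP [-> -> ->] //; [right|left]. Qed.

Lemma zip_smap_mem (f : name -> seq name -> name) s d r :
  (f d r, d) \in zip (smap f (s ++ d :: r)) (s ++ d :: r).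
Proof. by elim: s => [|d0 s IH] /=; rewrite ?mem_head // inE IH orbT. Qed.

(** As the table is intact, truth of the disjunction at index 0 is passed on to higher indices until
    some collision has tag 1 or, at the last index, the flag or the second query does. *)
Lemma query_sound K : (forall t, K (N, t) -> t \in or_table) -> holds K (cq_query x) ->
  query1_holds K /\ [\/ K (F, [:: tag1]), query2_holds K | collides K].
Proof.
move=> KN /holds_query [V hV].
have hA a : a \in cq_atoms x -> K (a.1, map (tval V) a.2).
  by move=> aA; apply: hV; rewrite inE aA orbT.
split.
  exists (fun y => V (vname 0 [::] y)); split=> [a aL|c p cd pP].
    have : (a.1, Cst tag1 :: map term1 a.2) \in cq_atoms x.
      by rewrite mem_cat; apply/orP; left; apply/mem_map_iff; exists a.
    move=> /hA /=; rewrite -map_comp; congr (K (_, _ :: _)).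
    by apply: eq_map => -[].
  have : (pmark x p, [:: Cst c; Cst c]) \in cq_atoms x.
    rewrite !mem_cat; apply/orP; right; apply/orP; left.
    by apply/mem_mark_atoms1; exists c, (pdom p), p.
  by move/hA.
have V0 : V (vname 7 [::] [::]) = tag1.
  by have := hV _ (mem_head _ _) => /= /KN; rewrite !inE => /or3P [] /eqP [].
have coll s pq r b : PP = s ++ pq :: r -> b \in collision x (idx r) pq ->
    K (b.1, map (tval V) b.2).
  move=> E br; apply: hA; rewrite !mem_cat; do 4![apply/orP; right].
  by apply/orP; left; apply/mem_collision_atoms; exists s, pq, r.
(* The prefix [s] loses its last pair while the index, which is the length of [r], grows by one. *)
have chain s r : PP = s ++ r -> V (vname 7 (idx r) [::]) = tag1 ->
    V (vname 7 (idx PP) [::]) = tag1 \/ collides K.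
  elim/last_ind: s r => [|s pq IH] r E Vr; first by left; rewrite E.
  rewrite -cats1 -catA /= in E.
  have [pP qP _] := pair_split E.
  have h := coll _ _ _ _ E.
  have /or_table_true : K (N, [:: V (vname 7 (idx (pq :: r)) [::]); V (vname 6 (idx r) [::]);
      V (vname 7 (idx r) [::])]).
    apply: (h (N, [:: Var (vname 7 (idx (pq :: r)) [::]); Var (vname 6 (idx r) [::]);
      Var (vname 7 (idx r) [::])])).
    by rewrite /collision !inE eqxx !orbT.
  case/(_ KN Vr) => [|B1]; first exact: IH.
  have h1 := h _ (mem_head _ _).
  have /h h2 : (prel pq.2, Var (vname 6 (idx r) [::]) :: collision_terms 5 (idx r) pq.2)
      \in collision x (idx r) pq by rewrite /collision !inE eqxx orbT.
  rewrite /= B1 in h2; right.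
  have [s1 [r1 [RS1 dsE1 i1]]] := position_split pP.
  have [s2 [r2 [RS2 dsE2 i2]]] := position_split qP.
  have mem c p s' r' : pdoms p = s' ++ pdom p :: r' -> pidx p = idx r' ->
      (V (vname 3 (idx r) [::]), pdom p) \in
      zip (map (tval V) (collision_terms c (idx r) p)) (pdoms p).
    move=> dE iE; rewrite /collision_terms map_smap dE.
    set f := fun _ _ => _.
    have fE : f (pdom p) r' = V (vname 3 (idx r) [::]) by rewrite /f iE eqxx.
    by rewrite -fE; exact: zip_smap_mem.
  exists (prel pq.1), (pdoms pq.1), (map (tval V) (collision_terms 4 (idx r) pq.1)).
  exists (prel pq.2), (pdoms pq.2), (map (tval V) (collision_terms 5 (idx r) pq.2)).
  exists (V (vname 3 (idx r) [::]), pdom pq.1); split=> //.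
  - by rewrite RS1 RS2.
  - exact: mem dsE1 i1.
  - have [_ _ ->] := pair_split E; exact: mem dsE2 i2.
have flag b : b \in flag_atoms x -> K (b.1, map (tval V) b.2).
  by move=> bf; apply: hA; rewrite !mem_cat bf !orbT.
have [SN|] := chain PP [::] (esym (cats0 _)) V0; last by move=> ?; apply: Or33.
have Kflag : K (F, [:: V (vname 9 [::] [::])]) by exact: flag _ (mem_head _ _).
have /or_table_true : K (N, [:: V (vname 9 [::] [::]); V (vname 8 [::] [::]);
    V (vname 7 (idx PP) [::])]).
  apply: (flag (N, [:: Var (vname 9 [::] [::]); Var (vname 8 [::] [::]);
    Var (vname 7 (idx PP) [::])])).
  by rewrite /flag_atoms !inE eqxx orbT.
case/(_ KN SN) => [a1|b1]; first by apply: Or31; rewrite -a1.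
apply: Or32; exists (fun y => V (vname 1 [::] y)), (fun m c => V (cvar m c)).
split=> [a aL|a s c r aL aE].
  have : (a.1, Var (vname 8 [::] [::]) :: smap (fun u r => term2 (mark (idx r) a.1) u) a.2)
      \in cq_atoms x.
    rewrite !mem_cat; do 2![apply/orP; right]; apply/orP; left.
    by apply/mem_map_iff; exists a.
  move=> /hA /=; rewrite b1 map_smap; congr (K (_, _ :: _)).
  by apply: eq_smap => -[].
have : (mark (idx r) a.1, [:: Var (cvar (mark (idx r) a.1) c); Cst c]) \in cq_atoms x.
  rewrite !mem_cat; do 3![apply/orP; right]; apply/orP; left.
  by apply/mem_mark_atoms2; exists a, s, c, r.
by move/hA.
Qed.

(* Which disjunct of the query is made true: the flag ([a]), the second query
   ([b]) or the [j]-th collision counted from the last one ([k]). *)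
Definition witness (a b k : bool) (j : nat) (v1 v2 : name -> name)
    (w : name -> name -> name) (t t' : seq name) (s : name) : name :=
  let: (i, (n, r)) := vparse s in
  match i with
  | 0 => v1 r
  | 1 => if b then v2 r else bot
  | 2 => if b then w (drop n r) (take n r) else bot
  | 3 => if k && (n == j) then nth bot (rev t) (size (pidx (pair_at n).1)) else bot
  | 4 => if k && (n == j) then nth bot (rev t) (size r) else bot
  | 5 => if k && (n == j) then nth bot (rev t') (size r) else bot
  | 6 => if k && (n == j) then tag1 else tag0
  | 7 => if [|| a, b | k && (n <= j)] then tag1 else tag0
  | 8 => if b then tag1 else tag0
  | _ => if a then tag1 else tag0
  end.

Lemma smap_const (T U : Type) (u : U) (s : seq T) : smap (fun _ _ => u) s = [seq u | _ <- s].
Proof. exact: smap_map. Qed.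

Lemma eq_map_const (T T' U : Type) (u : U) (s : seq T) (s' : seq T') :
  size s = size s' -> [seq u | _ <- s] = [seq u | _ <- s'].
Proof. by elim: s s' => [|y s IH] [|y' s'] //= [/IH ->]. Qed.

(** Exactly one disjunct is chosen; the atoms of all the others are satisfied by dummy facts of tag
    0. *)
Lemma query_witness K (a b k : bool) j v1 v2 w t t' :
    K0 `<=` K ->
    (forall a, a \in L1 -> K (a.1, tag1 :: map (tval v1) a.2)) ->
    (forall c p, known c (pdom p) -> p \in P -> K (pmark x p, [:: c; c])) ->
    [|| [&& a, ~~ b & ~~ k], [&& ~~ a, b & ~~ k] | [&& ~~ a, ~~ b & k]] ->
    (a -> K (F, [:: tag1])) ->
    (b -> (forall a, a \in L2 -> K (a.1, tag1 :: values2 v2 w a)) /\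
      (forall a s c r, a \in L2 -> a.2 = s ++ Cst c :: r ->
         K (mark (idx r) a.1, [:: w (mark (idx r) a.1) c; c]))) ->
    (k -> let: (p, q) := pair_at j in [/\ j < size PP,
      K (prel p, tag0 :: t), K (prel q, tag1 :: t'), size t = size (pdoms p) /\
      size t' = size (pdoms q)
      & nth bot (rev t) (size (pidx p)) = nth bot (rev t') (size (pidx q))]) ->
  holds K (cq_query x).
Proof.
move=> K0K h1 hm mode ha hb hk; apply/holds_query.
pose V := witness a b k j v1 v2 w t t'; exists V => b0 b0A.
have orK u : u \in or_table -> K (N, u) by move=> uT; apply/K0K/conf_or.
move: b0 b0A; apply: cq_atoms_ind => [a0 aL|c p cd pP|a0 aL|a0 s c r aL aE|s pq r E b1|b1|].
- have := h1 _ aL; rewrite /= -map_comp; congr (K (_, _ :: _)).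
  by apply: eq_map => -[y|c] //=; rewrite /V /witness vparse0.
- exact: hm.
- have [ds [RS sz _]] := typed_atomP (tyL2 aL).
  rewrite /= {1}/V /witness vparse0 map_smap; case bE: (b) hb => hb.
    have [/(_ _ aL) + _] := hb isT; congr (K (_, _ :: _)).
    apply: eq_smap => -[y|c] r /=; rewrite /V /witness bE ?vparse0 ?cvar_parse //.
    by rewrite drop_size_cat // take_size_cat.
  rewrite (_ : smap _ a0.2 = [seq bot | _ <- ds]); first exact/K0K/conf_dummy.
  rewrite -(eq_map_const _ sz) -smap_const; apply: eq_smap => -[y|c] r /=.
    by rewrite /V /witness vparse0 bE.
  by rewrite /V /witness cvar_parse bE.
- rewrite /= {1}/V /witness cvar_parse; case bE: (b) hb => hb.
    rewrite drop_size_cat // take_size_cat //; have [_ h] := hb isT; exact: (h a0 s c r aL aE).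
  (* When the second query is not chosen, its constants are replaced by [bot], and the dummy facts
     M(bot, c) apply. *)
  have cC : c \in C by apply: cL2 aL _; rewrite aE mem_cat mem_head orbT.
  have [ds [d [s' [r' [_ _ _ pP <-]]]]] := term_position (tyL2 aL) aE.
  exact/K0K/conf_mark.
- have [pP qP pq12] := pair_split E; have pE := pair_atE E.
  have [s1 [r1 [RS1 dsE1 i1]]] := position_split pP.
  have [s2 [r2 [RS2 dsE2 i2]]] := position_split qP.
  have collE c p u : p \in P ->
      V (vname 3 (idx r) [::]) = nth bot u (size (pidx p)) ->
      (forall r' : seq name, V (vname c (idx r) (idx r')) = nth bot u (size r')) ->
      map (tval V) (collision_terms c (idx r) p) =
      smap (fun _ (r' : seq name) => nth bot u (size r')) (pdoms p).
    move=> _ V3 Vc; rewrite map_smap; apply: eq_smap => d r' /=.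
    by case: eqP => [irE|_] /=; rewrite ?Vc // V3 -irE size_idx.
  have collK c p : p \in P -> k && (size r == j) = false ->
      (forall r' : seq name, V (vname c (idx r) (idx r')) = bot) ->
      map (tval V) (collision_terms c (idx r) p) = [seq bot | _ <- pdoms p].
    move=> _ kF Vc; rewrite map_smap -smap_const; apply: eq_smap => d r' /=.
    by case: eqP => _ /=; rewrite ?Vc // /V /witness vparse_idx kF.
  rewrite !inE => /or3P [] /eqP ->.
  + rewrite /=; case kj: (k && (size r == j)).
      move: kj hk => /andP [kT /eqP rj]; rewrite -rj pE => /(_ kT).
      case: (pq) E pE pP qP pq12 => p q /= E pE pP qP pq12 [_ Kt Kt' [sz sz'] nE].
      rewrite (@collE _ _ (rev t)) ?smap_nth //.
        by rewrite /V /witness vparse_idx kT rj eqxx -rj pE.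
      by move=> r'; rewrite /V /witness vparse_idx kT rj eqxx size_idx.
    rewrite collK //; first exact/K0K/conf_dummy.
    by move=> r'; rewrite /V /witness vparse_idx kj.
  + rewrite /=; case kj: (k && (size r == j)).
      move: kj hk => /andP [kT /eqP rj]; rewrite -rj pE => /(_ kT).
      case: (pq) E pE pP qP pq12 => p q /= E pE pP qP pq12 [_ Kt Kt' [sz sz'] nE].
      rewrite (@collE _ _ (rev t')) ?smap_nth //.
      * by rewrite /V /witness vparse_idx kT rj eqxx.
      * by rewrite /V /witness vparse_idx kT rj eqxx -rj pE.
      * by move=> r'; rewrite /V /witness vparse_idx kT rj eqxx size_idx.
    rewrite collK //; last by move=> r'; rewrite /V /witness vparse_idx kj.
    by rewrite /V /witness vparse_idx kj; exact/K0K/conf_dummy.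
  + apply: orK; rewrite /= /V /witness vparse_idxS !vparse_idx.
    case: (a) (b) (k) mode => -[] [] //= _.
    (* The row is (1, 0, 1), (0, 1, 1) or (0, 0, 0) as the index is below, at or above [j]. *)
    by case: (ltngtP (size r) j).
- rewrite !inE => /orP [] /eqP ->.
    rewrite /= /V /witness vparse0; case: (a) ha => [/(_ isT) //|_].
    exact/K0K/conf_flag.
  apply: orK; rewrite /= /V /witness !vparse0 vparse_idx.
  (* If a collision is chosen, the disjunction from the last index on is false, since [j] is less
     than [size PP]. *)
  case: (a) (b) (k) mode hk => -[] [] //= _ /(_ isT).
  case: (pair_at j) => p q [jPP _ _ _ _].
  by rewrite leqNgt jPP.
- apply: orK; rewrite /= /V /witness vparse0.
  by case: (a) (b) (k) mode => -[] [].
Qed.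

Lemma zip_position R ds t e d : (R, ds) \in S -> size t = size ds -> (e, d) \in zip t ds ->
  exists i, [/\ (R, (ds, (i, d))) \in P & nth bot (rev t) (size i) = e].
Proof.
move=> RS sz /(zip_splitP _ _ sz).1 [s1 [s2 [t1 [t2 [tE dsE sz1 sz2]]]]].
exists (idx t2); split; first by apply/memP; exists R, t1, d, t2; rewrite -dsE.
by rewrite size_idx -sz2 tE nth_rev_cat.
Qed.

Lemma S'_size K R ds t b : is_instance S' K -> (R, ds) \in S -> K (R, b :: t) ->
  size t = size ds.
Proof.
move=> S'K RS /S'K [ds' /mem_S' [[ds0 RS0 ->]|[p pP [RE _]]|[RE _]|[RE _]]] /=.
- by case; rewrite (S_uniq RS RS0).
- by have [_ _ /(_ pP)] := S_off p RS.
- by have [] := S_off pos0 RS.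
- by have [] := S_off pos0 RS.
Qed.

Lemma query_complete K : K0 `<=` K -> is_instance S' K -> query1_holds K ->
    [\/ K (F, [:: tag1]), query2_holds K | collides K] ->
  holds K (cq_query x).
Proof.
move=> K0K S'K [v1 [h1 hm]].
case=> [KF|[v2 [w h2]]|[R [ds [t [R' [ds' [t' [[e d] [/andP [RS RS'] Kt Kt' et et']]]]]]]]].
- exact: (@query_witness K true false false 0 v1 v1 (fun _ _ => bot) [::] [::]).
- exact: (@query_witness K false true false 0 v1 v2 w [::] [::]).
have sz := S'_size S'K RS Kt; have sz' := S'_size S'K RS' Kt'.
have [i [pP iE]] := zip_position RS sz et.
have [i' [qP iE']] := zip_position RS' sz' et'.
set p := (R, _) in pP; set q := (R', _) in qP.
have pqPP : (p, q) \in PP by apply/memPP.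
have [s [r E]] : exists s r, PP = s ++ (p, q) :: r.
  by case: (splitPr pqPP) => s r; exists s, r.
apply: (@query_witness K false false true (size r) v1 v1 (fun _ _ => bot) t t') => //.
rewrite (pair_atE E) => _; split=> //.
- by rewrite E size_cat /= addnS ltnS leq_addl.
- by rewrite iE iE'.
Qed.

(** * Renaming of the values not known at their domain *)

Definition long (v : name) : name := true :: bot ++ v.
(** A value not known at [d] is made longer than [bot], which keeps it apart from [bot] and from all
    constants of the configuration. *)
Definition rename (d v : name) : name := if `[< known v d >] then v else long v.
Definition unrename (d v : name) : name :=
  if `[< known v d >] then v else drop (size bot).+1 v.

Definition rel_doms (R : name) : seq name := nth [::] (unzip2 S) (index R (unzip1 S)).

Lemma rel_domsE R ds : (R, ds) \in S -> rel_doms R = ds.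
Proof.
move=> RS; have iS : index R (unzip1 S) < size S.
  by rewrite -(size_map fst) index_mem (map_f fst RS).
apply: (@S_uniq R) => //; have := mem_nth ([::], [::]) iS.
rewrite /rel_doms /unzip2 (nth_map ([::], [::])) //; case E: (nth _ _ _) => [R1 ds1] RS1.
have -> : R = R1.
  by rewrite -[R1]/(R1, ds1).1 -E -(nth_map _ [::]) // nth_index // (map_f fst RS).
by [].
Qed.

Definition rename_values (t ds : seq name) : seq name :=
  [seq rename p.2 p.1 | p <- zip t ds].

Definition rename_fact (f : fact) : fact := (f.1, rename_values f.2 (rel_doms f.1)).

Lemma mem_zip (T U : eqType) (s : seq T) (t : seq U) u v :
  (u, v) \in zip s t -> u \in s /\ v \in t.
Proof.
elim: s t => [|u1 s IHs] [|v1 t] //= h.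
have := h; rewrite -[_ \in _]/((_ == _) || _) => /orP [/eqP [-> ->]|/IHs [us vt]].
  by rewrite !mem_head.
by rewrite !inE us vt !orbT.
Qed.

Lemma known_C c d : known c d -> c \in C.
Proof. by case=> a [ds [aL _ /mem_zip [ca _]]]; exact: cL1 ca. Qed.

Lemma C_long c v : c \in C -> c <> long v.
Proof.
move=> /C_bot cb E; move: cb; rewrite E /long /= size_cat.
by rewrite -addSn ltnNge ltnW // leq_addr.
Qed.

(** Known constants occur in the configuration and are shorter than all renamed values, so the two
    cases cannot be confused. *)
Lemma renameK d : cancel (rename d) (unrename d).
Proof.
move=> v; rewrite /unrename /rename; case: (asboolP (known v d)) => [kv|nkv].
  by case: asboolP.
case: asboolP => [/known_C/C_long h|_]; first by have := h v.
by rewrite /long /= drop_size_cat.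
Qed.

(** The facts of the configuration are among the atoms [L1], so all their values are known. *)
Lemma rename_fact_conf f : f \in Conf -> rename_fact f = f.
Proof.
case: f => R t Rt; rewrite /rename_fact /=; congr pair.
have [ds RS sz] := SConf Rt; rewrite (rel_domsE RS).
have kn p : p \in zip t ds -> known p.1 p.2.
  move=> pz; exists (R, map Cst t), ds; split=> //; first exact: confL1.
  move: pz; elim: (t) (ds) => [|c s IHs] [|d ds'] //=.
  by rewrite !inE => /orP [/eqP ->|/IHs ->]; rewrite ?eqxx ?orbT.
rewrite /rename_values -[RHS](@unzip1_zip _ _ t ds) ?sz //.
by apply/eq_in_map => p /kn kp; rewrite /rename; case: asboolP.
Qed.

Lemma zip_rename t ds : size t = size ds ->
  zip (rename_values t ds) ds = [seq (rename p.2 p.1, p.2) | p <- zip t ds].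
Proof.
by rewrite /rename_values; elim: t ds => [|v t IHt] [|d ds] //= [/IHt ->].
Qed.

Lemma mask_zip (T U : Type) m (s : seq T) (t : seq U) :
  mask m (zip s t) = zip (mask m s) (mask m t).
Proof.
elim: m s t => [|b m IHm] [|u s] [|v t] //=; first by case: mask => //; case: b.
  by case: b; case: (mask m s) => //.
by case: b; rewrite IHm.
Qed.

Lemma rename_mask m t ds :
  mask m (rename_values t ds) = rename_values (mask m t) (mask m ds).
Proof. by rewrite /rename_values -mask_zip map_mask. Qed.

Definition rename_step (y : access * set fact) : access * set fact :=
  ((y.1.1, rename_values y.1.2 (mask (am_inputs y.1.1) (rel_doms (am_rel y.1.1)))),
   rename_fact @` y.2).

(** The renaming acts on pairs of a value and a domain, which is what the active domain consists of;
    accesses thus stay well-formed. *)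
Lemma rename_path I K p : is_instance S I -> K `<=` I -> path_ok S ACS I K p ->
  path_ok S ACS (rename_fact @` I) (rename_fact @` K) (map rename_step p) /\
  final (rename_fact @` K) (map rename_step p) = rename_fact @` (final K p).
Proof.
move=> SI; elim: p K => [//|[[m bind] Resp] p IHp] K KI /= [[mACS bsz] resp wf okp].
have [|okp' finp] := IHp _ _ okp.
  by rewrite subUset; split=> // -[R t] /resp [].
rewrite image_setU in okp' finp; split=> //.
have [ds RS msz] := wfACS mACS.
have bsz' : size bind = size (mask (am_inputs m) ds).
  by rewrite size_mask.
rewrite /= (rel_domsE RS); split=> //.
- split=> //=; rewrite /rename_values size_map size_zip -bsz' minnn.
  exact: bsz.
- move=> _ _ [[R t] RespR [<- <-]]; have [IR RE tE] := resp _ _ RespR.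
  split=> //; first by exists (R, t).
  by rewrite /= rename_mask tE RE (rel_domsE RS).
- move=> dep ds' /(S_uniq RS) <- pr.
  rewrite zip_rename // => /mapP [[v d] vd ->].
  have [R [t [ds1 [KR RS1 vt]]]] := wf dep _ RS _ vd.
  have [ds2 RS2 sz2] := SI _ _ (KI _ KR).
  rewrite -(S_uniq RS1 RS2) in sz2.
  exists R, (rename_values t ds1), ds1; split=> //.
    by exists (R, t); rewrite // /rename_fact /= (rel_domsE RS1).
  by rewrite zip_rename //; apply/mapP; exists (v, d).
Qed.

Lemma rename_tvals v v' us ds : size us = size ds ->
    (forall u d, (u, d) \in zip us ds -> rename d (tval v u) = tval v' u) ->
  rename_values (map (tval v) us) ds = map (tval v') us.
Proof.
rewrite /rename_values; elim: us ds => [|u us IH] [|d ds] //= [sz] h.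
rewrite IH // => [|u' d' ud]; first by rewrite h // mem_head.
by apply: h; rewrite inE ud orbT.
Qed.

(** A constant in [C] is no renamed value, so wherever it matches a renamed tuple it is known;
    undoing the renaming then gives a match of the original tuple. *)
Lemma unrename_tvals v us ds t : size us = size ds -> size t = size ds ->
    map (tval v) us = rename_values t ds ->
    (forall u d, (u, d) \in zip us ds ->
       match u with Var y => G2 y = Some d | Cst c => c \in C end) ->
  let v' y := if G2 y is Some d then unrename d (v y) else v y in
  t = map (tval v') us /\ forall c d, (Cst c, d) \in zip us ds -> known c d.
Proof.
move=> szu szt E h v'; elim: us ds t szu szt E h => [|u us IH] [|d ds] [|e t] //=.
move=> [szu] [szt] [uE E] h.
have [|tE kn] := IH _ _ szu szt E; first by move=> u' d' ud; apply: h; rewrite inE ud orbT.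
have := h u d (mem_head _ _); case: u uE {h} => [y|c] /= uE hu.
  split; last by move=> c d'; rewrite inE => /orP [/eqP []//|/kn].
  by rewrite -tE /v' hu uE renameK.
have ke : known e d.
  move: uE; rewrite /rename; case: asboolP => // _ cE.
  by have := C_long hu cE.
have ce : c = e by rewrite uE /rename; case: asboolP.
split; first by rewrite -tE ce.
by move=> c' d'; rewrite inE => /orP [/eqP [-> ->]|/kn //]; rewrite ce.
Qed.

Definition known_query2 : Prop := forall a ds c d,
  a \in L2 -> (a.1, ds) \in S -> (Cst c, d) \in zip a.2 ds -> known c d.

(* A constant unknown at a domain can be renamed at that domain without
   affecting the first query, after which the second one, which mentions it
   there, fails. *)
Lemma normalized_counterexample I p :
    is_instance S I -> [set` Conf] `<=` I -> path_ok S ACS I [set` Conf] p ->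
    (exists v, satisfied (final [set` Conf] p) v L1) ->
    ~ (known_query2 /\ exists v, satisfied (final [set` Conf] p) v L2) ->
  exists I' p', [/\ is_instance S I' /\ [set` Conf] `<=` I',
    path_ok S ACS I' [set` Conf] p',
    exists v, satisfied (final [set` Conf] p') v L1,
    ~ exists v, satisfied (final [set` Conf] p') v L2
  & forall R ds t e d, (R, ds) \in S -> final [set` Conf] p' (R, t) ->
      (e, d) \in zip t ds -> known e d \/ exists w, e = long w].
Proof.
move=> SI KI okp [v hv] nq2.
have [okp' finp'] := rename_path SI KI okp.
have confE : rename_fact @` [set` Conf] = [set` Conf].
  apply/seteqP; split=> [_ [f fC <-]|f fC]; first by rewrite rename_fact_conf.
  by exists f; rewrite ?rename_fact_conf.
rewrite confE in okp' finp'.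
have finI := final_sub KI okp.
exists (rename_fact @` I), (map rename_step p); split=> //.
- split.
    move=> _ _ [[R t] /SI [ds RS sz] [<- <-]]; exists ds => //=.
    by rewrite (rel_domsE RS) /rename_values size_map size_zip sz minnn.
  by rewrite -confE => _ [f /KI If <-]; exists f.
- exists (fun y => if G1 y is Some d then rename d (v y) else v y).
  rewrite finp' => a aL; exists (a.1, map (tval v) a.2); first exact: hv.
  have [ds [RS sz Ga]] := typed_atomP (tyL1 aL).
  rewrite /rename_fact /= (rel_domsE RS); congr pair.
  apply: rename_tvals => // -[y|c] d ud /=; first by rewrite (Ga _ _ ud).
  by rewrite /rename; case: asboolP => // -[]; exists a, ds.
(* A match of the second query in the renamed configuration is pulled back to the original one, and
   shows the constants of the query to be known where they occur. *)
- rewrite finp' => -[v0 hv0]; apply: nq2.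
  pose v' y := if G2 y is Some d then unrename d (v0 y) else v0 y.
  have key a ds : a \in L2 -> (a.1, ds) \in S ->
      final [set` Conf] p (a.1, map (tval v') a.2) /\
      forall c d, (Cst c, d) \in zip a.2 ds -> known c d.
    move=> aL RS; have [[R t] Kt [RE tE]] := hv0 _ aL.
    have [ds' [RS' sz Ga]] := typed_atomP (tyL2 aL).
    rewrite -(S_uniq RS RS') in sz Ga.
    have [ds1 RS1 szt] := SI _ _ (finI _ Kt).
    rewrite /= RE in RS1 tE Kt; rewrite -(S_uniq RS RS1) in szt.
    rewrite (rel_domsE RS) in tE.
    have [|tE' kn] := unrename_tvals sz szt (esym tE); last first.
      by split=> //; rewrite -/v' in tE'; rewrite -tE'.
    move=> [y|c] d ud; first exact: Ga.
    by apply: cL2 aL _; have [] := mem_zip ud.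
  split; first by move=> a ds c d aL RS; have [_] := key _ _ aL RS; exact.
  exists v' => a aL; have [ds [RS _ _]] := typed_atomP (tyL2 aL).
  by have [] := key _ _ aL RS.
- move=> R ds t e d RS; rewrite finp' => -[[R0 t0] Kt [RE tE]].
  rewrite /= in RE tE; subst R0; rewrite (rel_domsE RS) in tE; rewrite -tE.
  have [ds1 RS1 szt] := SI _ _ (finI _ Kt); rewrite -(S_uniq RS RS1) in szt.
  rewrite zip_rename // => /mapP [[v0 d0] vd [-> ->]] /=.
  by rewrite /rename; case: asboolP => kv; [left|right; exists v0].
Qed.

Lemma S'_uniq R ds ds' : (R, ds) \in S' -> (R, ds') \in S' -> ds = ds'.
Proof. exact: schema_uniq wf_S'. Qed.

Lemma S'_rel R ds : (R, ds) \in S -> (R, beta :: ds) \in S'.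
Proof. by move=> RS; apply/mem_S'; apply: Or41; exists ds. Qed.

Lemma S'_mark p : p \in P -> (pmark x p, [:: pdom p; mu]) \in S'.
Proof. by move=> pP; apply/mem_S'; apply: Or42; exists p. Qed.

Lemma S'_flag : (F, [:: beta]) \in S'.
Proof. by apply/mem_S'; apply: Or43. Qed.

Lemma S'_or : (N, [:: beta; beta; beta]) \in S'.
Proof. by apply/mem_S'; apply: Or44. Qed.

(** * The constructed access methods and the first access *)

Let ACS' := cq_methods x.

Lemma mem_methods m : m \in ACS' <->
  [\/ exists2 m0, m0 \in ACS & m = cq_method m0,
      exists2 p, p \in P & m = mark_method (pmark x p) | m = flag_method x].
Proof.
rewrite /ACS' /cq_methods !mem_cat; split.
  case/or3P => [/mem_map_iff [m0 ? ->]|/mem_map_iff [p ? ->]|].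
  - by apply: Or31; exists m0.
  - by apply: Or32; exists p.
  - by rewrite inE => /eqP ->; apply: Or33.
case=> [[m0 mA ->]|[p pP ->]|->]; apply/or3P.
- by apply: Or31; apply/mem_map_iff; exists m0.
- by apply: Or32; apply/mem_map_iff; exists p.
- by apply: Or33; rewrite mem_head.
Qed.

(** The table of disjunctions makes the tag 1 accessible from the start. *)
Lemma tag1_active K : K0 `<=` K -> active_domain S' K (tag1, beta).
Proof.
move=> K0K; exists N, [:: tag0; tag1; tag1], [:: beta; beta; beta]; split=> //.
- by apply/K0K/conf_or; rewrite !inE eqxx orbT.
- exact: S'_or.
- by rewrite !inE eqxx !orbT.
Qed.

Lemma flag_is_access : is_access ACS' (flag_access x).
Proof. by split=> //; apply/mem_methods; apply: Or33. Qed.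

Lemma flag_well_formed : well_formed S' K0 (flag_access x).
Proof.
move=> _ ds /= RS; rewrite -(S'_uniq S'_flag RS) /= => p; rewrite inE => /eqP ->.
exact: tag1_active.
Qed.

(** The only value in the response is the tag 1, which is accessible already. *)
Lemma flag_relevantE : long_term_relevant S' ACS' K0 (flag_access x) (cq_query x) <->
  exists I Resp p, [/\ is_instance S' I /\ K0 `<=` I, is_response I (flag_access x) Resp,
    path_ok S' ACS' I K0 p, holds (final K0 p `|` Resp) (cq_query x)
    & ~ holds (final K0 p) (cq_query x)].
Proof.
apply: long_term_relevantE; [exact: flag_is_access|exact: flag_well_formed|].
move=> I Resp resp SR p [R [t [ds [RespR RS pz]]]].
have [_ /= RF tE] := resp _ _ RespR; subst R.
rewrite -(S'_uniq S'_flag RS) in pz.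
case: t tE {RespR} pz => [|v t] //= [->].
by case: t => [|? ?]; rewrite /= inE => /eqP ->; exact: tag1_active.
Qed.

(** * From a counterexample to containment to the relevance of the first access *)

Definition tag_fact (f : fact) : fact := (f.1, tag1 :: f.2).

Definition tag_step (y : access * set fact) : access * set fact :=
  ((cq_method y.1.1, if am_dependent y.1.1 then tag1 :: y.1.2 else [:: tag1]),
   tag_fact @` y.2).

Lemma mask_falses (T U : Type) (m : seq T) (s : seq U) : mask [seq false | _ <- m] s = [::].
Proof. by elim: m s => [|b m IH] [|u s] //=. Qed.

Lemma count_falses (T : Type) (m : seq T) : count id [seq false | _ <- m] = 0.
Proof. by elim: m. Qed.

(** The tag 1 is accessible, and tagged facts provide the same values at the same domains as the
    original ones, so a path can be replayed at tag 1. *)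
Lemma tag_path I I' K K1 p : tag_fact @` I `<=` I' -> K0 `<=` K1 -> tag_fact @` K `<=` K1 ->
  path_ok S ACS I K p ->
  path_ok S' ACS' I' K1 (map tag_step p) /\
  final K1 (map tag_step p) = K1 `|` tag_fact @` (final K p).
Proof.
move=> II'; elim: p K K1 => [|[[m bind] Resp] p IHp] K K1 K0K1 KK1 /=.
  by move=> _; split=> //; rewrite setUidl.
case=> -[/= mACS bsz] resp wf okp.
have [| |okp' finp] := IHp (K `|` Resp) (K1 `|` tag_fact @` Resp) _ _ okp.
- by move=> f /K0K1; left.
- by rewrite image_setU; apply: setSU.
split; last first.
  rewrite finp -setUA; congr setU; rewrite setUidr //.
  apply: image_subset => f fR; apply: sub_final.
  by right.
split=> //.
- split; first by apply/mem_methods; apply: Or31; exists m.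
  by rewrite /= /cq_method /am_inputs /=; case: am_dependent; rewrite /= ?bsz // count_falses.
- move=> _ _ [[R t] RespR [<- <-]]; have [IR RE tE] := resp _ _ RespR.
  split=> //; first by apply: II'; exists (R, t).
  rewrite /= /cq_method /am_inputs /=; case: am_dependent => /=; last by rewrite mask_falses.
  by move: tE => /= ->.
- move=> _ ds'; have [ds RS msz] := wfACS mACS.
  move=> /(S'_uniq (S'_rel RS)) <- [v d] /=; case E: (am_dependent m); last first.
    rewrite /= inE => /orP [/eqP ->|]; first exact: tag1_active.
    by rewrite mask_falses.
  rewrite /= inE => /orP [/eqP ->|vd]; first exact: tag1_active.
  have [R [t [ds1 [KR RS1 vt]]]] := wf E _ RS _ vd.
  exists R, (tag1 :: t), (beta :: ds1); split; first by apply: KK1; exists (R, t).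
    exact: S'_rel.
  by rewrite /= inE vt orbT.
Qed.

Definition atom_fact (a : atom) : fact := (a.1, map (tval id) a.2).

Definition mark_step (a : atom) : access * set fact :=
  ((mark_method a.1, (atom_fact a).2), [set atom_fact a]).

(** Fetches the facts M(c, c): the first value is accessible by assumption, and the second one
    because of the dummy fact M(bot, c). *)
Lemma mark_path I K s : K0 `<=` K -> {subset s <= mark_atoms1 x} ->
  (forall c d, known c d -> active_domain S' K (c, d)) ->
  (forall a, a \in s -> I (atom_fact a)) ->
  path_ok S' ACS' I K (map mark_step s) /\
  final K (map mark_step s) = K `|` [set f | exists2 a, a \in s & f = atom_fact a].
Proof.
elim: s K => [|a s IHs] K K0K sub kn Is /=.
  split=> //; rewrite [X in _ `|` X](_ : _ = set0) ?setU0 //.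
  by apply/seteqP; split=> // f [].
have [||| |okp finp] := IHs (K `|` [set atom_fact a]).
- by move=> f /K0K; left.
- by move=> b bs; apply: sub; rewrite inE bs orbT.
- by move=> c d cd; rewrite active_domainU; left; exact: kn.
- by move=> b bs; apply: Is; rewrite inE bs orbT.
split; last first.
  rewrite finp -setUA; congr setU; apply/seteqP; split=> f.
    by case=> [->|[b bs ->]]; [exists a; rewrite ?mem_head|exists b; rewrite // inE bs orbT].
  case=> b; rewrite inE => /orP [/eqP -> ->|bs ->]; first by left.
  by right; exists b.
have [c [d [p [cd pP pd aE]]]] := (mem_mark_atoms1 a).1 (sub _ (mem_head _ _)).
split=> //.
- split; first by apply/mem_methods; apply: Or32; exists p; rewrite // aE.
  by rewrite aE.
- move=> R t [-> ->]; split=> //; last by rewrite aE.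
  exact: Is (mem_head _ _).
- move=> _ ds; rewrite aE /= => RS; rewrite -(S'_uniq (S'_mark pP) RS) /=.
  move=> q; rewrite !inE => /orP [] /eqP ->; first by rewrite pd; exact: kn.
  exists (pmark x p), [:: bot; c], [:: pdom p; mu]; split.
  + by apply: K0K; apply: conf_mark => //; exact: known_C cd.
  + exact: S'_mark.
  + by rewrite !inE eqxx orbT.
Qed.

Lemma conf_flagP t : K0 (F, t) -> t = [:: tag0].
Proof.
have off R ds : (R, ds) \in S -> R = F -> False by move=> /(S_off pos0) [].
case/conf_cases => [[t0 /SConf [ds RS _] _]|[ds RS _]|[r [c [rP _ FE _]]]|].
- by have := off _ _ RS erefl.
- by have := off _ _ RS erefl.
- by have [mF _] := mark_off rP; case: mF.
- by case=> [[_ ->]|[/F_neq_N]].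
Qed.

Lemma conf_orP t : K0 (N, t) -> t \in or_table.
Proof.
have off R ds : (R, ds) \in S -> R = N -> False by move=> /(S_off pos0) [].
case/conf_cases => [[t0 /SConf [ds RS _] _]|[ds RS _]|[r [c [rP _ NE _]]]|].
- by have := off _ _ RS erefl.
- by have := off _ _ RS erefl.
- by have [_ mN] := mark_off rP; case: mN.
- by case=> [[/esym/F_neq_N]|[]].
Qed.

Lemma conf_relP R ds b t : (R, ds) \in S -> K0 (R, b :: t) ->
  (b = tag1 /\ (R, t) \in Conf) \/ (b = tag0 /\ t = [seq bot | _ <- ds]).
Proof.
move=> RS; have [RF RN _] := S_off pos0 RS.
case/conf_cases => [[t0 Rt [-> ->]]|[ds' RS' [-> ->]]|[r [c [rP _ RE _]]]|].
- by left.
- by right; rewrite (S_uniq RS RS').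
- by have [_ _ /(_ rP)] := S_off r RS.
- by case=> [[/RF]|[/RN]].
Qed.

Lemma conf_markP p e c : p \in P -> K0 (pmark x p, [:: e; c]) -> e = bot.
Proof.
move=> pP; have [mF mN] := mark_off pP.
case/conf_cases => [[t0 /SConf [ds RS _] _]|[ds RS _]|[r [c' [_ _ _ []]]]|] //.
- by have [_ _ /(_ pP)] := S_off p RS.
- by have [_ _ /(_ pP)] := S_off p RS.
- by case=> [[/mF]|[/mN]].
Qed.

Lemma smap_cat_cons (T U : Type) (f : T -> seq T -> U) s u r :
  exists l1 l2, smap f (s ++ u :: r) = l1 ++ f u r :: l2 /\ size l1 = size s.
Proof.
elim: s => [|u0 s [l1 [l2 [E sz]]]] /=; first by exists [::], (smap f r).
by exists (f u0 (s ++ u :: r) :: l1), l2; rewrite E /= sz.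
Qed.

Lemma smap_eq_map (T U : Type) (f : T -> seq T -> U) (g : T -> U) us :
  (forall s u r, us = s ++ u :: r -> f u r = g u) -> smap f us = map g us.
Proof.
elim: us => //= u us IH h; rewrite (h [::] u us) // IH // => s u' r E.
by apply: (h (u :: s)); rewrite E.
Qed.

(** A normalized path is replayed at tag 1 and the facts M(c, c) are fetched. The flag then decides:
    the other disjuncts fail because [bot] occurs in no fact of tag 1. *)
Lemma relevant_of_counterexample I p :
    is_instance S I -> [set` Conf] `<=` I -> path_ok S ACS I [set` Conf] p ->
    (exists v, satisfied (final [set` Conf] p) v L1) ->
    ~ (exists v, satisfied (final [set` Conf] p) v L2) ->
  long_term_relevant S' ACS' K0 (flag_access x) (cq_query x).
Proof.
move=> SI0 KI0 okp0 h1 h2.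
have nq2 : ~ (known_query2 /\ exists v, satisfied (final [set` Conf] p) v L2).
  by case.
have {p SI0 KI0 okp0 h1 h2 nq2} [I' [p [[SI KI] okp [v hv] h2 norm]]] :=
  normalized_counterexample SI0 KI0 okp0 h1 nq2.
move: I' {I} SI KI okp => I SI KI okp.
apply/flag_relevantE.
set Kf := final [set` Conf] p in hv h2 norm.
have KfI : Kf `<=` I by exact: final_sub okp.
pose M := [set f | exists2 a, a \in mark_atoms1 x & f = atom_fact a].
pose I' := (K0 `|` tag_fact @` I) `|` M `|` [set (F, [:: tag1])].
have [|||okp1 fin1] := @tag_path I I' [set` Conf] K0 p _ _ _ okp.
- by move=> f If; left; left; right.
- by [].
- by move=> _ [[R t] Rt <-]; exact: conf_fact.
have [||||okp2 fin2] := @mark_path I' (K0 `|` tag_fact @` Kf) (mark_atoms1 x).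
- by move=> f; left.
- by [].
- move=> c d [a [ds [aL RS cd]]]; rewrite active_domainU; right.
  exists a.1, (tag1 :: map (tval v) a.2), (beta :: ds); split.
  + by exists (a.1, map (tval v) a.2); first exact: hv.
  + exact: S'_rel.
  + rewrite /= inE; apply/orP; right; move: cd; elim: (a.2) (ds) => [|u us IH] [|d' ds'] //=.
    by rewrite !inE => /orP [/eqP [<- ->]|/IH ->]; rewrite ?eqxx ?orbT.
- by move=> a aM; left; right; exists a.
pose q := map tag_step p ++ map mark_step (mark_atoms1 x).
have finq : final K0 q = K0 `|` tag_fact @` Kf `|` M by rewrite final_cat fin1 fin2.
have SI' : is_instance S' I'.
  move=> R t [[[/conf_instance //|[[R0 t0] /SI [ds RS sz] [<- <-]]]|[a aM [-> ->]]]|[-> ->]].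
  - by exists (beta :: ds); [exact: S'_rel|rewrite /= sz].
  - have [c [d [r [cd rP rd ->]]]] := (mem_mark_atoms1 a).1 aM.
    by exists [:: pdom r; mu]; first exact: S'_mark.
  - by exists [:: beta]; first exact: S'_flag.
have finI' : final K0 q `<=` I'.
  rewrite finq => f [[fK|[g /KfI Ig <-]]|fM]; first by left; left; left.
    by left; left; right; exists g.
  by left; right.
have K0q : K0 `<=` final K0 q by exact: sub_final.
have notF R ds : (R, ds) \in S -> R <> F by move=> /(S_off pos0) [].
have notN R ds : (R, ds) \in S -> R <> N by move=> /(S_off pos0) [].
have Moff a : a \in mark_atoms1 x -> exists2 r, r \in P & a.1 = pmark x r.
  by move=> /mem_mark_atoms1 [c [d [r [_ rP _ ->]]]]; exists r.
have qN t : final K0 q (N, t) -> t \in or_table.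
  rewrite finq => -[[/conf_orP//|[[R t0] /KfI /SI [ds RS _] [RN]]]|[a /Moff [r rP aE] [NE _]]].
    by case: (notN _ _ RS).
  by have [_ []] := mark_off rP; rewrite -aE -NE.
have noF : ~ final K0 q (F, [:: tag1]).
  rewrite finq => -[[/conf_flagP//|[[R t0] /KfI /SI [ds RS _] [RN]]]|[a /Moff [r rP aE] [FE _]]].
    by case: (notF _ _ RS).
  by have [[]] := mark_off rP; rewrite -aE -FE.
(* By its length, [bot] is neither a known constant nor a renamed value. *)
have nobot R ds t d : (R, ds) \in S -> Kf (R, t) -> (bot, d) \in zip t ds -> False.
  move=> RS Kt bt; have [/known_C/C_bot|[w /(congr1 size)]] := norm _ _ _ _ _ RS Kt bt.
    by rewrite ltnn.
  by rewrite /long /= size_cat; lia.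
have real R ds t : (R, ds) \in S -> final K0 q (R, tag1 :: t) -> Kf (R, t).
  move=> RS; rewrite finq => -[[/(conf_relP RS) [[_ Rt]|[]//]|[[R0 t0] Kt [<- <-]//]]|].
    exact: sub_final.
  case=> a /Moff [r rP aE] [RE _]; have [_ _ /(_ rP)] := S_off r RS.
  by rewrite RE aE.
exists I', [set (F, [:: tag1])], q; split.
- split=> //; first by move=> f; left; left; left.
- by move=> R t [-> ->]; split=> //; right.
- by apply/path_ok_cat; rewrite fin1.
- apply: query_complete.
  + by move=> f /K0q; left.
  + apply: is_instanceS SI' => f [/finI' //|]; by right.
  + exists v; split=> [a aL|c r cd rP]; left; rewrite finq.
      by left; right; exists (a.1, map (tval v) a.2); first exact: hv.
    right; exists (pmark x r, [:: Cst c; Cst c]) => //.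
    by apply/mem_mark_atoms1; exists c, (pdom r), r.
  + by apply: Or31; right.
move=> /(query_sound qN) [_ [//|[v2 [w [hq hw]]]|]].
  apply: h2; exists v2 => a aL.
  have [ds [RS _ _]] := typed_atomP (tyL2 aL).
  have Ka := real _ _ _ RS (hq _ aL).
  suff -> : map (tval v2) a.2 = values2 v2 w a by [].
  symmetry; apply: smap_eq_map => s [y|c] r aE //=.
  have [ds1 [d [s' [r' [RS1 dsE szl rP rE]]]]] := term_position (tyL2 aL) aE.
  have := hw _ _ _ _ aL aE; rewrite -rE finq.
  (* The fact found in M is a dummy M(bot, c), which would put [bot] into a fact of tag 1, or some
     M(c, c), so that the value is the constant itself. *)
  case=> [[/(conf_markP rP) wb|[[R t] /KfI /SI [ds2 RS2 _] [RE]]]|[b /mem_mark_atoms1]].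
  - have [l1 [l2 [vE szl1]]] := smap_cat_cons (fun u r => match u with
      Var y => v2 y | Cst c => w (mark (idx r) a.1) c end) s (Cst c) r.
    case: (@nobot _ _ _ d RS1 Ka); rewrite /values2 aE vE dsE -rE wb.
    by apply: zip_cat_cons; rewrite szl1.
  - by have [_ _ /(_ rP)] := S_off (a.1, (ds1, (idx r', d))) RS2; rewrite RE.
  - by case=> c' [d' [r1 [_ _ _ ->]]] [_ -> ->].
(* In a collision, the fact of tag 0 is a dummy, so the common value would be [bot]. *)
case=> R [ds [t [R' [ds' [t' [[e d] [/andP [RS RS'] Kt Kt' et et']]]]]]].
have [] := nobot _ _ _ d RS' (real _ _ _ RS' Kt').
move: Kt; rewrite finq => -[[/(conf_relP RS) [[]//|[_ tE]]|[? _ []//]]|].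
  suff <- : e = bot by [].
  move: et; rewrite tE => /mem_zip []; move=> /mapP [? _ ->]; by [].
case=> b /Moff [r rP bE] [RE _]; have [_ _ /(_ rP)] := S_off r RS.
by rewrite RE bE.
Qed.

(** * From the relevance of the first access to a counterexample to containment *)

Definition active_in_tags (K : set fact) : Prop :=
  forall v, active_domain S' K (v, beta) -> v = tag0 \/ v = tag1.

(** At the domains of [S], the relations M must not make accessible any value that no tagged fact
    provides there. *)
Definition active_in_facts (K : set fact) : Prop :=
  forall e d, d <> beta -> d <> mu -> active_domain S' K (e, d) ->
  exists R ds b t, [/\ (R, ds) \in S, K (R, b :: t) & (e, d) \in zip t ds].

Lemma zip_const_r (T U : eqType) (s : seq T) (u d : U) v t :
  (v, d) \in zip s (u :: t) -> d = u \/ d \in t.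
Proof. by case/mem_zip => _; rewrite inE => /orP [/eqP|]; [left|right]. Qed.

Lemma mu_beta : mu <> beta.
Proof. by move=> /(congr1 size) /=; lia. Qed.

(** The domain [beta] is new, so that it occurs only at tag attributes, at the flag and in the
    table. *)
Lemma facts_tags K : is_instance S' K ->
  (forall R ds b t, (R, ds) \in S -> K (R, b :: t) -> b = tag0 \/ b = tag1) ->
  (forall t v, K (F, t) \/ K (N, t) -> v \in t -> v = tag0 \/ v = tag1) ->
  active_in_tags K.
Proof.
move=> S'K hS hFN v [R [t [ds [KR RS vt]]]].
have [ds1 RS1 sz] := S'K _ _ KR; rewrite -(S'_uniq RS RS1) in sz.
case/mem_S': RS => [[ds0 RS0 dsE]|[p pP [RE dsE]]|[RE _]|[RE _]].
- move: vt sz KR; rewrite dsE; case: t => //= b t; rewrite inE => /orP [/eqP [->]|].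
    by move=> _; exact: hS RS0.
  by case/mem_zip => _ /(beta_fresh RS0) [].
- case/memP: (pP) => R0 [s [d [r [R0S pE]]]].
  have [pb _] : pdom p <> beta /\ pdom p <> mu.
    by apply: (beta_fresh R0S); rewrite pE mem_cat mem_head orbT.
  case/mem_zip: vt => _; rewrite dsE !inE => /orP [/eqP/esym//|/eqP/esym/mu_beta//].
- by case/mem_zip: vt => vt _; apply: hFN vt; left; rewrite -RE.
- by case/mem_zip: vt => vt _; apply: hFN vt; right; rewrite -RE.
Qed.

(** The invariant of the paths from the initial configuration: the only tags are 0 and 1, the
    relations M bring no new value, and the table of disjunctions is intact. *)
Record tame (K : set fact) : Prop := Tame {
  tame_conf : K0 `<=` K;
  tame_instance : is_instance S' K;
  tame_tags : active_in_tags K;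
  tame_facts : active_in_facts K;
  tame_or : forall t, K (N, t) -> t \in or_table
}.

Lemma pdom_fresh p : p \in P -> pdom p <> beta /\ pdom p <> mu.
Proof.
case/memP => R0 [s [d [r [R0S ->]]]].
by apply: (beta_fresh R0S); rewrite mem_cat mem_head orbT.
Qed.

Lemma tame_conf0 : tame K0.
Proof.
split=> //; first exact: conf_instance.
- apply: facts_tags; first exact: conf_instance.
    by move=> R ds b t RS /(conf_relP RS) [[->]|[->]]; [right|left].
  move=> t v [/conf_flagP ->|/conf_orP]; first by rewrite inE => /eqP; left.
  by rewrite !inE => /or3P [] /eqP ->; rewrite !inE => /or3P [] /eqP ->; auto.
- move=> e d db dm [R [t [ds [KR RS et]]]].
  case/mem_S': (RS) => [[ds0 RS0 dsE]|[p pP [RE dsE]]|[RE dsE]|[RE dsE]].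
  + subst ds; have [ds1 RS1 sz] := conf_instance KR.
    rewrite -(S'_uniq RS RS1) in sz; case: t KR et sz => //= b t KR.
    rewrite inE => /orP [/eqP [_ /db]//|et] _.
    by exists R, ds0, b, t.
  + subst R; have [ds1 RS1 sz] := conf_instance KR.
    rewrite -(S'_uniq RS RS1) dsE in sz; rewrite dsE in et.
    case: t KR et sz => [|e1 [|c []]] //= KR; rewrite !inE => /orP [/eqP [-> ->]|/eqP [_ /dm]] // _.
    (* The value [bot] of a dummy fact of M also occurs in the dummy fact of the relation to which
       the position belongs. *)
    rewrite (conf_markP pP KR); have [s [r [RS1' dsE1 _]]] := position_split pP.
    exists (prel p), (pdoms p), tag0, [seq bot | _ <- pdoms p]; split=> //.
      exact: conf_dummy.
    rewrite {2}dsE1 dsE1 map_cat; apply: zip_cat_cons.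
    by rewrite size_map.
  + by rewrite dsE in et; case: (zip_const_r et) => // /db.
  + by rewrite dsE in et; case/mem_zip: et => _; rewrite !inE => /or3P [] /eqP /db.
- exact: conf_orP.
Qed.

(** All constructed methods are dependent, with the tag or both attributes of M as inputs: a
    response brings neither a new tag nor, through M, a new value at a domain of [S]. *)
Lemma tame_step I K a Resp : is_instance S' I -> K `<=` I -> tame K ->
  is_access ACS' a -> is_response I a Resp -> well_formed S' K a -> tame (K `|` Resp).
Proof.
move=> SI KI [cK SK tK fK oK] [aA bsz] resp wf.
have SKR : is_instance S' (K `|` Resp).
  by apply: is_instanceS SI; rewrite subUset; split=> // -[R t] /resp [].
have dep : am_dependent a.1 by case/mem_methods: aA => [[m _ ->]|[p _ ->]|->].
have dep_act ds : (am_rel a.1, ds) \in S' ->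
    forall q, q \in zip a.2 (mask (am_inputs a.1) ds) -> active_domain S' K q.
  by move=> RS; exact: wf dep _ RS.
have respP R ds t : Resp (R, t) -> (R, ds) \in S' ->
  [/\ R = am_rel a.1, size t = size ds &
    forall q, q \in mask (am_inputs a.1) (zip t ds) -> active_domain S' K q].
  move=> RespR RS; have [IR RE tE] := resp _ _ RespR.
  have [ds1 RS1 sz] := SI _ _ IR; rewrite -(S'_uniq RS RS1) in sz.
  by split=> // q; rewrite mask_zip tE; apply: dep_act; rewrite -RE.
have tag_active R ds b t : (R, ds) \in S -> Resp (R, b :: t) -> active_domain S' K (b, beta).
  move=> RS RespR; have [RE _] := respP _ _ _ RespR (S'_rel RS); apply.
  case/mem_methods: aA RE => [[m mA ->] RE|[p pP ->] /= RE|-> /= RE].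
  - by rewrite /= mem_head.
  - by have [_ _ /(_ pP)] := S_off p RS.
  - by have [] := S_off pos0 RS.
have mark_active p e c : p \in P -> Resp (pmark x p, [:: e; c]) ->
    active_domain S' K (e, pdom p).
  move=> pP RespR; have [RE _] := respP _ _ _ RespR (S'_mark pP); apply.
  case/mem_methods: aA RE => [[m mA ->] /= RE|[q qP ->] /= RE|-> /= RE].
  - have [ds RS _] := wfACS mA; have [_ _ /(_ pP) h] := S_off p RS.
    by case: h; exact: esym RE.
  - by rewrite mem_head.
  - by have [h _] := mark_off pP; case: h.
have flag_active' v : Resp (F, [:: v]) -> active_domain S' K (v, beta).
  move=> RespR; have [RE _] := respP _ _ _ RespR S'_flag; apply.
  case/mem_methods: aA RE => [[m mA ->] /= RE|[q qP ->] /= RE|-> /= RE].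
  - have [ds RS _] := wfACS mA; have [h _ _] := S_off pos0 RS.
    by case: h; exact: esym RE.
  - by have [h _] := mark_off qP; case: h; exact: esym RE.
  - by rewrite mem_head.
(* No method accesses the table. *)
have noor t : Resp (N, t) -> False.
  move=> RespR; have [RE _ _] := respP _ _ _ RespR S'_or.
  case/mem_methods: aA RE => [[m mA ->] /= RE|[q qP ->] /= RE|-> /= RE].
  - have [ds RS _] := wfACS mA; have [_ h _] := S_off pos0 RS.
    by case: h; exact: esym RE.
  - by have [_ h] := mark_off qP; case: h; exact: esym RE.
  - by case: F_neq_N; exact: esym RE.
have kS R ds t : K (R, t) -> (R, ds) \in S' -> size t = size ds.
  by move=> KR RS; have [ds1 RS1 ->] := SK _ _ KR; rewrite (S'_uniq RS RS1).
have tags : active_in_tags (K `|` Resp).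
  apply: facts_tags => // [R ds b t RS [KR|/(tag_active _ _ _ _ RS) /tK //]|t v].
    apply: tK; exists R, (b :: t), (beta :: ds); split=> //; first exact: S'_rel.
    by rewrite /= mem_head.
  case=> -[Kt|Rt] vt.
  - have := kS _ _ _ Kt S'_flag; case: t Kt vt => [|u []] // Kt; rewrite inE => /eqP -> _.
    by apply: tK; exists F, [:: u], [:: beta]; split=> //; [exact: S'_flag|rewrite mem_head].
  - have [_ + _] := respP _ _ _ Rt S'_flag; case: t Rt vt => [|u []] // Rt; rewrite inE => /eqP -> _.
    by apply: tK; exact: flag_active'.
  - move: (oK _ Kt) vt; rewrite !inE => /or3P [] /eqP ->; rewrite !inE;
    by case/or3P => /eqP ->; auto.
  - by case: (noor _ Rt).
split=> //; first by move=> f /cK; left.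
  move=> e d db dm; rewrite active_domainU => -[/(fK _ _ db dm)|].
    by case=> R [ds [b [t [RS KR et]]]]; exists R, ds, b, t; split=> //; left.
  case=> R [t [ds [RespR RS et]]].
  have [_ sz _] := respP _ _ _ RespR RS.
  case/mem_S': (RS) => [[ds0 RS0 dsE]|[p pP [RE dsE]]|[RE dsE]|[RE dsE]].
  - subst ds; case: t RespR et sz => //= b t RespR.
    rewrite inE => /orP [/eqP [_ /db]//|et] _.
    by exists R, ds0, b, t; split=> //; right.
  - subst R ds; case: t RespR et sz => [|e1 [|c []]] //= RespR.
    rewrite !inE => /orP [/eqP [-> ->]|/eqP [_ /dm]] // _.
    have [pb pm] := pdom_fresh pP.
    have [R1 [ds1 [b [t [RS1 KR et]]]]] := fK _ _ pb pm (mark_active _ _ _ pP RespR).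
    by exists R1, ds1, b, t; split=> //; left.
  - by rewrite dsE in et; case: (zip_const_r et) => // /db.
  - by rewrite dsE in et; case/mem_zip: et => _; rewrite !inE => /or3P [] /eqP /db.
by move=> t [/oK//|/noor].
Qed.

Section Exploration.
Variables (I Kt : set fact).
Hypotheses (S'I : is_instance S' I) (KtI : Kt `<=` I) (K0Kt : K0 `<=` Kt)
  (ncoll : ~ collides Kt).

Definition real_facts : set fact :=
  [set f | (exists ds, (f.1, ds) \in S) /\ Kt (tag_fact f)].

(** Each fact may have its own path in the original setting; [derivable_all] combines them. *)
Definition derivable (f : fact) : Prop := exists q,
  path_ok S ACS real_facts [set` Conf] q /\ final [set` Conf] q f.

(** The paths are concatenated: accesses stay well-formed when the configuration grows. *)
Lemma derivable_all (T : eqType) (s : seq T) (Q : T -> fact -> Prop) :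
    (forall y, y \in s -> exists f, Q y f /\ derivable f) ->
  exists q, path_ok S ACS real_facts [set` Conf] q /\
    forall y, y \in s -> exists f, Q y f /\ final [set` Conf] q f.
Proof.
elim: s => [|y s IHs] h; first by exists [::]; split.
have [y' y's|q [okq qs]] := IHs; first by apply: h; rewrite inE y's orbT.
have [f [Qf [r [okr rf]]]] := h y (mem_head _ _).
exists (q ++ r); split.
  apply/path_ok_cat; split=> //; apply: path_ok_active okr.
  by apply: active_domainS; exact: sub_final.
move=> y'; rewrite inE final_cat => /orP [/eqP ->|/qs [f' [Qf' qf']]].
  exists f; split=> //; move: rf; rewrite -{1}(setUidr (@sub_final [set` Conf] q)).
  by rewrite finalU; left.
by exists f'; split=> //; exact: sub_final.
Qed.

Lemma real_instance : is_instance S real_facts.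
Proof.
move=> R t [[ds RS] /KtI IR]; exists ds => //.
exact: S'_size IR.
Qed.

Lemma conf_real : [set` Conf] `<=` real_facts.
Proof.
move=> [R t] Rt; have [ds RS _] := SConf Rt; split; first by exists ds.
exact/K0Kt/conf_fact.
Qed.

(** First the facts that provide the input values are derived, then the fact is fetched alone by an
    access bound to its own input values. *)
Lemma derivable_step m R t ds : m \in ACS -> R = am_rel m -> (R, ds) \in S ->
    real_facts (R, t) ->
    (am_dependent m -> forall q, q \in zip (mask (am_inputs m) t) (mask (am_inputs m) ds) ->
      exists f, (exists2 ds', (f.1, ds') \in S & q \in zip f.2 ds') /\ derivable f) ->
  derivable (R, t).
Proof.
move=> mA RE RS KR dep; have [ds1 RS1 sz] := real_instance KR.
rewrite -(S_uniq RS RS1) in sz; have [ds2 RS2 msz] := wfACS mA.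
rewrite -RE in RS2; rewrite -(S_uniq RS RS2) in msz.
have [q [okq qs]] : exists q, path_ok S ACS real_facts [set` Conf] q /\
    (am_dependent m -> forall y, y \in zip (mask (am_inputs m) t) (mask (am_inputs m) ds) ->
    exists f, (exists2 ds', (f.1, ds') \in S & y \in zip f.2 ds') /\ final [set` Conf] q f).
  case: (am_dependent m) dep => [/(_ isT)/derivable_all [q [okq qs]]|_].
    by exists q; split.
  by exists [::]; split.
exists (q ++ [:: ((m, mask (am_inputs m) t), [set (R, t)])]); split; last first.
  by rewrite final_cat /=; right.
apply/path_ok_cat; split=> //=; split=> //.
- by split; rewrite //= size_mask // sz.
- by move=> _ _ [-> ->].
- move=> /qs {}qs ds' /=; rewrite -RE => /(S_uniq RS) <- y /qs [[R1 t1] [[ds3 RS3 y3] qf]].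
  by exists R1, t1, ds3.
Qed.

(** The values needed to obtain a fact of tag 1 occur in earlier facts of [S]. In the absence of
    collisions these have tag 1 as well, hence are derivable by induction on the path. *)
Lemma explore p K : tame K -> path_ok S' ACS' I K p -> final K p = Kt ->
    (forall R ds t, (R, ds) \in S -> K (R, tag1 :: t) -> derivable (R, t)) ->
  tame Kt /\ forall f, real_facts f -> derivable f.
Proof.
elim: p K => [|[a Resp] p IHp] K tK /=.
  move=> _ KE h; rewrite KE in tK h; split=> // -[R t] [[ds RS]]; exact: h RS.
case=> aA resp wf okp finp der.
have KRKt : K `|` Resp `<=` Kt by rewrite -finp; exact: sub_final.
have KI : K `<=` I by move=> f Kf; apply/KtI/KRKt; left.
apply: (IHp (K `|` Resp)) => //; first exact: tame_step tK aA resp wf.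
move=> R ds t RS [KR|RespR]; first exact: der RS KR.
have [_ RE tE] := resp _ _ RespR.
have KtR : Kt (R, tag1 :: t) by apply: KRKt; right.
case: a aA RE tE wf {resp okp} => m' bind [/= /mem_methods m'A _] RE tE wf.
case: m'A => [[m mA mE]|[p' pP mE]|mE]; rewrite mE /= in RE.
- apply: (derivable_step mA RE RS); first by split; first by exists ds.
  move=> dep [v d] vd.
  (* The constructed method has the inputs of the original dependent one, and tameness finds their
     values in facts of [S]. *)
  have [R1 [ds1 [b [t1 [RS1 KR1 vt1]]]]] : exists R1 ds1 b t1,
      [/\ (R1, ds1) \in S, K (R1, b :: t1) & (v, d) \in zip t1 ds1].
    have [db dm] : d <> beta /\ d <> mu.
      by apply: beta_fresh RS _; have [_ /mem_mask] := mem_zip vd.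
    apply: tame_facts tK _ _ db dm _; apply: wf; first by rewrite mE.
      by rewrite mE /= -/(am_rel m) -RE; exact: S'_rel RS.
    move: tE; rewrite mE /cq_method /am_inputs /= dep => <- /=.
    by rewrite inE vd orbT.
  have [b0|b1] : b = tag0 \/ b = tag1.
    apply: tame_tags tK _ _; exists R1, (b :: t1), (beta :: ds1); split=> //.
      exact: S'_rel.
    by rewrite /= mem_head.
  (* A value passed from a fact of tag 0 to one of tag 1 would be a collision. *)
  - case: ncoll; exists R1, ds1, t1, R, ds, t, (v, d); split=> //.
    + by rewrite RS1.
    + by apply: KRKt; left; rewrite -b0.
    + by apply: (@mem_mask _ _ (am_inputs m)); rewrite mask_zip.
  - exists (R1, t1); split; first by exists ds1.
    by apply: der RS1 _; rewrite -b1.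
- by have [_ _ /(_ pP) []] := S_off p' RS.
- by have [[]] := S_off pos0 RS.
Qed.
End Exploration.

(** The response concerns the flag only, so the first query holds without it, whereas the second
    query and the collisions must fail. Without collisions, the facts of tag 1 are derivable in the
    original setting. *)
Lemma counterexample_of_relevant :
    long_term_relevant S' ACS' K0 (flag_access x) (cq_query x) ->
  exists I p, [/\ is_instance S I /\ [set` Conf] `<=` I, path_ok S ACS I [set` Conf] p,
    exists v, satisfied (final [set` Conf] p) v L1
  & ~ exists v, satisfied (final [set` Conf] p) v L2].
Proof.
case/flag_relevantE => I [Resp [p [[SI K0I] resp okp hq nhq]]].
set Kt := final K0 p in hq nhq.
have KtI : Kt `<=` I by exact: final_sub okp.
have SKt : is_instance S' Kt := is_instanceS KtI SI.
have K0Kt : K0 `<=` Kt by exact: sub_final.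
have respF R t : Resp (R, t) -> R = F by case/resp.
have tKt : tame Kt.
  rewrite /Kt; elim: p K0 tame_conf0 K0I okp {hq nhq Kt KtI SKt K0Kt} => [|[a Re] p IHp] K tK KI //=.
  case=> aA re wf okp; apply: IHp okp; first exact: tame_step tK aA re wf.
  by rewrite subUset; split=> // -[R t] /re [].
have KRN t : (Kt `|` Resp) (N, t) -> t \in or_table.
  by case=> [/(tame_or tKt)//|/respF/esym/F_neq_N].
have [[v [h1 hm]] _] := query_sound KRN hq.
have q1 : query1_holds Kt.
  exists v; split=> [a aL|c r cr rP].
    have [//|/respF aF] := h1 _ aL.
    by have [ds [RS _ _]] := typed_atomP (tyL1 aL); have [] := S_off pos0 RS.
  by have [//|/respF mF] := hm _ _ cr rP; have [] := mark_off rP.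
have ncoll : ~ collides Kt.
  by move=> coll; apply: nhq; apply: query_complete => //; apply: Or33.
have nq2 : ~ query2_holds Kt.
  by move=> q2; apply: nhq; apply: query_complete => //; apply: Or32.
have [|_ der] := explore SI KtI ncoll tame_conf0 okp erefl.
  move=> R ds t RS /(conf_relP RS) [[_ Rt]|[]//].
  by exists [::].
have [q [okq qL]] : exists q, path_ok S ACS (real_facts Kt) [set` Conf] q /\
    forall a, a \in L1 -> exists f, f = (a.1, map (tval v) a.2) /\ final [set` Conf] q f.
  apply: derivable_all => a aL; exists (a.1, map (tval v) a.2); split=> //.
  apply: der; have [ds [RS _ _]] := typed_atomP (tyL1 aL).
  split; first by exists ds.
  by have [//|/respF aF] := h1 _ aL; have [] := S_off pos0 RS.
have Sr := real_instance SI KtI.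
have Cr := conf_real K0Kt.
have [||I' [p' [SI' okp' ? ? _]]] := normalized_counterexample Sr Cr okq.
- by exists v => a /qL [f [->]].
(* The required facts M(c, c) let each known constant stand for itself. *)
- case=> kn [v2 hv2]; apply: nq2; exists v2, (fun _ c => c); split.
    move=> a aL; have [_] : real_facts Kt (a.1, map (tval v2) a.2).
      exact: (final_sub Cr okq) (hv2 _ aL).
    congr (Kt (_, _ :: _)); rewrite /values2 -smap_map.
    by apply: eq_smap => -[].
  move=> a s c r aL aE.
  have [ds [d [s' [r' [RS dsE szs rP <-]]]]] := term_position (tyL2 aL) aE.
  have cdk : known c d.
    by apply: (kn a ds) => //; rewrite aE dsE zip_cat_cons.
  by have [//|/respF mF] := hm c (a.1, (ds, (idx r', d))) cdk rP; have [] := mark_off rP.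
by exists I', p'.
Qed.

(** * Validity of the constructed input and the reductions *)

Lemma methods_wf m : m \in ACS' -> wf_method S' m.
Proof.
case/mem_methods => [[m0 m0A ->]|[p pP ->]|->].
- have [ds RS sz] := wfACS m0A; exists (beta :: ds); first exact: S'_rel.
  by rewrite /cq_method /am_inputs /=; case: am_dependent; rewrite /= ?size_map sz.
- by exists [:: pdom p; mu]; first exact: S'_mark.
- by exists [:: beta]; first exact: S'_flag.
Qed.

Lemma conf_value R t c : K0 (R, t) -> c \in t -> c \in flatten (unzip2 (cq_conf x)).
Proof. by move=> Rt ct; apply/flattenP; exists t => //; exact: (map_f snd Rt). Qed.

Lemma conf_tag0 : tag0 \in flatten (unzip2 (cq_conf x)).
Proof. by apply: conf_value conf_flag _; exact: mem_head. Qed.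

Lemma conf_tag1 : tag1 \in flatten (unzip2 (cq_conf x)).
Proof.
have : K0 (N, [:: tag0; tag1; tag1]) by apply: conf_or; rewrite !inE eqxx orbT.
by move/conf_value; apply; rewrite !inE eqxx.
Qed.

Lemma conf_constant c : c \in C -> c \in flatten (unzip2 (cq_conf x)).
Proof.
case/flattenP => t /mapP [[R t'] Rt ->] ct.
by apply: conf_value (conf_fact Rt) _; rewrite inE ct orbT.
Qed.

Lemma query_constants : {subset constants (cq_query x) <= flatten (unzip2 (cq_conf x))}.
Proof.
move=> c /constants_close [a].
pose ok (a : atom) := forall c, Cst c \in a.2 -> c \in flatten (unzip2 (cq_conf x)).
suff h a0 : a0 \in final_atom x :: cq_atoms x -> ok a0 by move=> /h; apply.
apply: cq_atoms_ind => {c a a0} [a aL|c p cd pP|a aL|a s c r aL aE|s pq r _ b bc|b bf|] c'.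
- rewrite inE => /orP [/eqP [->]|]; first exact: conf_tag1.
  by case/mapP => -[y|c] // ca [->]; apply: conf_constant; exact: cL1 ca.
- by rewrite !inE => /orP [] /eqP [->]; exact: conf_constant (known_C cd).
- by rewrite inE => /orP [/eqP//|/mem_smap [s [[y|c] [r []]]]].
- rewrite !inE => /eqP [->]; apply: conf_constant.
  by apply: cL2 aL _; rewrite aE mem_cat mem_head orbT.
- have terms n k p : Cst c' \in collision_terms n k p -> False.
    by case/mem_smap => s0 [d [r0 [_]]]; case: ifP.
  move: bc; rewrite !inE => /or3P [] /eqP -> /=; rewrite !inE.
  + by case/orP => [/eqP [->]|/terms //]; exact: conf_tag0.
  + by case/orP => [/eqP //|/terms].
  + by [].
- by move: bf; rewrite !inE => /orP [] /eqP ->; rewrite !inE.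
- by rewrite !inE => /or3P [] /eqP // [->]; [exact: conf_tag0|exact: conf_tag1].
Qed.

Lemma cq_reduction_valid : @valid (non_relevance is_cq) (cq_reduction x).
Proof.
split; first split.
- exact: wf_S'.
- exact: methods_wf.
- exact: conf_instance.
- exact: flag_is_access.
- exact: flag_well_formed.
- exact: is_cq_close.
- by split; [apply: typed_close; exact: typed_query|exact: query_constants].
Qed.

End Correctness.

Lemma cq_reduction_correct (x : containment_input) (P := containment is_cq)
    (P' := non_relevance is_cq) :
  @valid P x -> @valid P' (cq_reduction x) /\ (@yes P x <-> @yes P' (cq_reduction x)).
Proof.
move=> [[wfS wfACS SConf] [cq1 cq2] [ty1 c1] [ty2 c2]].
have [G1 tyG1] := typed_atoms cq1 ty1; have [G2 tyG2] := typed_atoms cq2 ty2.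
have tyL1 a : a \in atoms1 x -> typed_atom (cont_schema x) G1 a.
  rewrite mem_cat mem_rev => /orP [/tyG1 //|/mapP [[R t] Rt ->]].
  have [ds RS sz] := SConf _ _ Rt.
  apply: typed_atomI RS _ _; rewrite ?size_map // => y d.
  by case/zip_mapP.
have tyL2 a : a \in atoms2 x -> typed_atom (cont_schema x) G2 a.
  by rewrite mem_rev => /tyG2.
have cL1 a c : a \in atoms1 x -> Cst c \in a.2 -> c \in flatten (unzip2 (cont_conf x)).
  rewrite mem_cat mem_rev => /orP [aq ca|/mapP [[R t] Rt -> /mapP [c' ct [->]]]].
    by apply: c1; exact: constants_atoms cq1 aq ca.
  by apply/flattenP; exists t => //; exact: (map_f snd Rt).
have cL2 a c : a \in atoms2 x -> Cst c \in a.2 -> c \in flatten (unzip2 (cont_conf x)).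
  by rewrite mem_rev => aq ca; apply: c2; exact: constants_atoms cq2 aq ca.
have confL1 R t : (R, t) \in cont_conf x -> (R, map Cst t) \in atoms1 x.
  by move=> Rt; rewrite mem_cat; apply/orP; right; apply/mapP; exists (R, t).
(* The added ground atoms hold in every configuration that contains the initial one. *)
have hq1 K : [set` cont_conf x] `<=` K ->
    holds K (cont_query1 x) <-> exists v, satisfied K v (atoms1 x).
  move=> CK; rewrite (holds_cq K cq1 ty1); split=> -[v hv]; exists v => a.
    rewrite mem_cat mem_rev => /orP [/hv //|/mapP [[R t] Rt ->]] /=.
    by rewrite -map_comp map_id; exact: CK.
  by move=> aq; apply: hv; rewrite mem_cat mem_rev aq.
have hq2 K : holds K (cont_query2 x) <-> exists v, satisfied K v (atoms2 x).
  rewrite (holds_cq K cq2 ty2); split=> -[v hv]; exists v => a aq; apply: hv.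
    by rewrite mem_rev in aq.
  by rewrite mem_rev.
split; first exact: (cq_reduction_valid wfS wfACS SConf tyL1 tyL2 cL1 cL2).
split=> [cont /= ltr|nltr K' [I [p [SI CI /is_pathE okp K'E]]] /= h1].
  have [I [p [[SI CI] okp h1 []]]] :=
    counterexample_of_relevant wfS wfACS SConf tyL1 tyL2 cL1 cL2 confL1 ltr.
  apply/hq2/cont; last by apply/hq1 => //; exact: sub_final.
  by exists I, p; split=> //; apply/is_pathE.
apply: contrapT => h2; apply: nltr.
apply: (relevant_of_counterexample wfS wfACS SConf tyL1 tyL2 cL1 cL2 confL1 SI CI okp).
  by rewrite -K'E; apply/hq1 => //; rewrite K'E; exact: sub_final.
by rewrite -K'E => /hq2.
Qed.

Theorem proposition3p3 :
  (exists f : input (containment is_cq) -> input (non_relevance is_cq),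
     polytime_reduction f) /\
  (exists f : input (containment is_pq) -> input (non_relevance is_pq),
     polytime_reduction f /\
     forall x : input (containment is_pq), valid x ->
       rel_conf (f x) = cont_conf x).
Proof.
split.
  exists cq_reduction; split; last exact: cq_reduction_correct.
  apply: polytime_of_ptime cq_program_ptime _ => x _.
  exact: cq_program_code.
exists pq_reduction; split=> //; split; last exact: pq_reduction_correct.
apply: polytime_of_ptime pq_program_ptime _ => x _.
exact: pq_program_code.
Qed.
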